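(* Suppose the flow $\frac{du}{dt}=f(u,s)$ on $\mathbb{R}^m$ is uniform-hyperbolic and has a global compact attractor. Then on every trajectory $u(t)$, $t\ge 0$, on the attractor there exists a unique adjoint shadowing direction $\overline{v}:[0,\infty)\to\mathbb{R}^m$. Further, the adjoint sensitivity formula holds: $$\frac{dJ_{avg}}{ds}=\lim_{T\to\infty}\frac1T\int_0^T\left(\langle \overline{v},f_s\rangle+J_s\right)dt .$$
   Context: Setting. $f:\mathbb{R}^m\times\mathbb{R}\to\mathbb{R}^m$ and $J:\mathbb{R}^m\times\mathbb{R}\to\mathbb{R}$ are smooth functions of the state $u\in\mathbb{R}^m$ and the parameter $s\in\mathbb{R}$. A trajectory is a solution $u(t)$ of $du/dt=f(u,s)$, $u(0)=u_0$. The objective is $J_{avg}:=\lim_{T\to\infty}\frac1T\int_0^T J(u(t),s)\,dt$; since the system has a global attractor it is assumed throughout that $J_{avg}$ depends only on $s$ and not on $u_0$. Subscripts $u,s$ denote partial derivatives (e.g. $f_u=\partial f/\partial u$ is the Jacobian), evaluated along the trajectory at $(u(t),s)$. $\langle\cdot,\cdot\rangle$ and $\|\cdot\|$ are the Euclidean inner product and norm, and $\cdot^T$ on matrices is the transpose. Tangent flow operator. $D_{t_1}^{t_2}$ is the linear operator on $\mathbb{R}^m$ sending $w_1$ to $w(t_2)$, where $w$ solves $dw/dt=f_u w$ with $w(t_1)=w_1$. Uniform hyperbolicity. There are $C\in(0,\infty)$ and $\lambda>0$ such that for all $u$ on the attractor there is a splitting of the tangent space $\mathbb{R}^m=V^+(u)\oplus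 V^-(u)\oplus V^0(u)$ into unstable, stable and neutral subspaces such that, on the trajectory passing $u$ at time $0$: (1) for $v\in V^+(u)$ and $t\le 0$, $\|D_0^t v\|\le Ce^{-\lambda|t|}\|v\|$; (2) for $v\in V^-(u)$ and $t\ge 0$, $\|D_0^t v\|\le Ce^{-\lambda|t|}\|v\|$; (3) every $v\in V^0(u)$ equals $a f(u)$ for some $a\in\mathbb{R}$. The neutral subspace $V^0(u)$ is one-dimensional, spanned by $f(u)\neq0$. Unstable adjoint subspace. Let $P^+(t)$ be the projection onto $V^+(u(t))$ along $V^-(u(t))\oplus V^0(u(t))$, and $\overline{P}^+(t):=(P^+(t))^T$. The unstable adjoint subspace at time $t$ is the image of $\overline{P}^+(t)$, and the component of a vector $x$ in it is $\overline{P}^+(t)x$. Adjoint shadowing direction. On a trajectory $u(t)$, $t\ge0$, on the attractor, an adjoint shadowing direction is a function $\overline{v}:[0,\infty)\to\mathbb{R}^m$ such that: (1) $\frac{d\overline{v}}{dt}+f_u^T\overline{v}=-J_u$; (2) $\overline{v}(0)$ has zero component in the unstable adjoint subspace; (3) $\|\overline{v}(t)\|$ is bounded by a constant for all $t\ge0$; (4) $\lim_{T\to\infty}\frac1T\int_0^T\langle\overline{v}(t),f(t)\rangle\,dt=0$, where $f(t)=f(u(t),s)$.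
   Formalization: The attractor is global relative to an open set U of initial states (on all of R^m it would contain an equilibrium, contradicting f(u)≠0), and V^+ and V^- are required to be invariant under the tangent flow, without which existence can fail. *)

(* Defs.v *)
From HB Require Import structures.
From mathcomp Require Import all_boot all_order all_algebra.
From mathcomp Require Import all_classical all_reals all_analysis.

Set Implicit Arguments.
Unset Strict Implicit.
Unset Printing Implicit Defensive.

Import Order.TTheory GRing.Theory Num.Theory.
Import numFieldNormedType.Exports.

Local Open Scope classical_set_scope.
Local Open Scope ring_scope.

(* R^m is 'rV[R]_m.  Its library norm `|x| is the max norm, so the Euclidean
   inner product and norm are introduced here; the topology is the same.
   Vectors being rows, a matrix acts on the right: A w is written w *m A, with
   A stored in the transposed layout; this is also the layout of the library's
   jacobian.  As <w *m A, v> = <w, v *m A^T>, the Euclidean adjoint is still the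
   transpose. *)
Section Euclidean.
Variables (R : realType) (m : nat).
Implicit Types x y : 'rV[R]_m.

Definition dot x y : R := \sum_(i < m) x 0 i * y 0 i.

Definition enorm x : R := Num.sqrt (dot x x).

End Euclidean.

Section Calculus.
Variable R : realType.

Fixpoint Ck (V W : normedModType R) (k : nat) (g : V -> W) : Prop :=
  match k with
  | 0 => continuous g
  | k'.+1 => (forall x, differentiable g x) /\
             (forall v, Ck k' (fun x => 'D_v g x))
  end.

Definition smooth (V W : normedModType R) (g : V -> W) : Prop :=
  forall k, Ck k g.

(* g'(t) = l for a function g on [0, +oo[, one-sided when t = 0; the values of
   g at negative times are irrelevant. *)
Definition is_derive_ge0 (V : normedModType R) (g : R -> V) (t : R) (l : V) :=
  h^-1 *: (g (t + h) - g t)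
    @[h --> within [set h | 0 <= t + h] (0 : R)^'] --> l.

Definition time_average (g : R -> R) (T : R) : R :=
  T^-1 * Rintegral (@lebesgue_measure R) `[0, T] g.

Definition has_time_average (g : R -> R) (l : R) : Prop :=
  time_average g T @[T --> +oo] --> l.

End Calculus.

Section Dynamics.
Variables (R : realType) (m : nat).
Variables (f : 'rV[R]_m * R -> 'rV[R]_m) (J : 'rV[R]_m * R -> R).
Implicit Types (u : 'rV[R]_m) (s : R).

Definition f_u u s : 'M[R]_m := jacobian (fun y : 'rV[R]_m => f (y, s)) u.

Definition f_s u s : 'rV[R]_m := derive1 (fun r : R => f (u, r)) s.

Definition J_u u s : 'rV[R]_m :=
  \row_(i < m) 'D_(delta_mx 0 i) (fun y : 'rV[R]_m => J (y, s)) u.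

Definition J_s u s : R := derive1 (fun r : R => J (u, r)) s.

Definition trajectory s (x : R -> 'rV[R]_m) : Prop :=
  forall t, 0 <= t -> is_derive_ge0 x t (f (x t, s)).

Definition full_orbit s (x : R -> 'rV[R]_m) : Prop :=
  forall t : R, is_derive t (1 : R) x (f (x t, s)).

(* [tangent_flow s x t1 t2 w1 w2] is the graph D_{t1}^{t2} w1 = w2 of the
   tangent flow operator along the full orbit x. *)
Definition tangent_flow s (x : R -> 'rV[R]_m) (t1 t2 : R)
    (w1 w2 : 'rV[R]_m) : Prop :=
  exists w : R -> 'rV[R]_m,
    [/\ forall t : R, is_derive t (1 : R) w (w t *m f_u (x t) s),
        w t1 = w1 & w t2 = w2].

(* The invariance clause says that A is carried onto itself by the flow at all
   positive and negative times (solutions are unique, f being smooth).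
   The attractor is global relative to the open set U of initial conditions;
   for U = setT compact subsets of U may be replaced by bounded ones, and this
   is the usual global attractor.  U is kept general because a global attractor
   in all of R^m always contains an equilibrium (Brouwer), where f = 0, which
   uniform hyperbolicity with a one-dimensional neutral direction forbids. *)
Definition global_attractor s (U A : set 'rV[R]_m) : Prop :=
  [/\ compact A,
      A `<=` U,
      forall u, A u -> exists x : R -> 'rV[R]_m,
        [/\ full_orbit s x, x 0 = u & forall t, A (x t)] &
      forall K : set 'rV[R]_m, compact K -> K `<=` U ->
        forall e : R, 0 < e -> exists2 T : R, 0 <= T &
          forall x : R -> 'rV[R]_m, trajectory s x -> K (x 0) ->
          forall t, T <= t -> exists2 a, A a & enorm (x t - a) < e].

(* Jav is the function s |-> J_avg: at every s, from every initial condition in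
   U, the average exists along the trajectory and is the same number. *)
Definition is_J_avg (U : set 'rV[R]_m) (Jav : R -> R) : Prop :=
  forall s u, U u -> exists x : R -> 'rV[R]_m,
    [/\ trajectory s x, x 0 = u &
        has_time_average (fun t => J (x t, s)) (Jav s)].

(* V^0(u), as a row space *)
Definition neutral u s : 'M[R]_m := <<f (u, s)>>%MS.

(* Vp u and Vm u are the matrices whose row spaces are V^+(u) and V^-(u).  As
   usual for hyperbolic splittings, V^+ and V^- are invariant under the tangent
   flow; V^0 is so automatically. *)
Record uniform_hyperbolic s (A : set 'rV[R]_m)
    (Vp Vm : 'rV[R]_m -> 'M[R]_m) : Prop := UniformHyperbolic {
  neutral_neq0 : forall u, A u -> f (u, s) != 0;
  splitting_direct : forall u, A u -> mxdirect (Vp u + Vm u + neutral u s);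
  splitting_full : forall u, A u -> row_full (Vp u + Vm u + neutral u s)%MS;
  splitting_invariant : forall (x : R -> 'rV[R]_m) (t : R) v w,
    full_orbit s x -> A (x 0) -> tangent_flow s x 0 t v w ->
    ((v <= Vp (x 0))%MS -> (w <= Vp (x t))%MS) /\
    ((v <= Vm (x 0))%MS -> (w <= Vm (x t))%MS);
  splitting_contracting : exists C lambda : R, [/\ 0 < C, 0 < lambda &
    forall (x : R -> 'rV[R]_m) (t : R) v w,
    full_orbit s x -> A (x 0) -> tangent_flow s x 0 t v w ->
    ((v <= Vp (x 0))%MS -> t <= 0 ->
       enorm w <= C * expR (- lambda * `|t|) * enorm v) /\
    ((v <= Vm (x 0))%MS -> 0 <= t ->
       enorm w <= C * expR (- lambda * `|t|) * enorm v)] }.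

Definition unstable_proj (Vp Vm : 'rV[R]_m -> 'M[R]_m) u s : 'M[R]_m :=
  proj_mx (Vp u) (Vm u + neutral u s)%MS.

Definition adjoint_unstable_proj (Vp Vm : 'rV[R]_m -> 'M[R]_m) u s : 'M[R]_m :=
  (unstable_proj Vp Vm u s)^T.

(* As v' + f_u^T v = - J_u is solved for v', the derivative of v exists at every
   time t >= 0. *)
Record adjoint_shadowing s (Vp Vm : 'rV[R]_m -> 'M[R]_m)
    (x v : R -> 'rV[R]_m) : Prop := AdjointShadowing {
  adjoint_equation : forall t, 0 <= t -> exists2 v' : 'rV[R]_m,
    is_derive_ge0 v t v' & v' + v t *m (f_u (x t) s)^T = - J_u (x t) s;
  adjoint_unstable0 : v 0 *m adjoint_unstable_proj Vp Vm (x 0) s = 0;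
  adjoint_bounded : exists B : R, forall t, 0 <= t -> enorm (v t) <= B;
  adjoint_neutral0 : has_time_average (fun t => dot (v t) (f (x t, s))) 0 }.

End Dynamics.

(* Main.v *)
From mathcomp Require Import all_boot all_order all_algebra.
From mathcomp Require Import all_classical all_reals all_analysis.
From mathcomp Require Import ring lra zify ssrAC.
Require Import Defs.

(** The proof is quantitative and follows a single orbit [x] of the attractor, with
    fundamental matrix [Phi] of the tangent equation along it.

    Uniform hyperbolicity first gives an exponential dichotomy along [x]
    ([orbit_dichotomy]): the projections on the unstable, stable and neutral
    directions are bounded uniformly in time, because a vector whose components
    were much larger than itself would be torn apart by the flow.  Consequently
    the linear equation with a bounded forcing has a bounded solution, in which
    the unstable part is integrated from infinity and the stable part from time
    [0] ([green], [green_bound]).  A neutral forcing is the exception, and it is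
    dealt with separately in the two uses below.

    The adjoint equation has the transposed dichotomy, and [- J_u] is its forcing.
    Its solutions satisfy [<v, f> + J = const], and the averaging condition forces
    the constant to be [Javg s]; this fixes the neutral component, and the bounded
    solution provides the rest ([adjoint_exists]).  Two solutions differ by a
    solution of the homogeneous adjoint equation, whose constant pairing with
    unstable, stable and neutral tangent vectors is [0] ([adjoint_unique]).

    For the sensitivity, [x] is shadowed for all times [t >= 0] by a curve
    [y = x + w] that follows the field of parameter [s + d] at speed [1 + e], with
    [w] and [e] of order [d] ([shadowing]); the neutral forcing is absorbed by
    the change of speed.  As [U] is open and the average does not depend on the
    initial state, averaging [J] along [y] yields [Javg (s + d)]
    ([rescaled_average]).  Comparing the integrals of [J] along [y] and [x], the
    first-order effect of [w] and [e] is turned by the pairing [<v, w>], which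
    stays bounded, into the integral of [d * <v, f_s>] ([pairing_derive]).  So
    [(Javg (s + d) - Javg s) / d] and the average of [<v, f_s> + J_s] up to
    time [T] differ by [O(d)] once [T] is large, where the bound [O(d)] does not
    depend on [T] ([sensitivity_estimate]).  Letting [T] grow and then [d] shrink,
    this alone proves that the average converges, that [Javg] is differentiable
    at [s], and that the two limits agree ([common_limit]).

    Integrals are handled through antiderivatives and mean value inequalities; the
    max norm is used throughout, being invariant under transposition. *)

Set Implicit Arguments.
Unset Strict Implicit.
Unset Printing Implicit Defensive.
Import Order.TTheory GRing.Theory Num.Theory.
Import numFieldNormedType.Exports.
Local Open Scope classical_set_scope.
Local Open Scope ring_scope.

(** * Matrices: max norm, derivatives and continuity *)

Section MatrixNorm.
Context {R : realType}.

Lemma entry_le_norm p q (A : 'M[R]_(p, q)) i j : `|A i j| <= `|A|.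
Proof. by rewrite [leRHS]/Num.Def.normr/= mx_normrE; exact: (le_bigmax _ _ (i, j)). Qed.

Lemma norm_le_entry p q (A : 'M[R]_(p, q)) c :
  0 <= c -> (forall i j, `|A i j| <= c) -> `|A| <= c.
Proof.
by move=> c0 Ac; rewrite [leLHS]/Num.Def.normr/= mx_normrE bigmax_le.
Qed.

Lemma norm_mulmx p q r (A : 'M[R]_(p, q)) (B : 'M[R]_(q, r)) :
  `|A *m B| <= q%:R * `|A| * `|B|.
Proof.
apply: norm_le_entry => [|i j]; first by rewrite !mulr_ge0.
rewrite mxE (le_trans (ler_norm_sum _ _ _))//.
rewrite (@le_trans _ _ (\sum_(k < q) `|A| * `|B|))//.
  by apply: ler_sum => k _; rewrite normrM ler_pM// entry_le_norm.
by rewrite sumr_const card_ord -mulrA mulr_natl.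
Qed.

Lemma norm_trmx p q (A : 'M[R]_(p, q)) : `|A^T| = `|A|.
Proof.
apply/le_anti/andP; split; apply: norm_le_entry => // i j.
  by rewrite mxE entry_le_norm.
by rewrite -[A]trmxK mxE trmxK entry_le_norm.
Qed.

Lemma norm_delta_mx p q (i : 'I_p) (j : 'I_q) :
  `|delta_mx i j : 'M[R]_(p, q)| <= 1.
Proof.
apply: norm_le_entry => // k l; rewrite mxE.
by case: (_ && _); rewrite ?normr1 ?normr0.
Qed.

Lemma norm_row_le p q (A : 'M[R]_(p, q)) c : 0 <= c ->
  (forall y : 'rV_p, `|y *m A| <= c * `|y|) -> `|A| <= c.
Proof.
move=> c0 Ac; apply: norm_le_entry => // i j.
have -> : A i j = (delta_mx 0 i *m A : 'rV_q) 0 j by rewrite -rowE mxE.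
apply: (le_trans (entry_le_norm _ _ _)); apply: (le_trans (Ac _)).
by rewrite ler_piMr// norm_delta_mx.
Qed.

End MatrixNorm.

Section MatrixDerivative.
Context {R : realType}.

Lemma is_derive_mxP p q (F : R -> 'M[R]_(p, q)) (t : R) (dF : 'M[R]_(p, q)) :
  is_derive t 1 F dF <->
  forall i j, is_derive t 1 (fun r => F r i j) (dF i j).
Proof.
split=> [Fd i j|Fd].
  have Fdv : derivable F t 1 by [].
  apply: DeriveDef; first by move/derivable_mxP: Fdv.
  by rewrite -(@derive_val _ _ _ _ _ _ _ Fd) derive_mx// mxE.
have Fdv : derivable F t 1 by apply/derivable_mxP => i j.
apply: DeriveDef => //; rewrite derive_mx//.
by apply/matrixP => i j; rewrite mxE derive_val.
Qed.

Lemma is_derive_entry p q (F : R -> 'M[R]_(p, q)) (t : R) (dF : 'M[R]_(p, q)) i j :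
  is_derive t 1 F dF -> is_derive t 1 (fun r => F r i j) (dF i j).
Proof. by move/is_derive_mxP. Qed.

Lemma is_derive_continuous (V : normedModType R) (F : R -> V) (t : R) (dF : V) :
  is_derive t 1 F dF -> {for t, continuous F}.
Proof. by move=> Fd; apply/differentiable_continuous/derivable1_diffP. Qed.

Lemma is_derive_mulmx p q r (F : R -> 'M[R]_(p, q)) (G : R -> 'M[R]_(q, r)) (t : R) dF dG :
  is_derive t 1 F dF -> is_derive t 1 G dG ->
  is_derive t 1 (fun x => F x *m G x) (dF *m G t + F t *m dG).
Proof.
move=> /is_derive_mxP Fd /is_derive_mxP Gd; apply/is_derive_mxP => i j.
rewrite (_ : (fun _ => _) = \sum_(k < q) (fun x => F x i k * G x k j)); last first.
  by apply/funext => x; rewrite mxE fct_sumE.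
rewrite mxE !mxE -big_split/=; apply: is_derive_sum => k.
have h := @is_deriveM _ _ _ _ t 1 _ _ (Fd i k) (Gd k j).
by apply: (is_derive_eq h); rewrite addrC /GRing.scale/= [_ * dF i k]mulrC.
Qed.

Lemma is_derive_trmx p q (F : R -> 'M[R]_(p, q)) (t : R) dF :
  is_derive t 1 F dF -> is_derive t 1 (fun x => (F x)^T) dF^T.
Proof.
move=> /is_derive_mxP Fd; apply/is_derive_mxP => i j; rewrite mxE.
by under eq_fun do rewrite mxE.
Qed.

Lemma is_derive_mulmx_cst p q r (F : R -> 'M[R]_(p, q)) (B : 'M[R]_(q, r)) (t : R) dF :
  is_derive t 1 F dF -> is_derive t 1 (fun x => F x *m B) (dF *m B).
Proof.
move=> Fd; have := is_derive_mulmx Fd (is_derive_cst B t 1).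
by rewrite mulmx0 addr0.
Qed.

Lemma is_derive_reparam p q (F : R -> 'M[R]_(p, q)) (g : R -> R) (t : R) dF dg :
  is_derive (g t) 1 F dF -> is_derive t 1 g dg ->
  is_derive t 1 (F \o g) (dg *: dF).
Proof.
move=> /is_derive_mxP Fd gd; apply/is_derive_mxP => i j; rewrite !mxE mulrC.
exact: (@is_derive1_comp _ (fun r => F r i j) g t _ _ (Fd i j) gd).
Qed.

Lemma continuous_mxP (T : topologicalType) p q (F : T -> 'M[R]_(p, q)) x :
  {for x, continuous F} <-> forall i j, {for x, continuous (fun r => F r i j)}.
Proof.
split=> [Fc i j|Fc].
  exact: (continuous_comp Fc (@coord_continuous _ _ _ i j _)).
apply/cvgrPdist_le => e e0; near=> y.
apply: norm_le_entry; first exact: ltW.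
near: y; apply: filter_forall => i; apply: filter_forall => j.
move: (Fc i j) => /cvgrPdist_le/(_ _ e0); apply: filterS => y /=.
by rewrite !mxE.
Unshelve. all: by end_near. Qed.

Lemma continuous_entry (T : topologicalType) p q (F : T -> 'M[R]_(p, q)) i j :
  continuous F -> continuous (fun x => F x i j).
Proof. by move=> Fc x; exact: ((continuous_mxP F x).1 (Fc x)). Qed.

Lemma continuous_mx (T : topologicalType) p q (F : T -> 'M[R]_(p, q)) :
  (forall i j, continuous (fun x => F x i j)) -> continuous F.
Proof. by move=> Fc x; apply/continuous_mxP => i j; exact: Fc. Qed.

Lemma continuous_trmx (T : topologicalType) p q (F : T -> 'M[R]_(p, q)) :
  continuous F -> continuous (fun x => (F x)^T).
Proof.
move=> Fc; apply: continuous_mx => i j.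
by under eq_fun do rewrite mxE; exact: continuous_entry.
Qed.

Lemma continuous_mulmx (T : topologicalType) p q r (F : T -> 'M[R]_(p, q))
    (G : T -> 'M[R]_(q, r)) :
  continuous F -> continuous G -> continuous (fun x => F x *m G x).
Proof.
move=> Fc Gc x; apply/continuous_mxP => i j.
rewrite (_ : (fun _ => _) = \sum_(k < q) (fun x => F x i k * G x k j)); last first.
  by apply/funext => y; rewrite mxE fct_sumE.
apply: (big_ind (fun f => {for x, continuous f})) => /=.
- exact: cst_continuous.
- by move=> f g; apply: continuousD.
- move=> k _; apply: continuousM.
    exact: continuous_entry.
  exact: continuous_entry.
Qed.

End MatrixDerivative.

(** * Mean value inequalities and Gronwall's lemma *)

Section MeanValue.
Context {R : realType}.

Lemma ge0_derive_le (f df : R -> R) (a b : R) : a <= b -> continuous f ->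
  (forall t, a < t < b -> is_derive t 1 f (df t)) ->
  (forall t, a < t < b -> 0 <= df t) -> f a <= f b.
Proof.
rewrite le_eqVlt => /predU1P[-> //|ab] fc fd df0; rewrite -subr_ge0.
have fd' t : t \in `]a, b[ -> is_derive t 1 f (df t).
  by rewrite in_itv/=; exact: fd.
have [c] := MVT ab fd' (continuous_subspaceT fc).
by rewrite in_itv/= => /df0 dfc ->; rewrite mulr_ge0// subr_ge0 ltW.
Qed.

Lemma mean_value_ineq_real (F dF phi dphi : R -> R) (a b : R) :
  a <= b -> continuous F -> continuous phi ->
  (forall t, a < t < b -> is_derive t 1 F (dF t)) ->
  (forall t, a < t < b -> is_derive t 1 phi (dphi t)) ->
  (forall t, a < t < b -> `|dF t| <= dphi t) ->
  `|F b - F a| <= phi b - phi a.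
Proof.
move=> ab Fc phic Fd phid dFphi; rewrite ler_norml; apply/andP; split.
  suff: phi a + F a <= phi b + F b by move=> ?; lra.
  apply: (@ge0_derive_le (phi + F) (fun t => dphi t + dF t)) => //.
  - by move=> t; apply: continuousD; [exact: phic|exact: Fc].
  - by move=> t tab; apply: is_deriveD; [exact: phid|exact: Fd].
  - by move=> t /dFphi; rewrite ler_norml => /andP[+ _]; lra.
suff: phi a - F a <= phi b - F b by move=> ?; lra.
apply: (@ge0_derive_le (phi - F) (fun t => dphi t - dF t)) => //.
- by move=> t; apply: continuousB; [exact: phic|exact: Fc].
- by move=> t tab; apply: is_deriveB; [exact: phid|exact: Fd].
- by move=> t /dFphi; rewrite ler_norml => /andP[_]; lra.
Qed.

Lemma mean_value_cst (F dF : R -> R) (c T : R) : 0 <= T -> continuous F ->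
  (forall t, 0 < t < T -> is_derive t 1 F (dF t)) ->
  (forall t, 0 < t < T -> `|dF t| <= c) -> `|F T - F 0| <= c * T.
Proof.
move=> T0 Fc Fd dFc.
have cd (t : R) : is_derive t 1 (fun r : R => c * r) c.
  by have := @is_deriveZ _ _ _ id c t 1 1 (is_derive_id t 1); rewrite [c *: 1]mulr1.
have := mean_value_ineq_real T0 Fc (fun t => is_derive_continuous (cd t)) Fd (fun t _ => cd t) dFc.
by rewrite mulr0 subr0.
Qed.

Lemma mean_value_ineq p q (F dF : R -> 'M[R]_(p, q)) (phi dphi : R -> R) (a b : R) :
  a <= b -> continuous F -> continuous phi ->
  (forall t, a < t < b -> is_derive t 1 F (dF t)) ->
  (forall t, a < t < b -> is_derive t 1 phi (dphi t)) ->
  (forall t, a < t < b -> `|dF t| <= dphi t) ->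
  `|F b - F a| <= phi b - phi a.
Proof.
move=> ab Fc phic Fd phid dFphi; apply: norm_le_entry => [|i j].
  rewrite subr_ge0; apply: (@ge0_derive_le phi dphi) => // t tab.
  exact: le_trans (normr_ge0 _) (dFphi _ tab).
rewrite !mxE.
apply: (@mean_value_ineq_real (fun t => F t i j) (fun t => dF t i j) phi dphi) => //.
- exact: continuous_entry.
- by move=> t tab; apply: is_derive_entry; exact: Fd.
- by move=> t /dFphi; apply: le_trans; exact: entry_le_norm.
Qed.

Lemma derive0_cst p q (F : R -> 'M[R]_(p, q)) (a b : R) : a <= b -> continuous F ->
  (forall t, a < t < b -> is_derive t 1 F 0) -> F b = F a.
Proof.
move=> ab Fc Fd; apply/eqP; rewrite -subr_eq0 -normr_le0.
have := @mean_value_ineq p q F (fun=> 0) (fun=> 0) (fun=> 0) a b ab Fc.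
rewrite subrr; apply=> //.
- exact: cst_continuous.
- by move=> t _; rewrite normr0.
Qed.

Lemma eq_derive_eq p q (F G dF : R -> 'M[R]_(p, q)) (t0 t : R) :
  (forall t : R, is_derive t 1 F (dF t)) -> (forall t : R, is_derive t 1 G (dF t)) ->
  F t0 = G t0 -> F t = G t.
Proof.
move=> Fd Gd FG0; apply/eqP; rewrite -subr_eq0; apply/eqP.
have D0 (r : R) : is_derive r 1 (F - G) 0.
  by have := @is_deriveB _ _ _ _ _ r 1 _ _ (Fd r) (Gd r); rewrite subrr.
have Dc : continuous (F - G) by move=> r; exact: is_derive_continuous (D0 r).
have D00 : (F - G) t0 = 0 by rewrite -[LHS]/(F t0 - G t0) FG0 subrr.
rewrite -[LHS]/((F - G) t) -D00.
by have [tt|/ltW tt] := leP t0 t; [|apply/esym]; apply: derive0_cst.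
Qed.

Lemma is_derive_expRM (a c t : R) :
  is_derive t 1 (fun r => a * expR (c * r)) (a * c * expR (c * t)).
Proof.
have cd : is_derive t 1 (fun r : R => c * r) c.
  have := @is_deriveZ _ _ _ id c t 1 1 _.
  by rewrite [c *: 1]mulr1; apply; exact: is_derive_id.
have ed := @is_derive1_comp _ expR (fun r => c * r) t _ _ (is_derive_expR _) cd.
have := @is_deriveZ _ _ _ _ a t 1 _ ed.
by rewrite /GRing.scale/= => h; apply: (is_derive_eq h); rewrite /=; ring.
Qed.

(** The sum of the squares of the entries satisfies a scalar differential
    inequality; comparing it with the square of the max norm at both ends is
    what brings in the factors [p * q]. *)
Lemma gronwall p q (F dF : R -> 'M[R]_(p, q)) (L a b : R) :
  0 <= L -> a <= b -> continuous F ->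
  (forall t, a < t < b -> is_derive t 1 F (dF t)) ->
  (forall t, a < t < b -> `|dF t| <= L * `|F t|) ->
  `|F b| <= (p * q)%:R * expR ((p * q)%:R * L * (b - a)) * `|F a|.
Proof.
move=> L0 ab Fc Fd dFL; pose c : R := (p * q)%:R.
have c0 : 0 <= c by [].
pose S t := \sum_(i < p) (F t *m (F t)^T) i i.
pose dS t := \sum_(i < p) (dF t *m (F t)^T + F t *m (dF t)^T) i i.
have SE t : S t = \sum_(i < p) \sum_(k < q) F t i k ^+ 2.
  apply: eq_bigr => i _; rewrite mxE; apply: eq_bigr => k _.
  by rewrite mxE expr2.
have S0 t : 0 <= S t.
  by rewrite SE; do 2!(apply: sumr_ge0 => ? _); exact: sqr_ge0.
have SF t : `|F t| ^+ 2 <= S t.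
  rewrite -(sqr_sqrtr (S0 t)) ler_pXn2r ?nnegrE ?sqrtr_ge0//.
  apply: norm_le_entry; first exact: sqrtr_ge0.
  move=> i j; rewrite -sqrtr_sqr ler_wsqrtr// SE (bigD1 i)//= (bigD1 j)//=.
  rewrite -addrA lerDl addr_ge0// ?sumr_ge0// => k _; first exact: sqr_ge0.
  by apply: sumr_ge0 => l _; exact: sqr_ge0.
have FS t : S t <= c * `|F t| ^+ 2.
  rewrite SE (@le_trans _ _ (\sum_(i < p) \sum_(k < q) `|F t| ^+ 2))//.
    do 2!(apply: ler_sum => ? _).
    by rewrite -real_normK ?num_real// ler_pXn2r ?nnegrE// entry_le_norm.
  by rewrite !sumr_const !card_ord -mulrnA mulnC mulr_natl.
have Sd t : a < t < b -> is_derive t 1 S (dS t).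
  move=> tab; rewrite (_ : S = \sum_(i < p) (fun t => (F t *m (F t)^T) i i)).
    apply: is_derive_sum => i; apply: is_derive_entry.
    by apply: is_derive_mulmx; [|apply: is_derive_trmx]; exact: Fd.
  by apply/funext => r; rewrite fct_sumE.
have Sc : continuous S.
  rewrite (_ : S = \sum_(i < p) (fun t => (F t *m (F t)^T) i i)); last first.
    by apply/funext => r; rewrite fct_sumE.
  move=> t; apply: (big_ind (fun f => {for t, continuous f})) => /=.
  - exact: cst_continuous.
  - by move=> f g; apply: continuousD.
  - move=> i _; move: t; apply: continuous_entry.
    by apply: continuous_mulmx => //; exact: continuous_trmx.
have dSS t : a < t < b -> dS t <= 2 * c * L * S t.
  move=> tab; rewrite (@le_trans _ _ (\sum_(i < p) 2 * q%:R * L * `|F t| ^+ 2))//.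
    apply: ler_sum => i _; apply: le_trans (ler_norm _) _.
    apply: le_trans (entry_le_norm _ _ _) _.
    apply: le_trans (ler_normD _ _) _.
    have h1 := norm_mulmx (dF t) (F t)^T.
    have h2 := norm_mulmx (F t) (dF t)^T.
    rewrite !norm_trmx in h1 h2.
    have h3 : q%:R * (`|dF t| * `|F t|) <= q%:R * (L * `|F t| * `|F t|).
      by rewrite ler_wpM2l// ler_wpM2r// dFL.
    by rewrite expr2; lra.
  rewrite sumr_const card_ord.
  have -> : (2 * q%:R * L * `|F t| ^+ 2) *+ p = 2 * c * L * `|F t| ^+ 2.
    by rewrite /c natrM -[LHS]mulr_natl; ring.
  by rewrite ler_wpM2l// !mulr_ge0.
have SS : S b * expR (- (2 * c * L) * b) <= S a * expR (- (2 * c * L) * a).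
  rewrite -lerN2.
  pose k := - (2 * c * L).
  pose g := (S * (fun t => 1 * expR (k * t)))%R.
  have ed t := is_derive_expRM 1 k t.
  have := @ge0_derive_le (- g)
    (fun t => - (S t * (k * expR (k * t)) + dS t * expR (k * t))) a b ab.
  rewrite -[(- g) a]/(- (S a * (1 * expR (k * a)))).
  rewrite -[(- g) b]/(- (S b * (1 * expR (k * b)))) !mul1r; apply.
  - move=> t; apply: continuousN; apply: continuousM; first exact: Sc.
    exact: is_derive_continuous (ed t).
  - move=> t tab; apply: is_deriveN.
    apply: (is_derive_eq (@is_deriveM _ _ _ _ t 1 _ _ (Sd _ tab) (ed t))).
    by rewrite /GRing.scale/= !mul1r [dS t * _]mulrC.
  - move=> t tab; rewrite oppr_ge0 mulrA -mulrDl mulr_le0_ge0 ?expR_ge0//.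
    by have := dSS _ tab; rewrite /k; lra.
have {}SS : S b <= S a * expR (2 * c * L * (b - a)).
  move: SS; rewrite -ler_pdivlMr ?expR_gt0// -expRN -(mulrA (S a)) -expRD.
  by congr (_ <= _ * expR _); ring.
rewrite -/c -(@ler_pXn2r _ 2) ?nnegrE ?mulr_ge0 ?expR_ge0//.
apply: le_trans (SF _) _; apply: le_trans SS _.
rewrite !exprMn -expRM_natl.
have -> : 2%:R * (c * L * (b - a)) = 2 * c * L * (b - a) by ring.
rewrite [leRHS]mulrAC ler_wpM2r ?expR_ge0//; apply: le_trans (FS _) _.
rewrite ler_wpM2r ?sqr_ge0//.
rewrite /c -natrX ler_nat; case: (p * q)%N => // n.
by rewrite expnS expn1 leq_pmulr.
Qed.

End MeanValue.

(** * Antiderivatives on the whole line and limits at infinity *)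

Section Antiderivative.
Context {R : realType}.

Lemma antiderivative_right (g : R -> R) (a t : R) : continuous g -> a < t ->
  is_derive t 1 (fun r => Rintegral (@lebesgue_measure R) `[a, r] g) (g t).
Proof.
move=> gc at_.
have gi : (@lebesgue_measure R).-integrable `[a, t + 1] (EFin \o g).
  apply: continuous_compact_integrable; first exact: segment_compact.
  exact: continuous_subspaceT.
have tt1 : t < t + 1 by rewrite ltrDl.
have [d dE] := @continuous_FTC1_closed R g a t (t + 1) tt1 gi at_ (gc t).
apply: DeriveDef; first exact: d.
by rewrite -derive1E; exact: dE.
Qed.

(** The integral from [a] to [t] is an antiderivative only for [t > a].  Two
    such integrals, normalised to vanish at [0], agree wherever both are
    antiderivatives, so the base point may be moved further to the left as [t]
    decreases. *)
Lemma antiderivative_exists (g : R -> R) : continuous g ->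
  exists G : R -> R, G 0 = 0 /\ forall t : R, is_derive t 1 G (g t).
Proof.
move=> gc; pose I a r := Rintegral (@lebesgue_measure R) `[a, r] g.
have Id (a t : R) : a < t -> is_derive t 1 (I a) (g t).
  by move=> at_; exact: antiderivative_right.
have Iab a b t : a < 0 -> b < 0 -> a < t -> b < t -> I a t - I a 0 = I b t - I b 0.
  move=> a0 b0 at_ bt; pose D r := I a r - I b r.
  have Dd (r : R) : a < r -> b < r -> is_derive r 1 D 0.
    by move=> ar br; rewrite -(subrr (g r)); apply: is_deriveB; exact: Id.
  have [c [ca cb c0 ct]] : exists c : R, [/\ a < c, b < c, c < 0 & c < t].
    exists ((Num.max a b + Num.min 0 t) / 2).
    have : Num.max a b < Num.min 0 t by rewrite lt_min !gt_max a0 b0 at_ bt.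
    have : a <= Num.max a b by rewrite le_max lexx.
    have : b <= Num.max a b by rewrite le_max lexx orbT.
    have : Num.min 0 t <= 0 by rewrite ge_min lexx.
    have : Num.min 0 t <= t by rewrite ge_min lexx orbT.
    by move: (Num.max _ _) (Num.min _ _) => ? ? ? ? ? ? ?; split; lra.
  have const r1 r2 : c < r1 -> r1 <= r2 -> D r2 = D r1.
    move=> cr1; rewrite le_eqVlt => /predU1P[->//|r12].
    apply/eqP; rewrite -subr_eq0; apply/eqP.
    have Dd' r : r \in `]r1, r2[ -> is_derive r 1 D 0.
      by rewrite in_itv/= => /andP[? _]; apply: Dd; lra.
    have Dc : {within `[r1, r2], continuous D}.
      apply: derivable_within_continuous => r; rewrite in_itv/= => /andP[? _].
      by apply: (@ex_derive _ _ _ _ _ _ _ (Dd r _ _)); lra.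
    by have [e _ ->] := MVT r12 Dd' Dc; rewrite mul0r.
  suff : D t = D 0 by rewrite /D; lra.
  by have [t0|/ltW t0] := leP 0 t; [|apply/esym]; apply: const.
pose m (t : R) := - (`|t| + 1).
exists (fun t => I (m t) t - I (m t) 0); split=> [|t]; first by rewrite subrr.
pose a := - (`|t| + 2).
have at_ : a < t by rewrite /a; have := ler_norm (- t); rewrite normrN; lra.
have a0 : a < 0 by rewrite /a; have := normr_ge0 t; lra.
have Ia : is_derive t 1 (fun r => I a r - I a 0) (g t).
  rewrite -[g t]subr0; apply: (@is_deriveB _ _ _ (I a) (cst (I a 0))); exact: Id.
apply: near_eq_is_derive Ia => //.
near=> r.
have mr0 : m r < 0 by rewrite /m; have := normr_ge0 r; lra.
have mr : m r < r by rewrite /m; have := ler_norm (- r); rewrite normrN; lra.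
apply: Iab => //.
suff : `|t - r| < 1.
  have := ler_normD (t - r) (- t); rewrite normrN addrAC subrr sub0r normrN => h h1.
  by have := ler_norm (- r); rewrite normrN /a; lra.
by near: r; apply: cvgr_dist_lt => //; exact: cvg_id.
Unshelve. all: by end_near. Qed.

(** Choosing the antiderivative that vanishes at [0] gives oriented integrals
    of matrix curves, for times of both signs, governed by the mean value
    inequality alone. *)
Definition prim p q (g : R -> 'M[R]_(p, q)) : R -> 'M[R]_(p, q) :=
  xget (fun=> 0) [set G | G 0 = 0 /\ forall t : R, is_derive t 1 G (g t)].

Lemma primP p q (g : R -> 'M[R]_(p, q)) : continuous g ->
  prim g 0 = 0 /\ forall t : R, is_derive t 1 (prim g) (g t).
Proof.
move=> gc; rewrite /prim; case: xgetP => //= noG.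
have ex (ij : 'I_p * 'I_q) :
    exists G : R -> R, G 0 = 0 /\ forall t : R, is_derive t 1 G (g t ij.1 ij.2).
  by apply: antiderivative_exists; exact: continuous_entry.
have [G GP] := choice ex.
have [] := noG (fun t => \matrix_(i, j) G (i, j) t); split.
  by apply/matrixP => i j; rewrite !mxE; have [->] := GP (i, j).
move=> t; apply/is_derive_mxP => i j.
by under eq_fun do rewrite mxE; have [_] := GP (i, j).
Qed.

Lemma prim0 p q (g : R -> 'M[R]_(p, q)) : continuous g -> prim g 0 = 0.
Proof. by case/primP. Qed.

Lemma is_derive_prim p q (g : R -> 'M[R]_(p, q)) (t : R) : continuous g ->
  is_derive t 1 (prim g) (g t).
Proof. by case/primP. Qed.

Lemma prim_continuous p q (g : R -> 'M[R]_(p, q)) : continuous g -> continuous (prim g).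
Proof. by move=> gc t; exact: is_derive_continuous (is_derive_prim t gc). Qed.

Lemma primB p q (g h : R -> 'M[R]_(p, q)) : continuous g -> continuous h ->
  prim (g - h) = prim g - prim h.
Proof.
move=> gc hc; apply/funext => t.
have ghc : continuous (g - h) by move=> r; apply: continuousB; [exact: gc|exact: hc].
apply: (@eq_derive_eq _ _ _ _ _ (g - h) 0 t).
- by move=> r; exact: is_derive_prim.
- by move=> r; apply: is_deriveB; exact: is_derive_prim.
- by rewrite prim0// -[RHS]/(prim g 0 - prim h 0) !prim0// subrr.
Qed.

Lemma prim_mulmx p q r (g : R -> 'M[R]_(p, q)) (B : 'M[R]_(q, r)) :
  continuous g -> prim (fun t => g t *m B) = (fun t => prim g t *m B).
Proof.
move=> gc; apply/funext => t.
have gBc : continuous (fun t => g t *m B).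
  by apply: (@continuous_mulmx _ _ _ _ _ g (fun=> B)) => //; exact: cst_continuous.
apply: (@eq_derive_eq R p r _ (fun t => prim g t *m B) (fun t => g t *m B) 0 t).
- by move=> s; exact: is_derive_prim.
- by move=> s; apply: is_derive_mulmx_cst; exact: is_derive_prim.
- by rewrite !prim0// mul0mx.
Qed.

End Antiderivative.

Section Limits.
Context {R : realType}.

Lemma cvg_dist_le (T : Type) (V : normedModType R) (F : set_system T)
    (FF : ProperFilter F) (f : T -> V) l c b :
  f @ F --> l -> (\forall x \near F, `|f x - c| <= b) -> `|l - c| <= b.
Proof.
move=> fl fb; apply/ler_addgt0Pr => e e0.
have fle : \forall x \near F, `|l - f x| <= e by apply: cvgr_dist_le.
have [x [h1 h2]] := filter_ex (filterI fb fle).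
by rewrite -(subrKA (f x)) (le_trans (ler_normD _ _))// addrC lerD.
Qed.

Lemma expR_decay (c l e : R) : 0 < l -> 0 < e -> exists2 T : R, 0 <= T & c * expR (- l * T) <= e.
Proof.
move=> l0 e0; exists (`|c| / (l * e)); first by rewrite divr_ge0// mulr_ge0// ltW.
set T := _ / _.
have [c0|c0] := leP c 0; first by rewrite (le_trans _ (ltW e0))// mulr_le0_ge0// expR_ge0.
rewrite mulNr expRN -ler_pdivlMr ?invr_gt0 ?expR_gt0// invrK.
rewrite -ler_pdivrMl//; apply: le_trans (expR_ge1Dx _).
have -> : l * T = e^-1 * c by rewrite /T gtr0_norm//; field; rewrite !gt_eqF.
by rewrite lerDr.
Qed.

(** The curve has finite length: the mean value inequality, with the primitive
    [- (C / l) * expR (- l * t)] as comparison function, makes it Cauchy. *)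
Lemma is_cvg_exp_decay p q (F dF : R -> 'M[R]_(p, q)) (C l : R) : 0 < l ->
  (forall t : R, is_derive t 1 F (dF t)) ->
  (forall t, 0 <= t -> `|dF t| <= C * expR (- l * t)) ->
  cvg (F @ +oo).
Proof.
move=> l0 Fd dFC.
have C0 : 0 <= C.
  by have := le_trans (normr_ge0 _) (dFC _ (lexx 0)); rewrite mulr0 expR0 mulr1.
have Fc : continuous F by move=> t; exact: is_derive_continuous (Fd t).
apply: cauchy_cvg; apply: cauchy_exP => e e0.
have [T T0 Te] := @expR_decay (C / l) l (e / 2) l0 (divr_gt0 e0 (ltr0Sn _ _)).
exists (F T); exists T; split; first exact: num_real.
move=> t Tt; rewrite -ball_normE/= distrC.
apply: (@le_lt_trans _ _ (e / 2)); last by lra.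
pose phi r := - (C / l) * expR (- l * r).
have := @mean_value_ineq _ _ _ F dF phi (fun r => C * expR (- l * r)) T t (ltW Tt) Fc.
have phid (r : R) : is_derive r 1 phi (C * expR (- l * r)).
  apply: (is_derive_eq (is_derive_expRM _ _ _)).
  by rewrite mulrNN divfK// gt_eqF.
move/(_ (fun r => is_derive_continuous (phid r))) => h.
apply: le_trans (h _ _ _) _ => //.
- by move=> r /andP[Tr _]; apply: dFC; lra.
rewrite /phi; have : 0 <= C / l * expR (- l * t).
  by rewrite mulr_ge0 ?expR_ge0// divr_ge0// ltW.
by lra.
Qed.

End Limits.

(** * A weighted fixed point theorem and linear differential equations *)

Section FixedPoint.
Context {R : realType}.

Lemma half_pow_small (c e : R) : 0 <= c -> 0 < e -> exists n, c / 2 ^+ n <= e.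
Proof.
move=> c0 e0; exists (Num.truncn (c / e)).+1.
rewrite ler_pdivrMr ?exprn_gt0// mulrC -ler_pdivrMr//.
apply: le_trans (ltW (truncnS_gt _)) _.
by rewrite -natrX ler_nat ltnW// ltn_expl.
Qed.

(** The contraction principle for continuous curves on the whole line, in the
    weighted sup norm [sup `|x t| / rho t].  An exponential weight yields global
    solutions of linear equations in one step; [rho = 1], with a ball for [Q],
    is the form that shadowing requires. *)
Lemma weighted_fixed_point p q (Q : set 'M[R]_(p, q)) (rho : R -> R)
    (T : (R -> 'M[R]_(p, q)) -> R -> 'M[R]_(p, q)) (x0 : R -> 'M[R]_(p, q)) (D : R) :
  let good (x : R -> 'M[R]_(p, q)) := continuous x /\ forall t, Q (x t) in
  closed Q -> continuous rho -> (forall t, 0 <= rho t) -> 0 <= D ->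
  good x0 -> (forall x, good x -> good (T x)) ->
  (forall x y (d : R), good x -> good y -> 0 <= d ->
    (forall t, `|x t - y t| <= d * rho t) ->
    forall t, `|T x t - T y t| <= d / 2 * rho t) ->
  (forall t, `|T x0 t - x0 t| <= D * rho t) ->
  exists2 x, good x & forall t, T x t = x t.
Proof.
move=> good Qcl rhoc rho0 D0 gx0 gT contr start.
pose x_ n := iter n T x0.
have gx n : good (x_ n) by elim: n => // n; exact: gT.
have step n t : `|x_ n.+1 t - x_ n t| <= D / 2 ^+ n * rho t.
  elim: n t => [|n ih] t; first by rewrite expr0 divr1; exact: start.
  rewrite exprSr invfM mulrA; apply: (contr _ _ _ (gx _) (gx _) _ ih).
  by rewrite divr_ge0// exprn_ge0.
have far k n t : `|x_ (n + k)%N t - x_ n t| <= 2 * D / 2 ^+ n * rho t.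
  elim: k n => [|k ih] n.
    by rewrite addn0 subrr normr0 !mulr_ge0// invr_ge0 exprn_ge0.
  rewrite addnS -addSn -(subrKA (x_ n.+1 t)); apply: le_trans (ler_normD _ _) _.
  apply: le_trans (lerD (ih n.+1) (step n t)) _; rewrite -mulrDl ler_wpM2r//.
  by rewrite exprSr invfM; move: (2 ^+ n)^-1 => z; lra.
have small t (e : R) : 0 < e -> exists n, 2 * D / 2 ^+ n * rho t <= e.
  have c0 : 0 <= 2 * D * rho t by rewrite !mulr_ge0.
  move=> e0; have [n] := half_pow_small c0 e0.
  by exists n; rewrite mulrAC.
have cv t : cvg (x_ n t @[n --> \oo]).
  apply: cauchy_cvg; apply: cauchy_exP => e e0.
  have [n ne] := small t (e / 2) (divr_gt0 e0 (ltr0Sn _ _)).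
  exists (x_ n t); exists n => // m /= nm; rewrite -ball_normE/= distrC.
  have := far (m - n)%N n t; rewrite subnKC// => h.
  by apply: le_lt_trans h (le_lt_trans ne _); lra.
pose x t : 'M[R]_(p, q) := lim (x_ n t @[n --> \oo]).
have xl t : x_ n t @[n --> \oo] --> x t by exact: cv.
have xd n t : `|x t - x_ n t| <= 2 * D / 2 ^+ n * rho t.
  apply: cvg_dist_le (xl t) _; near=> m.
  have nm : (n <= m)%N by near: m; exact: nbhs_infty_ge.
  by have := far (m - n)%N n t; rewrite subnKC.
have gxl : good x.
  split=> t; last by apply: closed_cvg (xl t) => //; apply: nearW => n; have [] := gx n.
  apply/cvgrPdist_le => e e0.
  have c0 : 0 <= 2 * D * (rho t + 1) by rewrite !mulr_ge0 ?addr_ge0.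
  have [n ne] := half_pow_small c0 (divr_gt0 e0 (ltr0Sn _ 2)).
  have A y : rho y <= rho t + 1 -> `|x y - x_ n y| <= e / 3.
    move=> yt; apply: le_trans (xd n y) (le_trans _ ne).
    by rewrite mulrAC ler_wpM2r ?invr_ge0 ?exprn_ge0// ler_wpM2l// mulr_ge0.
  near=> y.
  have yt : rho y <= rho t + 1.
    have : `|rho t - rho y| <= 1 by near: y; apply: cvgr_dist_le; rewrite ?ltr01//; exact: rhoc.
    by rewrite ler_norml => /andP[]; lra.
  have h1 : `|x t - x_ n t| <= e / 3 by apply: A; rewrite lerDl.
  have h2 := A y yt.
  have h3 : `|x_ n t - x_ n y| <= e / 3.
    near: y; apply: cvgr_dist_le; first exact: (gx n).1.
    by rewrite divr_gt0.
  rewrite -(subrKA (x_ n t)); apply: le_trans (ler_normD _ _) _.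
  rewrite -(subrKA (x_ n y) (x_ n t)).
  have := ler_normD (x_ n t - x_ n y) (x_ n y - x y).
  by move: h2; rewrite distrC; lra.
exists x => // t; apply/eqP; rewrite -subr_eq0 -normr_le0.
apply/ler_addgt0Pr => e e0; rewrite add0r.
have [n ne] := small t e e0.
have h1 : `|T x t - x_ n.+1 t| <= 2 * D / 2 ^+ n / 2 * rho t.
  apply: (contr _ _ _ gxl (gx _) _ (xd n)).
  by rewrite !mulr_ge0// invr_ge0 exprn_ge0.
have h2 := xd n.+1 t; rewrite exprSr invfM mulrA distrC in h2.
rewrite -(subrKA (x_ n.+1 t)) (le_trans (ler_normD _ _))// (le_trans _ ne)//.
by have := lerD h1 h2; lra.
Unshelve. all: by end_near. Qed.

End FixedPoint.

Section LinearODE.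
Context {R : realType}.

(** With the weight [expR (2 * L * `|t|)] the integral operator
    [X |-> X0 + prim (X *m M)] has contraction constant [1 / 2], for positive
    and negative times at once. *)
Lemma linear_ode p n (M : R -> 'M[R]_n) (X0 : 'M[R]_(p, n)) (B : R) :
  continuous M -> (forall t, `|M t| <= B) ->
  exists X : R -> 'M[R]_(p, n),
    X 0 = X0 /\ forall t : R, is_derive t 1 X (X t *m M t).
Proof.
move=> Mc MB.
have B0 : 0 <= B by apply: le_trans (MB 0).
pose L := n%:R * B + 1.
have L0 : 0 < L by rewrite ltr_wpDl// mulr_ge0.
pose rho (t : R) := expR (2 * L * `|t|).
pose T (X : R -> 'M[R]_(p, n)) t := X0 + prim (fun r => X r *m M r) t.
have XMc (X : R -> 'M[R]_(p, n)) : continuous X -> continuous (fun r => X r *m M r).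
  by move=> Xc; exact: continuous_mulmx.
have Tc (X : R -> 'M[R]_(p, n)) : continuous X -> continuous (T X).
  move=> Xc t; apply: continuousD; first exact: cst_continuous.
  exact: prim_continuous (XMc _ Xc) t.
have [||||||||X [Xc _] TX] := @weighted_fixed_point R p n setT rho T (fun=> 0) `|X0|.
- exact: closedT.
- move=> t; apply: continuous_comp; last exact: continuous_expR.
  apply: continuousM; first exact: cst_continuous.
  exact: norm_continuous.
- by move=> t; exact: expR_ge0.
- by [].
- by split=> // t; exact: cst_continuous.
- by move=> X [Xc _]; split=> //; exact: Tc.
- move=> X Y d [Xc _] [Yc _] d0 XY t.
  rewrite /T opprD addrACA subrr add0r.
  pose F := prim (fun r => X r *m M r) - prim (fun r => Y r *m M r).
  pose dF r := (X r - Y r) *m M r.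
  have Fd (r : R) : is_derive r 1 F (dF r).
    rewrite /dF mulmxBl; apply: is_deriveB; exact: is_derive_prim (XMc _ _).
  have F0 : F 0 = 0 by rewrite -[LHS]/(prim _ 0 - prim _ 0) !prim0 ?subrr//; exact: XMc.
  have Fc : continuous F by move=> r; exact: is_derive_continuous (Fd r).
  have dFle r : `|dF r| <= d * L * rho r.
    apply: le_trans (norm_mulmx _ _) _.
    have h : n%:R * `|X r - Y r| * `|M r| <= n%:R * (d * rho r) * B.
      by rewrite ler_pM ?mulr_ge0// ler_wpM2l.
    apply: le_trans h _.
    have -> : n%:R * (d * rho r) * B = d * (n%:R * B) * rho r by ring.
    by rewrite ler_wpM2r ?expR_ge0// ler_wpM2l// /L lerDl.
  rewrite -[X in `|X|]/(F t).
  have [t0|t0] := leP 0 t.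
    have phid (r : R) := is_derive_expRM (d / 2) (2 * L) r.
    have := @mean_value_ineq _ _ _ F dF _ _ 0 t t0 Fc
      (fun r => is_derive_continuous (phid r)) (fun r _ => Fd r) (fun r _ => phid r).
    rewrite F0 subr0 mulr0 expR0 mulr1 => h.
    apply: le_trans (h _) _.
      move=> r /andP[r0 _]; apply: le_trans (dFle r) _.
      rewrite /rho gtr0_norm//.
      by have -> : d / 2 * (2 * L) * expR (2 * L * r) = d * L * expR (2 * L * r) by field.
    by rewrite /rho ger0_norm// gerBl divr_ge0.
  have phid (r : R) := is_derive_expRM (- (d / 2)) (- (2 * L)) r.
  have := @mean_value_ineq _ _ _ F dF _ _ t 0 (ltW t0) Fc
    (fun r => is_derive_continuous (phid r)) (fun r _ => Fd r) (fun r _ => phid r).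
  rewrite F0 sub0r normrN mulr0 expR0 mulr1 => h.
  apply: le_trans (h _) _.
    move=> r /andP[_ r0]; apply: le_trans (dFle r) _.
    rewrite /rho ltr0_norm// mulrN -mulNr.
    have -> // : - (d / 2) * - (2 * L) * expR (- (2 * L) * r) =
            d * L * expR (- (2 * L) * r) by field.
  rewrite /rho ltr0_norm// mulrN -[in leRHS]mulNr.
  by move: (expR _) => z; lra.
- move=> t; rewrite subr0 /T.
  rewrite (_ : prim _ t = 0) ?addr0; last first.
    apply: (@eq_derive_eq _ _ _ _ (fun=> 0) (fun=> 0) 0 t) => //; last first.
      by rewrite prim0//; apply: XMc => r; exact: cst_continuous.
    move=> r; rewrite -[X in is_derive _ _ _ X](mul0mx _ (M r)).
    by apply: (is_derive_prim _ (g := fun r => 0 *m M r)); apply: XMc => ?; exact: cst_continuous.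
  by rewrite ler_peMr// -expR0 ler_expR !mulr_ge0// ltW.
exists X; split.
  by rewrite -TX /T prim0 ?addr0//; exact: XMc.
move=> t; rewrite (_ : X = T X); last by apply/funext => r; rewrite TX.
rewrite -[_ *m _]add0r; apply: is_deriveD; rewrite -/(T X).
rewrite (_ : T X = X); last by apply/funext.
exact: is_derive_prim (XMc _ _).
Qed.

End LinearODE.

(** * Second-order estimates for smooth functions on balls *)

Section SmoothBounds.
Context {R : realType} {m : nat}.
Local Notation E := ('rV[R]_m * R)%type.

Lemma norm_pair (a : 'rV[R]_m) (b : R) : `|(a, b) : E| = Num.max `|a| `|b|.
Proof. by []. Qed.

Lemma norm_pair_l (a : 'rV[R]_m) : `|(a, 0) : E| = `|a|.
Proof. by rewrite norm_pair normr0; apply/max_idPl. Qed.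

Lemma norm_pair_r (b : R) : `|(0, b) : E| = `|b|.
Proof. by rewrite norm_pair normr0; apply/max_idPr. Qed.

Lemma compact_ball0 (r : R) : compact [set p : E | `|p| <= r].
Proof.
have -> : [set p : E | `|p| <= r] = [set a : 'rV[R]_m | `|a| <= r] `*` `[- r, r].
  apply/seteqP; split=> -[a b] /=; rewrite norm_pair ge_max in_itv/= ler_norml.
    by move=> /andP[].
  by move=> [-> ->].
apply: compact_setX; last exact: segment_compact.
apply: bounded_closed_compact.
  by exists r; split; [exact: num_real|move=> x rx a /= /le_trans; apply; exact: ltW].
apply: (@closed_comp _ _ (fun a : 'rV[R]_m => `|a|) [set x | x <= r]).
  by move=> a _; exact: norm_continuous.
exact: closed_le.
Qed.

Lemma compact_norm_bound (T : topologicalType) (V : normedModType R) (K : set T) (g : T -> V) :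
  compact K -> continuous g -> exists2 L : R, 0 <= L & forall p, K p -> `|g p| <= L.
Proof.
move=> Kc gc; have /compact_bounded[L [_ LP]] : compact (g @` K).
  by apply: continuous_compact => //; exact: continuous_subspaceT.
exists (`|L| + 1) => [|p Kp]; first by rewrite addr_ge0.
by apply: (LP (`|L| + 1)); [rewrite (le_lt_trans (ler_norm _))// ltrDl|exists p].
Qed.

Lemma derive_basis (g : E -> R) (p e : E) : differentiable g p ->
  'D_e g p = \sum_(i < m) e.1 0 i * 'D_(delta_mx 0 i, 0) g p + e.2 * 'D_(0, 1) g p.
Proof.
move=> gd; rewrite !deriveE//.
have eE : e = \sum_(i < m) e.1 0 i *: (delta_mx 0 i, 0) + e.2 *: (0, 1).
  case: e => a b /=; apply/eqP/andP; split; apply/eqP.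
    rewrite [RHS]/= (big_morph fst (id1 := 0) (op1 := +%R))//= scaler0 addr0.
    exact: row_sum_delta.
  rewrite [RHS]/= (big_morph snd (id1 := 0) (op1 := +%R))//= big1.
    by rewrite add0r [RHS]mulr1.
  by move=> i _; rewrite scaler0.
rewrite {1}eE linearD linear_sum linearZ/=; congr (_ + _).
by apply: eq_bigr => i _; rewrite linearZ deriveE.
Qed.

Lemma segment_mean_value (g : E -> R) (p q : E) : (forall x, differentiable g x) ->
  exists2 th : R, 0 <= th <= 1 & g p - g q = 'D_(p - q) g (q + th *: (p - q)).
Proof.
move=> gd; pose e : E := p - q; rewrite -/e; pose phi (th : R) := g (q + th *: e).
have phid (th : R) : is_derive th 1 phi ('D_e g (q + th *: e)).
  have D : derivable g (q + th *: e) e by exact: diff_derivable.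
  have E1 : (fun h : R => h^-1 *: ((phi \o shift th) (h *: 1) - phi th)) =
      (fun h : R => h^-1 *: ((g \o shift (q + th *: e)) (h *: e) - g (q + th *: e))).
    apply/funext => h; congr (_ *: (g _ - _)).
    by rewrite /= [h *: 1]mulr1 scalerDl addrCA.
  by apply: DeriveDef; rewrite /derivable /derive E1.
have phic : continuous phi by move=> th; exact: is_derive_continuous (phid th).
have [th] := MVT ltr01 (fun t _ => phid t) (continuous_subspaceT phic).
rewrite in_itv/= => /andP[/ltW th0 /ltW th1].
rewrite /phi scale1r scale0r addr0 /e subrKC subr0 mulr1 => h.
by exists th => //; rewrite th0.
Qed.

Lemma segment_norm_le (V : normedModType R) (p q z : V) (th d : R) : 0 <= th <= 1 ->
  `|p - z| <= d -> `|q - z| <= d -> `|q + th *: (p - q) - z| <= d.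
Proof.
move=> /andP[th0 th1] pz qz.
have -> : q + th *: (p - q) - z = (1 - th) *: (q - z) + th *: (p - z).
  rewrite scalerBl scale1r !scalerBr opprB -[RHS]addrA.
  by rewrite [X in _ = _ + X]addrC subrKA addrAC addrA.
apply: le_trans (ler_normD _ _) _; rewrite !normrZ !ger0_norm ?subr_ge0//.
have : (1 - th) * `|q - z| <= (1 - th) * d by rewrite ler_wpM2l// subr_ge0.
have : th * `|p - z| <= th * d by rewrite ler_wpM2l.
by lra.
Qed.

Lemma C1_derive_bound (g : E -> R) (r : R) :
  (forall x, differentiable g x) -> (forall v, continuous (fun x => 'D_v g x)) ->
  exists2 L, 0 <= L & forall p e, `|p| <= r -> `|'D_e g p| <= L * `|e|.
Proof.
move=> gd gc.
have ex v : exists L, 0 <= L /\ forall p : E, `|p| <= r -> `|'D_v g p| <= L.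
  by have [L ? ?] := compact_norm_bound (@compact_ball0 r) (gc v); exists L.
have [L LP] := choice (fun i : 'I_m => ex (delta_mx 0 i, 0)).
have [L' [L'0 L'P]] := ex (0, 1).
exists (\sum_i L i + L').
  by rewrite addr_ge0// sumr_ge0// => i _; have [] := LP i.
move=> p e pr; rewrite derive_basis// mulrDl.
have e1 i : `|e.1 0 i| <= `|e|.
  by apply: le_trans (entry_le_norm _ _ _) _; case: (e) => a b; rewrite norm_pair le_max lexx.
have e2 : `|e.2| <= `|e|.
  by case: (e) => a b; rewrite norm_pair le_max lexx orbT.
apply: le_trans (ler_normD _ _) (lerD _ _); last first.
  by rewrite normrM mulrC ler_pM// L'P.
apply: le_trans (ler_norm_sum _ _ _) _; rewrite mulr_suml; apply: ler_sum => i _.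
by rewrite normrM mulrC ler_pM//; have [_] := LP i; exact.
Qed.

Lemma C1_lipschitz (g : E -> R) (r : R) :
  (forall x, differentiable g x) -> (forall v, continuous (fun x => 'D_v g x)) ->
  exists2 L, 0 <= L & forall p q, `|p| <= r -> `|q| <= r -> `|g p - g q| <= L * `|p - q|.
Proof.
move=> gd gc; have [L L0 LP] := C1_derive_bound r gd gc.
exists L => // p q pr qr; have [th thI ->] := segment_mean_value p q gd.
apply: LP; have := @segment_norm_le _ p q 0 th r thI.
by rewrite !subr0; exact.
Qed.

(** What a C^2 function satisfies on a ball, with one constant for all the
    estimates.  In the last one the differential is taken at a point [z] that
    need not lie on the segment from [q] to [p]: the perturbed field is compared
    at two points near the orbit, but linearised on the orbit itself. *)
Definition C2_bound (W : normedModType R) (g : E -> W) (r L : R) : Prop :=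
  [/\ 0 <= L,
      forall p : E, `|p| <= r -> `|g p| <= L,
      forall p e : E, `|p| <= r -> `|'D_e g p| <= L * `|e|,
      forall p q : E, `|p| <= r -> `|q| <= r -> `|g p - g q| <= L * `|p - q| &
      forall (p q z : E) (d : R), `|p| <= r -> `|q| <= r -> `|z| <= r ->
        `|p - z| <= d -> `|q - z| <= d ->
        `|g p - g q - 'D_(p - q) g z| <= L * d * `|p - q|].

Lemma C2_bound_le (W : normedModType R) (g : E -> W) (r L L' : R) :
  L <= L' -> C2_bound g r L -> C2_bound g r L'.
Proof.
move=> LL' [L0 b0 b1 b2 b3]; split.
- exact: le_trans LL'.
- by move=> p /b0 /le_trans; exact.
- by move=> p e /b1 h; apply: le_trans (h e) _; rewrite ler_wpM2r.
- by move=> p q pr qr; apply: le_trans (b2 _ _ pr qr) _; rewrite ler_wpM2r.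
- move=> p q z d pr qr zr pz qz; apply: le_trans (b3 _ _ _ _ pr qr zr pz qz) _.
  rewrite ler_wpM2r// ler_wpM2r//.
  exact: le_trans (normr_ge0 _) pz.
Qed.

(** The partial derivatives are Lipschitz on the ball, being C^1; the mean value
    theorem on the segment from [q] to [p] then gives the Taylor estimate. *)
Lemma smooth_C2_bound_real (g : E -> R) (r : R) : smooth g -> exists L, C2_bound g r L.
Proof.
move=> /(_ 2%N) [gd g2].
have gc v : continuous (fun x => 'D_v g x).
  by move=> x; apply: differentiable_continuous; have [] := g2 v.
have g0 : continuous g by move=> x; exact: differentiable_continuous.
have [L0 L00 b0] := compact_norm_bound (@compact_ball0 r) g0.
have [L1 L10 b1] := C1_derive_bound r gd gc.
have [L2 L20 b2] := C1_lipschitz r gd gc.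
have ex v : exists L, 0 <= L /\ forall p q : E, `|p| <= r -> `|q| <= r ->
    `|'D_v g p - 'D_v g q| <= L * `|p - q|.
  have [gvd gvc] := g2 v.
  by have [L ? ?] := C1_lipschitz r gvd gvc; exists L.
have [K KP] := choice (fun i : 'I_m => ex (delta_mx 0 i, 0)).
have [K' [K'0 K'P]] := ex (0, 1).
have K0 : 0 <= \sum_i K i by rewrite sumr_ge0// => i _; have [] := KP i.
exists (L0 + L1 + L2 + (\sum_i K i + K')); split.
- by rewrite !addr_ge0.
- by move=> p /b0 h; apply: le_trans h _; lra.
- by move=> p e /b1 h; apply: le_trans (h e) _; rewrite ler_wpM2r//; lra.
- by move=> p q pr qr; apply: le_trans (b2 _ _ pr qr) _; rewrite ler_wpM2r//; lra.
move=> p q z d pr qr zr pz qz.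
have d0 : 0 <= d by exact: le_trans (normr_ge0 _) pz.
have [th thI ->] := segment_mean_value p q gd.
set e := p - q; set x := q + _.
have xr : `|x| <= r.
  by have := @segment_norm_le _ p q 0 th r thI; rewrite !subr0; exact.
have xz : `|x - z| <= d by exact: segment_norm_le.
clearbody x; clearbody e; rewrite (derive_basis e (gd x)) (derive_basis e (gd z)) opprD addrACA -sumrB -mulrBr.
apply: (@le_trans _ _ ((\sum_i K i + K') * d * `|e|)); last first.
  by rewrite ler_wpM2r// ler_wpM2r//; lra.
have e1 i : `|e.1 0 i| <= `|e|.
  by apply: le_trans (entry_le_norm _ _ _) _; case: (e) => a b; rewrite norm_pair le_max lexx.
have e2 : `|e.2| <= `|e|.
  by case: (e) => a b; rewrite norm_pair le_max lexx orbT.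
rewrite !mulrDl; apply: le_trans (ler_normD _ _) (lerD _ _); last first.
  rewrite normrM mulrC ler_pM//; apply: le_trans (K'P _ _ xr zr) _.
  by rewrite ler_wpM2l.
apply: le_trans (ler_norm_sum _ _ _) _; rewrite !mulr_suml; apply: ler_sum => i _.
rewrite -mulrBr normrM mulrC ler_pM//; have [K0i Ki] := KP i.
by apply: le_trans (Ki _ _ xr zr) _; rewrite ler_wpM2l.
Qed.

End SmoothBounds.

Section SmoothMatrix.
Context {R : realType}.

Lemma derive_entry (V : normedModType R) a b (f : V -> 'M[R]_(a, b)) x v i j :
  differentiable f x -> 'D_v (fun y => f y i j) x = 'D_v f x i j.
Proof. by move=> fd; rewrite derive_mx ?mxE//; exact: diff_derivable. Qed.

Lemma differentiable_entry (V : normedModType R) a b (f : V -> 'M[R]_(a, b)) x i j :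
  differentiable f x -> differentiable (fun y => f y i j) x.
Proof.
by move=> fd; exact: (differentiable_comp fd (differentiable_coord _ _ _)).
Qed.

Lemma Ck_entry k (V : normedModType R) a b (f : V -> 'M[R]_(a, b)) i j :
  Ck k f -> Ck k (fun x => f x i j).
Proof.
elim: k f => [|k ih] f /=; first exact: continuous_entry.
move=> [fd fk]; split=> [x|v]; first exact: differentiable_entry.
rewrite (_ : (fun x => _) = (fun x => 'D_v f x i j)); first exact: ih.
by apply/funext => x; rewrite derive_entry.
Qed.

End SmoothMatrix.

Section Defect.
Context {R : realType} {m : nat}.
Local Notation E := ('rV[R]_m * R)%type.

Lemma smooth_C2_bound_mx a b (f : E -> 'M[R]_(a, b)) (r : R) :
  smooth f -> exists L, C2_bound f r L.
Proof.
move=> fs.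
have ex (ij : 'I_a * 'I_b) : exists L, C2_bound (fun x => f x ij.1 ij.2) r L.
  by apply: smooth_C2_bound_real => k; apply: Ck_entry; exact: fs.
have [L LP] := choice ex.
have L0 ij : 0 <= L ij by have [] := LP ij.
pose K := \sum_ij L ij.
have KP i j : C2_bound (fun x => f x i j) r K.
  apply: C2_bound_le (LP (i, j)); rewrite /K (bigD1 (i, j))//= lerDl.
  by rewrite sumr_ge0.
have K0 : 0 <= K by rewrite sumr_ge0.
have fd x : differentiable f x by have [] := fs 1%N.
exists K; split=> //.
- by move=> p pr; apply: norm_le_entry => // i j; have [_ + _ _ _] := KP i j; exact.
- move=> p e pr; apply: norm_le_entry => [|i j]; first by rewrite mulr_ge0.
  by rewrite -derive_entry//; have [_ _ + _ _] := KP i j; exact.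
- move=> p q pr qr; apply: norm_le_entry => [|i j]; first by rewrite mulr_ge0.
  by rewrite !mxE; have [_ _ _ + _] := KP i j; exact.
- move=> p q z d pr qr zr pz qz.
  have d0 : 0 <= d by exact: le_trans (normr_ge0 _) pz.
  apply: norm_le_entry => [|i j]; first by rewrite !mulr_ge0.
  by rewrite !mxE -derive_entry//; have [_ _ _ _] := KP i j; exact.
Qed.

(** The field at displacement [w], parameter shift [d] and speed [1 + h], minus
    its value at [z] and its linear part in [w] and [h].  A displacement [w] of
    an orbit solves the perturbed equation run at speed [1 + h] exactly when it
    solves the linearised equation forced by [h] times the field plus this
    defect. *)
Definition defect (W : normedModType R) (g : E -> W) (z : E) (d : R)
    (w : 'rV[R]_m) (h : R) : W :=
  (1 + h) *: g (z + (w, d)) - g z - 'D_(w, 0) g z - h *: g z.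

Lemma norm_pair_le (a : 'rV[R]_m) (b c : R) : `|a| <= c -> `|b| <= c -> `|(a, b) : E| <= c.
Proof. by move=> ac bc; rewrite norm_pair ge_max ac. Qed.

(** As a function of [(w, h, d)] the defect has no linear part in [w] and [h] at
    the origin, so its Lipschitz constant in [(w, h)] on a ball of radius [c] is
    of order [c].  This makes the shadowing operator a contraction. *)
Lemma defect_lipschitz (W : normedModType R) (g : E -> W) (r L : R) (z : E)
    (d c : R) (w1 w2 : 'rV[R]_m) (h1 h2 : R) :
  C2_bound g r L -> differentiable g z -> `|z| + c <= r ->
  `|d| <= c -> `|w1| <= c -> `|w2| <= c -> `|h1| <= c -> `|h2| <= c ->
  `|defect g z d w1 h1 - defect g z d w2 h2| <=
  2 * L * c * (`|w1 - w2| + `|h1 - h2|).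
Proof.
move=> [L0 _ _ lip taylor] gd zr dc w1c w2c h1c h2c.
have c0 : 0 <= c by exact: le_trans dc.
have near w : `|w| <= c -> `|z + (w, d)| <= r.
  move=> wc; apply: le_trans (ler_normD _ _) (le_trans _ zr).
  by rewrite lerD2l; exact: norm_pair_le.
set p := z + (w1, d); set q := z + (w2, d).
have pq : p - q = (w1 - w2, 0).
  rewrite /p /q opprD addrACA subrr add0r.
  by apply/eqP/andP; split; rewrite /= ?subrr.
have zle : `|z| <= r by apply: le_trans zr; rewrite lerDl.
have Dw : 'D_(w1, 0) g z - 'D_(w2, 0) g z = 'D_(p - q) g z.
  rewrite !deriveE// -linearB; congr ('d g z _).
  by rewrite pq; apply/eqP/andP; split; rewrite /= ?subrr.
have -> : defect g z d w1 h1 - defect g z d w2 h2 =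
   (g p - g q - 'D_(p - q) g z) + h1 *: (g p - g q) + (h1 - h2) *: (g q - g z).
  rewrite -Dw /defect -/p -/q !scalerDl !scale1r !scalerBr !scaleNr.
  rewrite !opprD !opprK !addrA.
  by rewrite [RHS](ACl (1*2*3*4*5*8*9*10*(7*6)))/= subrr addr0
    [LHS](ACl (1*6*4*9*2*5*7*10*(8*3)))/= subrr addr0.
have pqE : `|p - q| = `|w1 - w2| by rewrite pq norm_pair_l.
have pz : `|p - z| <= c by rewrite /p addrAC subrr add0r norm_pair_le.
have qz : `|q - z| <= c by rewrite /q addrAC subrr add0r norm_pair_le.
have t1 : `|g p - g q - 'D_(p - q) g z| <= L * c * `|w1 - w2|.
  by rewrite -pqE; apply: taylor => //; exact: near.
have t2 : `|h1 *: (g p - g q)| <= c * (L * `|w1 - w2|).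
  by rewrite normrZ -pqE ler_pM//; apply: lip; exact: near.
have t3 : `|(h1 - h2) *: (g q - g z)| <= `|h1 - h2| * (L * c).
  rewrite normrZ ler_pM//; apply: le_trans (lip _ _ (near _ w2c) zle) _.
  by rewrite ler_wpM2l.
apply: le_trans (ler_normD _ _) _.
have := ler_normD (g p - g q - 'D_(p - q) g z) (h1 *: (g p - g q)).
have : 0 <= L * c * `|h1 - h2| by rewrite !mulr_ge0.
by lra.
Qed.

Lemma defect0E (W : normedModType R) (g : E -> W) (z : E) (d : R) :
  defect g z d 0 0 = g (z + (0, d)) - g z.
Proof.
by rewrite /defect addr0 scale1r scale0r subr0 -[(0, 0)]/(0 : E) derive0 subr0.
Qed.

Lemma defect0_le (W : normedModType R) (g : E -> W) (r L : R) (z : E) (d : R) :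
  C2_bound g r L -> `|z| + `|d| <= r -> `|defect g z d 0 0| <= L * `|d|.
Proof.
move=> [L0 _ _ lip taylor] zr.
have zle : `|z| <= r by apply: le_trans zr; rewrite lerDl.
rewrite defect0E; apply: le_trans (lip _ _ _ _) _ => //.
  by apply: le_trans (ler_normD _ _) _; rewrite norm_pair_r.
by rewrite addrAC subrr add0r norm_pair_r.
Qed.

Lemma defect0_taylor (W : normedModType R) (g : E -> W) (r L : R) (z : E) (d : R) :
  C2_bound g r L -> differentiable g z -> `|z| + `|d| <= r ->
  `|defect g z d 0 0 - d *: 'D_(0, 1) g z| <= L * `|d| ^+ 2.
Proof.
move=> [L0 _ _ lip taylor] gd zr.
have zle : `|z| <= r by apply: le_trans zr; rewrite lerDl.
have dE : z + (0, d) - z = (0, d) by rewrite addrAC subrr add0r.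
have h := taylor (z + (0, d)) z z `|d|.
rewrite dE norm_pair_r subrr normr0 in h.
rewrite defect0E expr2 mulrA.
have -> : d *: 'D_(0, 1) g z = 'D_(0, d) g z.
  rewrite !deriveE// -linearZ; congr ('d g z _).
  by apply/eqP/andP; split; rewrite /= ?scaler0// [d *: 1]mulr1.
apply: h => //.
by apply: le_trans (ler_normD _ _) _; rewrite norm_pair_r.
Qed.

End Defect.

(** * One-sided derivatives and uniqueness of solutions *)

Section OneSided.
Context {R : realType} {V : normedModType R}.
Implicit Types (g : R -> V).

Lemma is_derive_ge0_of g (t : R) l : is_derive t 1 g l -> is_derive_ge0 g t l.
Proof.
move=> gd; have gv : derivable g t 1 by [].
have cv : h^-1 *: (g (t + h) - g t) @[h --> 0^'] --> l.
  rewrite -(@derive_val _ _ _ _ _ _ _ gd) /derive.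
  rewrite (_ : (fun h => _) = (fun h => h^-1 *: ((g \o shift t) (h *: 1) - g t))).
    exact: gv.
  by apply/funext => h; congr (_ *: (g _ - _)); rewrite /= [h *: 1]mulr1 addrC.
by apply: cvg_trans cv; apply: cvg_app; exact: cvg_within.
Qed.

Lemma is_derive_ge0_interior g (t : R) l :
  0 < t -> is_derive_ge0 g t l -> is_derive t 1 g l.
Proof.
move=> t0 gd.
have cv : h^-1 *: ((g \o shift t) (h *: 1) - g t) @[h --> 0^'] --> l.
  rewrite (_ : (fun h => _) = (fun h => h^-1 *: (g (t + h) - g t))); last first.
    by apply/funext => h; congr (_ *: (g _ - _)); rewrite /= [h *: 1]mulr1 addrC.
  apply: cvg_trans gd; apply: cvg_app => A /= wA.
  near=> h.
  have th : `|h| < t by near: h; exact: dnbhs0_lt.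
  have Ah : 0 <= t + h -> A h by near: h; exact: wA.
  by apply: Ah; move: th; rewrite ltr_norml => /andP[]; lra.
by apply: DeriveDef; [apply/cvg_ex; exists l|exact: cvg_lim].
Unshelve. all: by end_near. Qed.

Lemma is_derive_ge0_cvg0 g l : is_derive_ge0 g 0 l ->
  g (Num.max r 0) @[r --> (0 : R)] --> g 0.
Proof.
move=> gd; apply/cvgrPdist_le => e e0.
have nh : \forall h \near (0 : R)^', 0 <= 0 + h ->
    `|l - h^-1 *: (g (0 + h) - g 0)| <= 1.
  by move/cvgrPdist_le: gd => /(_ 1 ltr01).
have n1 : \forall h \near (0 : R), 0 <= h -> h != 0 -> `|g h - g 0| <= h * (`|l| + 1).
  move: nh => [d /= d0 dP]; exists d => //= h dh h0 hn0.
  have := dP h dh hn0; rewrite add0r => /(_ h0) h1.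
  have hp : 0 < h by rewrite lt_neqAle eq_sym hn0.
  rewrite mulrC -ler_pdivrMr// -[X in _ / X](gtr0_norm hp) mulrC -normfV -normrZ.
  rewrite -[_ *: _](subrK l) -[_ - l]opprB; apply: le_trans (ler_normD _ _) _.
  by rewrite normrN addrC lerD2l.
near=> r; have [r0|r0] := leP r 0.
  by rewrite subrr normr0 ltW.
have rle : `|r| < e / (`|l| + 1).
  near: r; apply: (@nbhs0_lt R R); by rewrite divr_gt0// ltr_wpDl.
rewrite distrC; apply: le_trans (_ : r * (`|l| + 1) <= _).
  have n1r : 0 <= r -> r != 0 -> `|g r - g 0| <= r * (`|l| + 1) by near: r; exact: n1.
  by apply: n1r; rewrite ?gt_eqF// ltW.
by rewrite -ler_pdivlMr ?ltr_wpDl// ltW// (le_lt_trans (ler_norm _)).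
Unshelve. all: by end_near. Qed.

(** Freezing a curve at its initial value for negative times makes it continuous
    on the whole line and keeps its derivative at positive times, which is all
    that mean value arguments use. *)
Lemma ge0_extension g (dg : R -> V) :
  (forall t : R, 0 <= t -> is_derive_ge0 g t (dg t)) ->
  continuous (fun t : R => g (Num.max t 0)) /\
  forall t : R, 0 < t -> is_derive t 1 (fun t : R => g (Num.max t 0)) (dg t).
Proof.
move=> gd.
have gpos (t : R) : 0 < t -> is_derive t 1 (fun t : R => g (Num.max t 0)) (dg t).
  move=> t0; apply: (@near_eq_is_derive _ _ _ g).
  - near=> r; congr g; apply/esym/max_idPl.
    by apply: ltW; near: r; exact: lt_nbhsr.
  - exact: is_derive_ge0_interior (gd _ (ltW t0)).
split=> // t; have [t0|t0|<-] := ltgtP 0 t.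
- exact: is_derive_continuous (gpos _ t0).
- rewrite /continuous_at (max_idPr (ltW t0)); apply: cvg_near_cst.
  near=> r; congr g; apply/max_idPr.
  by apply: ltW; near: r; exact: lt_nbhsl.
- by rewrite /continuous_at maxxx; exact: is_derive_ge0_cvg0 (gd _ (lexx 0)).
Unshelve. all: by end_near. Qed.

End OneSided.

Section Uniqueness.
Context {R : realType} {m : nat}.
Variable f : 'rV[R]_m * R -> 'rV[R]_m.
Hypothesis f_smooth : smooth f.

(** Solutions of a time-rescaled equation are determined by their initial value:
    on a compact time interval both stay in a ball where [f] is Lipschitz. *)
Lemma rescaled_ode_unique (s T : R) (c : R -> R) (x y : R -> 'rV[R]_m) :
  0 <= T -> continuous c -> continuous x -> continuous y ->
  (forall t : R, 0 < t < T -> is_derive t 1 x (c t *: f (x t, s))) ->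
  (forall t : R, 0 < t < T -> is_derive t 1 y (c t *: f (y t, s))) ->
  x 0 = y 0 -> x T = y T.
Proof.
move=> T0 cc xc yc xd yd xy0.
have cI : compact (`[0, T] : set R) by exact: segment_compact.
have [C C0 cC] := compact_norm_bound cI cc.
have [rx rx0 xr] := compact_norm_bound cI xc.
have [ry ry0 yr] := compact_norm_bound cI yc.
pose r := rx + ry + `|s|.
have [L [L0 _ _ lip _]] := smooth_C2_bound_mx r f_smooth.
pose d := x - y.
have dc : continuous d by move=> t; apply: continuousB; [exact: xc|exact: yc].
have dd (t : R) : 0 < t < T -> is_derive t 1 d (c t *: f (x t, s) - c t *: f (y t, s)).
  by move=> tT; apply: is_deriveB; [exact: xd|exact: yd].
have dL (t : R) : 0 < t < T -> `|c t *: f (x t, s) - c t *: f (y t, s)| <= C * L * `|d t|.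
  move=> /andP[t0 tT]; have tI : `[0, T]%classic t by rewrite /= in_itv/= !ltW.
  rewrite -scalerBr normrZ -mulrA ler_pM//; first exact: cC.
  have -> : `|d t| = `|(x t, s) - (y t, s)|.
    by rewrite -[d t]/(x t - y t) -norm_pair_l -(subrr s).
  by apply: lip; rewrite norm_pair ge_max /r; apply/andP; split;
    have := xr _ tI; have := yr _ tI; have := normr_ge0 s; lra.
have := gronwall (mulr_ge0 C0 L0) T0 dc dd dL.
rewrite -[d 0]/(x 0 - y 0) xy0 subrr normr0 mulr0 normr_le0 subr_eq0.
by move/eqP.
Qed.

End Uniqueness.

(** * Partial derivatives of the field and of the objective *)

Section PartialDerivatives.
Context {R : realType} {m : nat}.
Local Notation E := ('rV[R]_m * R)%type.

Lemma differentiable_pair_cst (s : R) (u : 'rV[R]_m) :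
  differentiable (fun y : 'rV[R]_m => (y, s) : E) u.
Proof. by apply: differentiable_pair => //; exact: differentiable_cst. Qed.

Lemma derive_state (W : normedModType R) (g : E -> W) (u w : 'rV[R]_m) (s : R) :
  'D_w (fun y => g (y, s)) u = 'D_(w, 0) g (u, s).
Proof.
rewrite /derive; set F := fun h : R => _; set G := fun h : R => _.
suff -> : F = G by [].
apply/funext => h; rewrite /F /G /=; congr (_ *: (g _ - _)).
by apply/eqP/andP; split; rewrite /= ?scaler0 ?add0r.
Qed.

Lemma derive_param (W : normedModType R) (g : E -> W) (u : 'rV[R]_m) (s : R) :
  derive1 (fun r => g (u, r)) s = 'D_(0, 1) g (u, s).
Proof.
rewrite derive1E /derive; set F := fun h : R => _; set G := fun h : R => _.
suff -> : F = G by [].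
apply/funext => h; rewrite /F /G /=; congr (_ *: (g _ - _)).
by apply/eqP/andP; split; rewrite /= ?scaler0 ?add0r.
Qed.

Lemma is_derive_along (W : normedModType R) (g : E -> W) (x : R -> 'rV[R]_m)
    (s t : R) (dx : 'rV[R]_m) :
  (forall p, differentiable g p) -> is_derive t 1 x dx ->
  is_derive t 1 (fun r => g (x r, s)) ('D_(dx, 0) g (x t, s)).
Proof.
move=> gd xd.
have xt : derivable x t 1 by [].
have xdf : differentiable x t by apply/derivable1_diffP.
have cd : differentiable (fun r : R => (x r, s) : E) t.
  by apply: differentiable_pair => //; exact: differentiable_cst.
have gcd : differentiable (g \o (fun r : R => (x r, s) : E)) t.
  exact: differentiable_comp.
apply: DeriveDef; first exact: diff_derivable.
have dx1 : 'd x t 1 = dx by rewrite -(@derive_val _ _ _ _ _ _ _ xd) deriveE.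
have cE := diff_pair xdf (differentiable_cst s t).
rewrite !deriveE// -[X in 'd X t](_ : g \o (fun r : R => (x r, s) : E) = _)//.
rewrite diff_comp//= cE dx1; congr ('d g _ (_, _)).
by rewrite diff_cst.
Qed.

Variables (f : E -> 'rV[R]_m) (J : E -> R).
Hypothesis f_smooth : smooth f.
Hypothesis J_smooth : smooth J.

Lemma smooth_differentiable (W : normedModType R) (g : E -> W) p :
  smooth g -> differentiable g p.
Proof. by move=> /(_ 1%N) []. Qed.

Lemma smooth_continuous (W : normedModType R) (g : E -> W) : smooth g -> continuous g.
Proof. by move=> /(_ 0%N). Qed.

Lemma smooth_derive_continuous (W : normedModType R) (g : E -> W) v :
  smooth g -> continuous (fun p => 'D_v g p).
Proof. by move=> /(_ 1%N) [_ /(_ v)]. Qed.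

Lemma continuous_along (S T : topologicalType) (g : E -> T) (x : S -> 'rV[R]_m)
    (s : R) :
  continuous g -> continuous x -> continuous (fun t => g (x t, s)).
Proof.
move=> gc xc t; apply: (@continuous_comp _ _ _ (fun r => (x r, s)) g); last exact: gc.
have xct : x @ t --> x t by exact: xc.
have sct : (fun=> s) @ t --> s by exact: cvg_cst.
exact: (cvg_pair xct sct).
Qed.

(** The tangent equation in coordinates: rows are multiplied on the right by the
    Jacobian, and this is the directional derivative of the field. *)
Lemma mulmx_f_u (u w : 'rV[R]_m) (s : R) : w *m f_u f u s = 'D_(w, 0) f (u, s).
Proof.
rewrite -derive_state deriveEjacobian//.
apply: (@differentiable_comp _ _ _ _ (fun y => (y, s)) f).
  exact: differentiable_pair_cst.
exact: smooth_differentiable.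
Qed.

Lemma dot_mulmx (x y : 'rV[R]_m) : dot x y = (x *m y^T) 0 0.
Proof. by rewrite /dot mxE; apply: eq_bigr => i _; rewrite mxE. Qed.

Lemma dot_J_u (u w : 'rV[R]_m) (s : R) : dot w (J_u J u s) = 'D_(w, 0) J (u, s).
Proof.
rewrite derive_basis; last exact: smooth_differentiable.
rewrite /= mul0r addr0; apply: eq_bigr => i _.
by rewrite mxE derive_state.
Qed.

Lemma f_sE (u : 'rV[R]_m) (s : R) : f_s f u s = 'D_(0, 1) f (u, s).
Proof. exact: derive_param. Qed.

Lemma J_sE (u : 'rV[R]_m) (s : R) : J_s J u s = 'D_(0, 1) J (u, s).
Proof. exact: derive_param. Qed.

Variables (s : R) (x : R -> 'rV[R]_m).
Hypothesis x_continuous : continuous x.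

Lemma f_u_continuous : continuous (fun t => f_u f (x t) s).
Proof.
apply: continuous_mx => i j.
rewrite (_ : (fun t => _) = (fun t => 'D_(delta_mx 0 i, 0) f (x t, s) 0 j)); last first.
  by apply/funext => t; rewrite -mulmx_f_u -rowE [RHS]mxE.
apply: continuous_entry.
apply: (@continuous_along _ _ (fun p => 'D_(delta_mx 0 i, 0) f p)) => //.
exact: smooth_derive_continuous.
Qed.

Lemma J_u_continuous : continuous (fun t => J_u J (x t) s).
Proof.
apply: continuous_mx => i j.
rewrite (_ : (fun t => _) = (fun t => 'D_(delta_mx 0 j, 0) J (x t, s))); last first.
  by apply/funext => t; rewrite mxE derive_state.
apply: (@continuous_along _ _ (fun p => 'D_(delta_mx 0 j, 0) J p)) => //.
exact: smooth_derive_continuous.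
Qed.

End PartialDerivatives.

(** * Fundamental matrices, dichotomies and splittings *)

Section Fundamental.
Context {R : realType} {n : nat}.
Implicit Types (M Phi Psi : R -> 'M[R]_n).

(** Rows are propagated on the right: a solution of [w' = w *m M] is
    [w 0 *m Phi t], and [Psi tau *m Phi t] is the transition from time [tau] to
    time [t]. *)
Record fundamental M Phi Psi : Prop := Fundamental {
  fund0 : Phi 0 = 1%:M;
  fund_derive : forall t : R, is_derive t 1 Phi (Phi t *m M t);
  fund_inv_derive : forall t : R, is_derive t 1 Psi (- (M t *m Psi t));
  fundK : forall t, Phi t *m Psi t = 1%:M }.

Lemma fundKV M Phi Psi t : fundamental M Phi Psi -> Psi t *m Phi t = 1%:M.
Proof. by move=> F; apply: mulmx1C; exact: fundK F t. Qed.

Lemma fundV0 M Phi Psi : fundamental M Phi Psi -> Psi 0 = 1%:M.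
Proof. by move=> F; have := fundK F 0; rewrite (fund0 F) mul1mx. Qed.

Lemma fundamental_exists M (B : R) : continuous M -> (forall t, `|M t| <= B) ->
  exists Phi Psi, fundamental M Phi Psi.
Proof.
move=> Mc MB.
have [Phi [Phi0 Phid]] := linear_ode 1%:M Mc MB.
have Mtc : continuous (fun t => - (M t)^T).
  by move=> t; apply: cvgN; exact: continuous_trmx.
have MtB t : `|- (M t)^T| <= B by rewrite normrN norm_trmx.
have [X [X0 Xd]] := linear_ode 1%:M Mtc MtB.
exists Phi, (fun t => (X t)^T).
have Psid (t : R) : is_derive t 1 (fun r => (X r)^T) (- (M t *m (X t)^T)).
  apply: (is_derive_eq (is_derive_trmx (Xd t))).
  by rewrite trmx_mul linearN/= trmxK mulNmx.
split=> // t.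
apply: (@eq_derive_eq R n n (fun r => Phi r *m (X r)^T) (fun=> 1%:M) (fun=> 0) 0 t).
- move=> r; apply: (is_derive_eq (is_derive_mulmx (Phid r) (Psid r))).
  by rewrite mulmxN mulmxA subrr.
- by rewrite Phi0 X0 trmx1 mulmx1.
Qed.

(** Gronwall forwards; backwards, Gronwall for the time-reversed curve. *)
Lemma linear_growth M (w : R -> 'rV[R]_n) (L t0 t : R) :
  (forall t, `|M t| <= L) -> (forall t : R, is_derive t 1 w (w t *m M t)) ->
  `|w t| <= n%:R * expR (n%:R * (n%:R * L) * `|t - t0|) * `|w t0|.
Proof.
move=> ML wd.
have L0 : 0 <= L by exact: le_trans (ML 0).
have wc : continuous w by move=> r; exact: is_derive_continuous (wd r).
have nL0 : 0 <= n%:R * L by rewrite mulr_ge0.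
have wL r : `|w r *m M r| <= n%:R * L * `|w r|.
  apply: le_trans (norm_mulmx _ _) _.
  by rewrite -!mulrA ler_wpM2l// mulrC ler_wpM2r.
have [tt|tt] := leP t0 t.
  have := gronwall nL0 tt wc (fun r _ => wd r) (fun r _ => wL r).
  by rewrite mul1n ger0_norm ?subr_ge0.
pose v r := w (- r).
have vd (r : R) : is_derive r 1 v (- (w (- r) *m M (- r))).
  have := is_derive_reparam (wd (- r)) (is_deriveNid _ _).
  by rewrite scaleN1r.
have vc : continuous v by move=> r; exact: is_derive_continuous (vd r).
have vL r : `|- (w (- r) *m M (- r))| <= n%:R * L * `|v r| by rewrite normrN.
have tt' : - t0 <= - t by rewrite lerN2 ltW.
have := gronwall nL0 tt' vc (fun r _ => vd r) (fun r _ => vL r).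
by rewrite mul1n /v !opprK ltr0_norm ?subr_lt0// opprB [- t + _]addrC.
Qed.

End Fundamental.

Section Dichotomy.
Context {R : realType} {n : nat}.

(** [Pu] and [Ps] project at time [0]; carried to time [tau] they become
    [Psi tau *m Pu *m Phi tau] and [Psi tau *m Ps *m Phi tau].  The product
    [Psi tau *m Pu *m Phi t] projects at time [tau] and then moves to time [t]:
    the unstable part decays backwards, the stable part forwards. *)
Record dichotomy (Phi Psi : R -> 'M[R]_n) (Pu Ps : 'M[R]_n) (K l : R) : Prop :=
  Dichotomy {
    dich_ge0 : 0 <= K;
    dich_gt0 : 0 < l;
    dich_u : forall t tau, t <= tau ->
      `|Psi tau *m Pu *m Phi t| <= K * expR (- l * (tau - t));
    dich_s : forall t tau, tau <= t ->
      `|Psi tau *m Ps *m Phi t| <= K * expR (- l * (t - tau)) }.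

(** The adjoint equation has the fundamental matrix [(Psi t)^T].  Transposing the
    transition matrices reverses time, so that stable and unstable parts are
    exchanged; the max norm does not see the transposition. *)
Lemma dichotomy_adjoint Phi Psi Pu Ps K l : dichotomy Phi Psi Pu Ps K l ->
  dichotomy (fun t => (Psi t)^T) (fun t => (Phi t)^T) Ps^T Pu^T K l.
Proof.
move=> [K0 l0 du ds]; split=> // t tau tt; rewrite -!trmx_mul norm_trmx mulmxA.
  exact: ds.
exact: du.
Qed.

(** [q *m f0] is the third projection, onto the neutral line spanned by [f0]; the
    column [q] reads off the coefficient along [f0]. *)
Record splitting (Pu Ps : 'M[R]_n) (q : 'cV[R]_n) (f0 : 'rV[R]_n) : Prop :=
  Splitting {
    split_sum : Pu + Ps + q *m f0 = 1%:M;
    split_us : Pu *m Ps = 0;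
    split_uq : Pu *m q = 0;
    split_fu : f0 *m Pu = 0;
    split_fs : f0 *m Ps = 0;
    split_fq : f0 *m q = 1%:M }.

Lemma mulmx_rV_eq0 k (c : 'M[R]_(k, 1)) (f0 : 'rV[R]_n) :
  f0 != 0 -> c *m f0 = 0 -> c = 0.
Proof.
move=> /eqP f0N0 cf; apply/matrixP => i j; rewrite !mxE (ord1 j).
have /existsP[l fl] : [exists l, f0 0 l != 0].
  apply: contra_notT f0N0; rewrite negb_exists => /forallP h.
  by apply/rowP => l; rewrite mxE; have := h l; rewrite negbK => /eqP.
have := congr1 (fun A : 'M[R]_(k, n) => A i l) cf.
rewrite !mxE big_ord1 => /eqP; rewrite mulf_eq0 (negPf fl) orbF => /eqP.
exact.
Qed.

(** A direct sum is a statement about ranks, hence symmetric in the three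
    summands; each of them is therefore in direct sum with the two others, and
    the three projections add up to the identity. *)
Lemma splitting_exists (Vp Vm : 'M[R]_n) (f0 : 'rV[R]_n) :
  f0 != 0 -> mxdirect (Vp + Vm + <<f0>>) -> row_full (Vp + Vm + <<f0>>)%MS ->
  exists (Ps : 'M[R]_n) (q : 'cV[R]_n),
    [/\ splitting (proj_mx Vp (Vm + <<f0>>)%MS) Ps q f0,
        (proj_mx Vp (Vm + <<f0>>)%MS <= Vp)%MS & (Ps <= Vm)%MS].
Proof.
move=> f0N0 dir full; set V0 := <<f0>>%MS.
have rk : \rank (Vp + Vm + V0)%MS = (\rank Vp + \rank Vm + \rank V0)%N.
  by move: dir; rewrite mxdirectE/= => /eqP.
have capu : (Vp :&: (Vm + V0) = 0)%MS.
  apply/eqP; rewrite -mxrank_eq0 -leqn0.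
  have := mxrank_sum_cap Vp (Vm + V0)%MS; rewrite addsmxA rk.
  by have := mxrank_sum_cap Vm V0; lia.
have caps : (Vm :&: (Vp + V0) = 0)%MS.
  apply/eqP; rewrite -mxrank_eq0 -leqn0.
  have := mxrank_sum_cap Vm (Vp + V0)%MS; rewrite addsmxA [(Vm + Vp)%MS]addsmxC rk.
  by have := mxrank_sum_cap Vp V0; lia.
set Pu := proj_mx Vp _; set Ps := proj_mx Vm (Vp + V0)%MS.
have Pu_sub : (Pu <= Vp)%MS by rewrite -[Pu]mul1mx proj_mx_sub.
have Ps_sub : (Ps <= Vm)%MS by rewrite -[Ps]mul1mx proj_mx_sub.
have PuPs : Pu *m Ps = 0.
  by apply: proj_mx_0 => //; exact: submx_trans Pu_sub (addsmxSl _ _).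
have PuPu : Pu *m Pu = Pu by exact: proj_mx_id.
have P0 : (1%:M - Pu - Ps <= V0)%MS.
  have : (1%:M - Pu <= Vm + V0)%MS.
    by rewrite -[Pu]mul1mx proj_mx_compl_sub// addsmxA submx_full.
  case/sub_addsmxP => -[D1 D2] /= E1.
  have : (1%:M - Pu) *m Ps = D1 *m Vm.
    rewrite E1 mulmxDl [X in _ + X]proj_mx_0//.
      by rewrite addr0 proj_mx_id// submxMl.
    exact: submx_trans (submxMl _ _) (addsmxSr _ _).
  rewrite mulmxBl mul1mx PuPs subr0 => ->.
  by rewrite E1 addrC addKr submxMl.
have f0V0 : (f0 <= V0)%MS by rewrite genmxE.
have f0Pu : f0 *m Pu = 0.
  by apply: proj_mx_0 => //; exact: submx_trans f0V0 (addsmxSr _ _).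
have f0Ps : f0 *m Ps = 0.
  by apply: proj_mx_0 => //; exact: submx_trans f0V0 (addsmxSr _ _).
have /submxP[q qE] : (1%:M - Pu - Ps <= f0)%MS by rewrite genmxE in P0.
exists Ps, q; split=> //; split=> //.
- by rewrite -qE -[1%:M - Pu - Ps]addrA -opprD subrKC.
- by apply: (mulmx_rV_eq0 f0N0); rewrite -mulmxA -qE !mulmxBr mulmx1 PuPu PuPs subrr subr0.
- apply/eqP; rewrite -subr_eq0; apply/eqP/(mulmx_rV_eq0 f0N0).
  by rewrite mulmxBl mul1mx -mulmxA -qE !mulmxBr mulmx1 f0Pu f0Ps !subr0 subrr.
Qed.

End Dichotomy.

(** * Exponential dichotomy along an orbit of the attractor *)

Section Enorm.
Context {R : realType} {m : nat}.
Implicit Types v : 'rV[R]_m.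

Lemma norm_le_enorm v : `|v| <= enorm v.
Proof.
apply: norm_le_entry; first exact: sqrtr_ge0.
move=> i j; rewrite (ord1 i) -sqrtr_sqr ler_wsqrtr// /dot (bigD1 j)//= -expr2 lerDl.
by apply: sumr_ge0 => k _; rewrite -expr2 sqr_ge0.
Qed.

Lemma enorm_le_norm v : enorm v <= m%:R * `|v|.
Proof.
rewrite -[leRHS]ger0_norm ?mulr_ge0// -sqrtr_sqr ler_wsqrtr//.
apply: (@le_trans _ _ (\sum_(i < m) `|v| ^+ 2)).
  apply: ler_sum => i _; rewrite -expr2 -real_normK ?num_real//.
  by rewrite ler_pXn2r ?nnegrE// entry_le_norm.
rewrite sumr_const card_ord -[X in X <= _]mulr_natl exprMn ler_wpM2r ?sqr_ge0//.
by rewrite -natrX ler_nat; case: (m) => // n; rewrite expnS expn1 leq_pmulr.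
Qed.

Lemma norm_dot v (w : 'rV[R]_m) : `|dot v w| <= m%:R * `|v| * `|w|.
Proof.
rewrite dot_mulmx; apply: le_trans (entry_le_norm _ _ _) _.
by apply: le_trans (norm_mulmx _ _) _; rewrite norm_trmx.
Qed.

End Enorm.

Section HyperbolicOrbit.
Context {R : realType} {m : nat}.
Variables (f : 'rV[R]_m * R -> 'rV[R]_m) (s : R) (A : set 'rV[R]_m)
  (Vp Vm : 'rV[R]_m -> 'M[R]_m).
Hypothesis f_smooth : smooth f.
Hypothesis A_compact : compact A.
Hypothesis hyp : uniform_hyperbolic f s A Vp Vm.

Variable x : R -> 'rV[R]_m.
Hypothesis x_orbit : full_orbit f s x.
Hypothesis x_A : forall t, A (x t).

Let M t := f_u f (x t) s.

Lemma orbit_continuous : continuous x.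
Proof. by move=> t; exact: is_derive_continuous (x_orbit t). Qed.

Lemma orbit_f_u_bound : exists2 L : R, 0 <= L & forall t, `|M t| <= L.
Proof.
have [r r0 rA] := compact_norm_bound A_compact (fun a => @cvg_id _ (nbhs a)).
have [L [L0 _ Lb _ _]] := smooth_C2_bound_mx (Num.max r `|s|) f_smooth.
exists L => // t; apply: norm_row_le => // w.
rewrite /M mulmx_f_u// -(norm_pair_l w); apply: Lb.
by rewrite norm_pair ge_max !le_max rA ?lexx ?orbT.
Qed.

Lemma f_derive_along (t : R) :
  is_derive t 1 (fun r => f (x r, s)) (f (x t, s) *m M t).
Proof.
rewrite /M mulmx_f_u//; apply: is_derive_along; last exact: x_orbit.
by move=> p; exact: smooth_differentiable.
Qed.

(** The field is itself a solution of the tangent equation. *)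
Lemma f_along_orbit Phi Psi t : fundamental M Phi Psi ->
  f (x 0, s) *m Phi t = f (x t, s).
Proof.
move=> F.
have fd := f_derive_along.
have : f (x t, s) *m Psi t = f (x 0, s).
  rewrite -[RHS]mulmx1 -(fundV0 F).
  apply: (@eq_derive_eq R _ _ (fun r => f (x r, s) *m Psi r) (fun=> f (x 0, s) *m Psi 0) (fun=> 0) 0 t) => //.
  move=> r; apply: (is_derive_eq (is_derive_mulmx (fd r) (fund_inv_derive F r))).
  by rewrite mulmxN mulmxA subrr.
by move=> <-; rewrite -mulmxA (fundKV t F) mulmx1.
Qed.

Lemma orbit_f_bounds : exists F d : R,
  [/\ 0 <= F, 0 < d & forall t, d <= `|f (x t, s)| <= F].
Proof.
have fc : continuous (fun u => f (u, s)).
  apply: (@continuous_along _ _ _ _ f id); first exact: smooth_continuous.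
  by move=> u; exact: cvg_id.
have [F F0 FP] := compact_norm_bound A_compact fc.
have A0 : A !=set0 by exists (x 0).
have nfc : {within A, continuous (fun u => `|f (u, s)|)}.
  apply: continuous_subspaceT => u; apply: continuous_comp; first exact: fc.
  exact: norm_continuous.
have [c + cmin] := compact_EVT_min A0 A_compact nfc.
rewrite inE => Ac.
exists F, `|f (c, s)|; split=> //; first by rewrite normr_gt0; exact: neutral_neq0 hyp _ Ac.
by move=> t; rewrite cmin ?inE//= FP.
Qed.

Lemma tangent_flow_shift Phi Psi tau t (v : 'rV[R]_m) : fundamental M Phi Psi ->
  tangent_flow f s (fun r => x (r + tau)) 0 (t - tau) v (v *m Psi tau *m Phi t).
Proof.
move=> F; exists (fun r => v *m Psi tau *m Phi (r + tau)); split.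
- move=> r; have := @is_derive_reparam _ _ _ Phi (shift tau) r _ _
    (fund_derive F (r + tau)) (is_derive_shift r 1 tau).
  rewrite scale1r => d.
  have := is_derive_mulmx (is_derive_cst (v *m Psi tau) r 1) d.
  by rewrite mul0mx add0r mulmxA.
- by rewrite add0r -mulmxA (fundKV tau F) mulmx1.
- by rewrite subrK.
Qed.

Lemma full_orbit_shift tau : full_orbit f s (fun r => x (r + tau)).
Proof.
move=> r; have := @is_derive_reparam _ _ _ x (shift tau) r _ _
  (x_orbit (r + tau)) (is_derive_shift r 1 tau).
by rewrite scale1r.
Qed.

(** Only the uniform bound on the projections is not immediate.  Let [y] have
    components [a], [b] and [c *: f].  Moving by a large time [T] forwards
    (backwards) expands the unstable (stable) component by at least
    [expR (l * T) / C1], while the other two components stay bounded in terms of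
    their initial size and [y] grows by at most a fixed factor [G].  Comparing
    the two sides bounds [`|a| + `|b|] by a multiple of [`|y|], since [c] is
    itself controlled by [`|y| + `|a| + `|b|]: the field is bounded away from
    [0] on the attractor. *)
Lemma orbit_dichotomy : exists Phi Psi Ps q K l,
  [/\ fundamental M Phi Psi,
      splitting (unstable_proj f Vp Vm (x 0) s) Ps q (f (x 0, s)),
      dichotomy Phi Psi (unstable_proj f Vp Vm (x 0) s) Ps K l &
      forall t, `|Psi t *m q| <= K].
Proof.
have [L L0 ML] := orbit_f_u_bound.
have [Phi [Psi F]] := fundamental_exists (f_u_continuous f_smooth orbit_continuous) ML.
have [Ps [q [S Pu_sub Ps_sub]]] := splitting_exists (neutral_neq0 hyp (x_A 0))
  (splitting_direct hyp (x_A 0)) (splitting_full hyp (x_A 0)).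
rewrite -/(unstable_proj f Vp Vm (x 0) s) in S Pu_sub.
set Pu := unstable_proj f Vp Vm (x 0) s in S Pu_sub *.
have [F1 [d [F10 d0 fb]]] := orbit_f_bounds.
have [C [l [C0 l0 contr]]] := splitting_contracting hyp.
pose C1 := C * m%:R.
have C10 : 0 <= C1 by rewrite mulr_ge0// ltW.
have inv t (v : 'rV_m) : ((v <= Vp (x 0))%MS -> (v *m Phi t <= Vp (x t))%MS) /\
    ((v <= Vm (x 0))%MS -> (v *m Phi t <= Vm (x t))%MS).
  apply: (splitting_invariant hyp x_orbit (x_A 0)).
  have := tangent_flow_shift 0 t v F.
  rewrite subr0 (fundV0 F) mulmx1.
  by under eq_fun do rewrite addr0.
have contr_norm (e : R) (v w : 'rV[R]_m) : 0 <= e -> enorm w <= C * e * enorm v ->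
    `|w| <= C1 * e * `|v|.
  move=> e0 h; apply: le_trans (norm_le_enorm _) _; apply: le_trans h _.
  have -> : C1 * e * `|v| = C * e * (m%:R * `|v|) by rewrite /C1; ring.
  by rewrite ler_wpM2l ?enorm_le_norm// mulr_ge0// ltW.
have cu t tau (v : 'rV[R]_m) : t <= tau -> (v <= Vp (x tau))%MS ->
    `|v *m Psi tau *m Phi t| <= C1 * expR (- l * (tau - t)) * `|v|.
  move=> tt vV; apply: contr_norm; first exact: expR_ge0.
  have := contr (fun r => x (r + tau)) (t - tau) v _ (full_orbit_shift tau) _
    (tangent_flow_shift tau t v F).
  rewrite add0r => /(_ (x_A _)) [+ _] => /(_ vV).
  by rewrite subr_le0 ler0_norm ?subr_le0// opprB; exact.
have cs t tau (v : 'rV[R]_m) : tau <= t -> (v <= Vm (x tau))%MS ->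
    `|v *m Psi tau *m Phi t| <= C1 * expR (- l * (t - tau)) * `|v|.
  move=> tt vV; apply: contr_norm; first exact: expR_ge0.
  have := contr (fun r => x (r + tau)) (t - tau) v _ (full_orbit_shift tau) _
    (tangent_flow_shift tau t v F).
  rewrite add0r => /(_ (x_A _)) [_] => /(_ vV).
  by rewrite subr_ge0 ger0_norm ?subr_ge0//; exact.
(* Components of y taken at time tau and moved to time t, where they lie in the
   unstable and stable spaces of the point reached. *)
pose U y tau t : 'rV[R]_m := y *m Psi tau *m Pu *m Phi t.
pose S' y tau t : 'rV[R]_m := y *m Psi tau *m Ps *m Phi t.
have UV y tau t : (U y tau t <= Vp (x t))%MS.
  by apply: (inv t _).1; exact: submx_trans (submxMl _ _) Pu_sub.
have SV y tau t : (S' y tau t <= Vm (x t))%MS.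
  by apply: (inv t _).2; exact: submx_trans (submxMl _ _) Ps_sub.
have PsiPhi (B : 'rV[R]_m) t t' : B *m Phi t' *m Psi t' *m Phi t = B *m Phi t.
  by rewrite -(mulmxA B) (fundK F) mulmx1.
have Ule y tau t t' : t <= t' ->
    `|U y tau t| <= C1 * expR (- l * (t' - t)) * `|U y tau t'|.
  by move=> tt; have := cu t t' _ tt (UV y tau t'); rewrite PsiPhi.
have Sle y tau t t' : t' <= t ->
    `|S' y tau t| <= C1 * expR (- l * (t - t')) * `|S' y tau t'|.
  by move=> tt; have := cs t t' _ tt (SV y tau t'); rewrite PsiPhi.
pose c (y : 'rV[R]_m) tau : R := (y *m Psi tau *m q) 0 0.
have sumE y tau t : y *m Psi tau *m Phi t =
    U y tau t + S' y tau t + c y tau *: f (x t, s).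
  rewrite /U /S' -mulmxDl -mulmxDr -(f_along_orbit t F) scalemxAl -mulmxDl.
  rewrite -mul_scalar_mx /c -mx11_scalar -(mulmxA _ q) -mulmxDr (split_sum S).
  by rewrite mulmx1.
pose kappa := 2 * F1 / d.
have kappa0 : 0 <= kappa by rewrite /kappa divr_ge0 ?mulr_ge0// ltW.
(* kappa, twice the ratio of the bounds on the speed along the orbit, is the price
   of the neutral component in the estimate of a + b; T is taken so long that the
   factor e absorbs it. *)
have [T T0 Te] : exists2 T : R, 0 <= T & C1 * expR (- l * T) <= (2 * (1 + kappa))^-1.
  by apply: expR_decay => //; rewrite invr_gt0 mulr_gt0// ltr_wpDr.
pose e := C1 * expR (- l * T).
pose G := m%:R * expR (m%:R * (m%:R * L) * T).
have growth (y : 'rV[R]_m) tau t : `|t - tau| = T -> `|y *m Psi tau *m Phi t| <= G * `|y|.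
  move=> tT; have := @linear_growth _ _ M (fun r => y *m Psi tau *m Phi r) L tau t ML.
  rewrite -[y *m Psi tau *m Phi tau]mulmxA (fundKV tau F) mulmx1 tT; apply.
  move=> r; have := is_derive_mulmx (is_derive_cst (y *m Psi tau) r 1) (fund_derive F r).
  by rewrite mul0mx add0r mulmxA.
have G0 : 0 <= G by rewrite mulr_ge0// expR_ge0.
have e0 : 0 <= e by rewrite mulr_ge0// expR_ge0.
have ek : e * (1 + kappa) <= 1 / 2.
  have k1 : 0 < 1 + kappa by rewrite ltr_wpDr.
  rewrite -ler_pdivlMr//; apply: le_trans Te _.
  by rewrite invfM div1r.
have e1 : e <= 1.
  have : 0 <= e * kappa by rewrite mulr_ge0.
  by lra.
pose K := 2 * (2 * G + kappa).
have K0 : 0 <= K by rewrite mulr_ge0// addr_ge0// mulr_ge0.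
have cd y tau : `|c y tau| * d <= `|y| + (`|U y tau tau| + `|S' y tau tau|).
  apply: (@le_trans _ _ `|c y tau *: f (x tau, s)|).
    by rewrite normrZ ler_wpM2l//; have /andP[] := fb tau.
  have -> : c y tau *: f (x tau, s) = y - (U y tau tau + S' y tau tau).
    have := sumE y tau tau; rewrite -[LHS]mulmxA (fundKV tau F) mulmx1 => yE.
    by rewrite [X in X - _]yE [X in X - _]addrC addrK.
  by apply: le_trans (ler_normB _ _) _; rewrite lerD2l ler_normD.
have bound y tau : `|U y tau tau| + `|S' y tau tau| <= K * `|y|.
  set a := `|U y tau tau|; set b := `|S' y tau tau|.
  have [a0 b0] : 0 <= a /\ 0 <= b by rewrite !normr_ge0.
  have a1 : a <= e * `|U y tau (tau + T)|.
    by have := @Ule y tau tau (tau + T); rewrite addrAC subrr add0r; apply; rewrite lerDl.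
  have b1 : b <= e * `|S' y tau (tau - T)|.
    by have := @Sle y tau tau (tau - T); rewrite opprB subrKC; apply; rewrite gerBl.
  have a2 : `|S' y tau (tau + T)| <= e * b.
    by have := @Sle y tau (tau + T) tau; rewrite addrAC subrr add0r; apply; rewrite lerDl.
  have b2 : `|U y tau (tau - T)| <= e * a.
    by have := @Ule y tau (tau - T) tau; rewrite opprB subrKC; apply; rewrite gerBl.
  have U1 : `|U y tau (tau + T)| <= G * `|y| + b + `|c y tau| * F1.
    have -> : U y tau (tau + T) = y *m Psi tau *m Phi (tau + T)
        - S' y tau (tau + T) - c y tau *: f (x (tau + T), s).
      by rewrite sumE addrAC addrK addrK.
    apply: le_trans (ler_normB _ _) (lerD _ _).
      apply: le_trans (ler_normB _ _) (lerD _ _).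
        by apply: growth; rewrite addrAC subrr add0r ger0_norm.
      by apply: le_trans a2 _; rewrite ler_piMl.
    by rewrite normrZ ler_wpM2l//; have /andP[] := fb (tau + T).
  have S1 : `|S' y tau (tau - T)| <= G * `|y| + a + `|c y tau| * F1.
    have -> : S' y tau (tau - T) = y *m Psi tau *m Phi (tau - T)
        - U y tau (tau - T) - c y tau *: f (x (tau - T), s).
      by rewrite sumE addrAC addrK (addrC (U _ _ _)) addrK.
    apply: le_trans (ler_normB _ _) (lerD _ _).
      apply: le_trans (ler_normB _ _) (lerD _ _).
        by apply: growth; rewrite addrAC subrr add0r normrN ger0_norm.
      by apply: le_trans b2 _; rewrite ler_piMl.
    by rewrite normrZ ler_wpM2l//; have /andP[] := fb (tau - T).
  have cF : 2 * (`|c y tau| * F1) <= kappa * (`|y| + (a + b)).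
    have -> : 2 * (`|c y tau| * F1) = kappa * (`|c y tau| * d).
      by rewrite /kappa; field; rewrite gt_eqF.
    by rewrite ler_wpM2l//; exact: cd.
  have h1 : a + b <= e * (2 * G * `|y| + (a + b) + kappa * (`|y| + (a + b))).
    apply: le_trans (lerD a1 b1) _; rewrite -mulrDr ler_wpM2l//.
    by apply: le_trans (lerD U1 S1) _; lra.
  have h2 : e * (1 + kappa) * (a + b) <= 1 / 2 * (a + b).
    by rewrite ler_wpM2r// addr_ge0.
  have h3 : e * ((2 * G + kappa) * `|y|) <= 1 * ((2 * G + kappa) * `|y|).
    by rewrite ler_wpM2r// mulr_ge0// addr_ge0// mulr_ge0.
  by rewrite /K; lra.
have cbound y tau : `|c y tau| <= (1 + K) / d * `|y|.
  rewrite mulrAC ler_pdivlMr//; apply: le_trans (cd y tau) _.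
  by have := bound y tau; lra.
exists Phi, Psi, Ps, q, (C1 * K + (1 + K) / d), l.
have Kd0 : 0 <= (1 + K) / d by rewrite divr_ge0 ?addr_ge0// ltW.
have CK0 : 0 <= C1 * K by rewrite mulr_ge0.
split=> //.
  split=> //.
  - by rewrite addr_ge0.
  - move=> t tau tt; apply: norm_row_le; first by rewrite mulr_ge0 ?expR_ge0// addr_ge0.
    move=> y; rewrite 2!mulmxA; rewrite -[X in `|X|]/(U y tau t); apply: le_trans (Ule _ _ _ _ tt) _.
    have h : `|U y tau tau| <= K * `|y|.
      by apply: le_trans (bound y tau); rewrite lerDl.
    have := ler_wpM2l C10 h; have := expR_ge0 (- l * (tau - t)).
    move: (expR _) => z z0 h1; have := ler_wpM2l z0 h1.
    have : 0 <= z * ((1 + K) / d * `|y|) by rewrite mulr_ge0// mulr_ge0.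
    by lra.
  - move=> t tau tt; apply: norm_row_le; first by rewrite mulr_ge0 ?expR_ge0// addr_ge0.
    move=> y; rewrite 2!mulmxA; rewrite -[X in `|X|]/(S' y tau t); apply: le_trans (Sle _ _ _ _ tt) _.
    have h : `|S' y tau tau| <= K * `|y|.
      by apply: le_trans (bound y tau); rewrite lerDr.
    have := ler_wpM2l C10 h; have := expR_ge0 (- l * (t - tau)).
    move: (expR _) => z z0 h1; have := ler_wpM2l z0 h1.
    have : 0 <= z * ((1 + K) / d * `|y|) by rewrite mulr_ge0// mulr_ge0.
    by lra.
move=> t; apply: norm_row_le; first by rewrite addr_ge0.
move=> y; rewrite mulmxA; apply: norm_le_entry.
  by rewrite mulr_ge0// addr_ge0.
move=> i j; rewrite (ord1 i) (ord1 j); apply: le_trans (cbound y t) _.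
by rewrite ler_wpM2r// lerDr.
Qed.

End HyperbolicOrbit.

(** * Bounded solutions of the forced linear equation *)

Section Green.
Context {R : realType} {n : nat}.
Variables (M Phi Psi : R -> 'M[R]_n) (Pu Ps : 'M[R]_n) (K l : R).
Hypothesis F : fundamental M Phi Psi.
Hypothesis D : dichotomy Phi Psi Pu Ps K l.
Implicit Types h : R -> 'rV[R]_n.

Definition pulled_back (P : 'M[R]_n) h (r : R) : 'rV[R]_n := h r *m Psi r *m P.

(** Variation of constants, with the unstable part integrated from [+oo] and the
    stable part from [0]: each part is then moved in the direction of time in
    which it decays. *)
Definition green h (t : R) : 'rV[R]_n :=
  (prim (pulled_back Pu h) t - lim (prim (pulled_back Pu h) @ +oo)) *m Phi t
  + prim (pulled_back Ps h) t *m Phi t.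

Lemma pulled_back_continuous P h : continuous h -> continuous (pulled_back P h).
Proof.
move=> hc; apply: (@continuous_mulmx _ _ _ _ _ _ (fun=> P)); last exact: cst_continuous.
apply: continuous_mulmx => // t.
exact: is_derive_continuous (fund_inv_derive F t).
Qed.

Arguments pulled_back_continuous P {h} _.

Lemma green_cvg h B : continuous h -> (forall t, `|h t| <= B) ->
  cvg (prim (pulled_back Pu h) @ +oo).
Proof.
move=> hc hB; have kc := pulled_back_continuous Pu hc.
apply: (@is_cvg_exp_decay _ _ _ _ (pulled_back Pu h) (n%:R * B * K) l).
- exact: dich_gt0 D.
- by move=> t; exact: is_derive_prim.
move=> t t0; have := dich_u D t0; rewrite (fund0 F) mulmx1 subr0 => dt.
rewrite /pulled_back -mulmxA; apply: le_trans (norm_mulmx _ _) _.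
by rewrite -(mulrA (n%:R * B)) ler_pM// ?mulr_ge0// ler_wpM2l.
Qed.

Lemma green_derive h (t : R) : continuous h ->
  is_derive t 1 (green h) (green h t *m M t + h t *m Psi t *m (Pu + Ps) *m Phi t).
Proof.
move=> hc.
have d1 := is_derive_prim t (pulled_back_continuous Pu hc).
have d2 := is_derive_prim t (pulled_back_continuous Ps hc).
have d1' := @is_deriveB _ _ _ _ (cst (lim (prim (pulled_back Pu h) @ +oo))) t 1 _ _
  d1 (is_derive_cst _ _ _).
rewrite subr0 in d1'.
apply: (is_derive_eq (is_deriveD (is_derive_mulmx d1' (fund_derive F t))
   (is_derive_mulmx d2 (fund_derive F t)))).
pose X := prim (pulled_back Pu h) t - lim (prim (pulled_back Pu h) @ +oo).
pose Y := prim (pulled_back Ps h) t.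
rewrite -[LHS]/((pulled_back Pu h t *m Phi t + X *m (Phi t *m M t)) +
  (pulled_back Ps h t *m Phi t + Y *m (Phi t *m M t))).
rewrite /green -/X -/Y /pulled_back mulmxDr !mulmxDl !mulmxA addrACA.
by rewrite addrC.
Qed.

(** At time [t] the integrands are bounded by [expR (- l * `|r - t|)] times
    [n%:R * K * B], whose integral over the half-line is at most
    [2 * n%:R * K / l * B]. *)
Lemma green_bound h B t : continuous h -> (forall t, `|h t| <= B) -> 0 <= t ->
  `|green h t| <= 2 * n%:R * K / l * B.
Proof.
move=> hc hB t0.
have l0 := dich_gt0 D; have K0 := dich_ge0 D.
have B0 : 0 <= B by exact: le_trans (hB 0).
pose c := n%:R * B * K / l.
have c0 : 0 <= c by rewrite /c divr_ge0 ?mulr_ge0// ltW.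
have cl : c * l = n%:R * B * K by rewrite /c divfK// gt_eqF.
pose g P r := prim (pulled_back P h) r *m Phi t.
have gd P (r : R) : is_derive r 1 (g P) (h r *m (Psi r *m P *m Phi t)).
  have := is_derive_mulmx_cst (Phi t) (is_derive_prim r (pulled_back_continuous P hc)).
  by rewrite /pulled_back !mulmxA.
have gc P : continuous (g P) by move=> r; exact: is_derive_continuous (gd P r).
have gle (X : 'M[R]_n) r e : `|X| <= K * e -> `|h r *m X| <= c * l * e.
  move=> Xe; apply: le_trans (norm_mulmx _ _) _.
  by rewrite cl -(mulrA (n%:R * B)) ler_pM// ?mulr_ge0// ler_wpM2l.
have gs : `|g Ps t| <= c.
  have phid (r : R) := is_derive_expRM (c * expR (- l * t)) l r.
  have := @mean_value_ineq _ _ _ _ _ _ _ 0 t t0 (gc Ps)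
    (fun r => is_derive_continuous (phid r)) (fun r _ => gd Ps r) (fun r _ => phid r).
  rewrite {2}/g prim0 ?mul0mx ?subr0; last exact: pulled_back_continuous.
  move=> hm; apply: le_trans (hm _) _.
    move=> r /andP[_ rt]; have := gle _ r _ (dich_s D (ltW rt)).
    have -> : - l * (t - r) = - l * t + l * r by ring.
    by rewrite expRD; congr (_ <= _); ring.
  rewrite -mulrA -expRD mulNr addNr expR0 mulr1 gerBl.
  by rewrite mulr_ge0 ?expR_ge0// mulr_ge0 ?expR_ge0.
have gu : `|lim (prim (pulled_back Pu h) @ +oo) *m Phi t - g Pu t| <= c.
  have cv : g Pu r @[r --> +oo] --> lim (prim (pulled_back Pu h) @ +oo) *m Phi t.
    have mc : continuous (fun X : 'rV[R]_n => X *m Phi t).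
      apply: (@continuous_mulmx _ _ _ _ _ id (fun=> Phi t)); last exact: cst_continuous.
      by move=> X; exact: cvg_id.
    exact: (cvg_comp _ _ (green_cvg hc hB) (mc _)).
  apply: cvg_dist_le cv _; exists t; split; first exact: num_real.
  move=> r tr.
  have phid (z : R) := is_derive_expRM (- (c * expR (l * t))) (- l) z.
  have := @mean_value_ineq _ _ _ _ _ _ _ t r (ltW tr) (gc Pu)
    (fun r => is_derive_continuous (phid r)) (fun r _ => gd Pu r) (fun r _ => phid r).
  move=> hm; apply: le_trans (hm _) _.
    move=> z /andP[tz _]; have := gle _ z _ (dich_u D (ltW tz)).
    have -> : - l * (z - t) = l * t + - l * z by ring.
    by rewrite expRD; congr (_ <= _); ring.
  have e1 : c * expR (l * t) * expR (- l * t) = c.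
    by rewrite -mulrA -expRD mulNr addrN expR0 mulr1.
  have : 0 <= c * expR (l * t) * expR (- l * r).
    by rewrite mulr_ge0 ?expR_ge0// mulr_ge0 ?expR_ge0.
  by lra.
have -> : 2 * n%:R * K / l * B = c + c by rewrite /c; ring.
rewrite /green mulmxBl; apply: le_trans (ler_normD _ _) (lerD _ _) => //.
by rewrite distrC.
Qed.

Lemma greenB h1 h2 B1 B2 t : continuous h1 -> (forall t, `|h1 t| <= B1) ->
  continuous h2 -> (forall t, `|h2 t| <= B2) ->
  green (h1 - h2) t = green h1 t - green h2 t.
Proof.
move=> h1c h1B h2c h2B.
have pE P : prim (pulled_back P (h1 - h2)) = prim (pulled_back P h1) - prim (pulled_back P h2).
  rewrite -primB; try exact: pulled_back_continuous.
  congr prim; apply/funext => r.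
  by rewrite -[RHS]/(pulled_back P h1 r - pulled_back P h2 r) /pulled_back -!mulmxBl.
rewrite /green !pE (_ : lim _ = lim (prim (pulled_back Pu h1) @ +oo) -
    lim (prim (pulled_back Pu h2) @ +oo)).
  rewrite -[(_ - _ : R -> _) t]/(prim (pulled_back Pu h1) t - prim (pulled_back Pu h2) t).
  rewrite -[(_ - _ : R -> _) t]/(prim (pulled_back Ps h1) t - prim (pulled_back Ps h2) t).
  rewrite -!mulmxDl.
  rewrite -!mulmxBl; congr (_ *m _); rewrite !opprD !opprK !addrA;
    rewrite [RHS](ACl (1*4*2*5*3*6)); done.
apply: (cvg_lim (@norm_hausdorff _ _)); apply: cvgB; [exact: green_cvg h1c h1B|exact: green_cvg h2c h2B].
Qed.

(** At time [0] only the integral of the unstable part over the future remains,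
    and it factors through [Pu]. *)
Lemma green0_mul h B (k : nat) (N : 'M[R]_(n, k)) :
  continuous h -> (forall t, `|h t| <= B) -> Pu *m N = 0 -> green h 0 *m N = 0.
Proof.
move=> hc hB PuN.
have c1 := pulled_back_continuous Pu hc.
rewrite /green !prim0//; last exact: pulled_back_continuous.
rewrite sub0r mul0mx addr0 (fund0 F) mulmx1 mulNmx.
suff -> : lim (prim (pulled_back Pu h) @ +oo) *m N = 0 by rewrite oppr0.
have mc : continuous (fun X : 'rV[R]_n => X *m N).
  apply: (@continuous_mulmx _ _ _ _ _ id (fun=> N)); last exact: cst_continuous.
  by move=> X; exact: cvg_id.
have cv : prim (pulled_back Pu h) r *m N @[r --> +oo] --> lim (prim (pulled_back Pu h) @ +oo) *m N.
  exact: (cvg_comp _ _ (green_cvg hc hB) (mc _)).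
rewrite -prim_mulmx// in cv.
have zE : (fun t => pulled_back Pu h t *m N) = (fun=> 0).
  by apply/funext => r; rewrite /pulled_back -mulmxA PuN mulmx0.
apply/eqP; rewrite -normr_le0 -[X in `|X|]subr0; apply: cvg_dist_le cv _.
apply: nearW => r; rewrite subr0 prim_mulmx//.
have -> : prim (pulled_back Pu h) r *m N = 0.
  apply: (@eq_derive_eq _ _ _ (fun r => prim (pulled_back Pu h) r *m N) (fun=> 0) (fun=> 0) 0 r).
  - by move=> z; apply: (is_derive_eq (is_derive_mulmx_cst N (is_derive_prim z c1))); rewrite (congr1 (@^~ z) zE).
  - by rewrite prim0// mul0mx.
by rewrite normr0.
Qed.

End Green.

(** * The adjoint shadowing direction: existence and uniqueness *)

Section TimeAverage.
Context {R : realType}.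

Lemma time_average_FTC (g g1 G : R -> R) (T : R) : 0 < T ->
  continuous g -> continuous G -> (forall t : R, 0 < t -> is_derive t 1 G (g t)) ->
  (forall t, 0 <= t -> g1 t = g t) ->
  time_average g1 T = T^-1 * (G T - G 0).
Proof.
move=> T0 gc Gc Gd g1g; rewrite /time_average; congr (_ * _).
transitivity (Rintegral (@lebesgue_measure R) `[0, T] g).
  by apply: eq_Rintegral => t; rewrite inE/= in_itv/= => /andP[t0 _]; rewrite g1g.
rewrite /Rintegral (@continuous_FTC2 _ g G 0 T T0)//.
- exact: continuous_subspaceT.
- split.
  + by move=> t; rewrite in_itv/= => /andP[t0 _]; apply: ex_derive; exact: Gd.
  + by apply: cvg_at_right_filter; exact: Gc.
  + by apply: cvg_at_left_filter; exact: Gc.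
- move=> t; rewrite in_itv/= => /andP[t0 _].
  by rewrite derive1E; apply: derive_val; exact: Gd.
Qed.

End TimeAverage.

Section ScalarMatrix.
Context {R : realType}.

Lemma is_derive_scalar_mx (g : R -> R) (t dg : R) :
  is_derive t 1 g dg -> is_derive t 1 (fun r => (g r)%:M : 'M[R]_1) dg%:M.
Proof.
move=> gd; apply/is_derive_mxP => i j; rewrite (ord1 i) (ord1 j).
rewrite mxE eqxx mulr1n.
by under eq_fun do rewrite mxE eqxx mulr1n.
Qed.

Lemma trmx11 (B : 'M[R]_1) : B^T = B.
Proof. by apply/matrixP => i j; rewrite mxE (ord1 i) (ord1 j). Qed.

(** The adjoint equation [v' = - v *m M^T], for the pairing with solutions of
    [w' = w *m M] to stay constant. *)
Lemma fundamental_adjoint n (M Phi Psi : R -> 'M[R]_n) : fundamental M Phi Psi ->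
  fundamental (fun t => - (M t)^T) (fun t => (Psi t)^T) (fun t => (Phi t)^T).
Proof.
move=> F; split.
- by rewrite (fundV0 F) trmx1.
- move=> t; apply: (is_derive_eq (is_derive_trmx (fund_inv_derive F t))).
  by rewrite linearN/= trmx_mul mulmxN.
- move=> t; apply: (is_derive_eq (is_derive_trmx (fund_derive F t))).
  by rewrite trmx_mul mulNmx opprK.
- by move=> t; rewrite -trmx_mul (fundK F) trmx1.
Qed.

End ScalarMatrix.

Section Adjoint.
Context {R : realType} {m : nat}.
Variables (f : 'rV[R]_m * R -> 'rV[R]_m) (J : 'rV[R]_m * R -> R)
  (s : R) (A : set 'rV[R]_m).
Hypothesis f_smooth : smooth f.
Hypothesis J_smooth : smooth J.
Hypothesis A_compact : compact A.
Variable x : R -> 'rV[R]_m.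
Hypothesis x_orbit : full_orbit f s x.
Hypothesis x_A : forall t, A (x t).
Let M t := f_u f (x t) s.
Variables (Phi Psi : R -> 'M[R]_m) (Pu Ps : 'M[R]_m) (q : 'cV[R]_m) (K l : R).
Hypothesis F : fundamental M Phi Psi.
Hypothesis S : splitting Pu Ps q (f (x 0, s)).
Hypothesis D : dichotomy Phi Psi Pu Ps K l.
Hypothesis qK : forall t, `|Psi t *m q| <= K.

Lemma J_derive_along (t : R) :
  is_derive t 1 (fun r => J (x r, s)) (dot (f (x t, s)) (J_u J (x t) s)).
Proof.
rewrite dot_J_u//; apply: is_derive_along; last exact: x_orbit.
by move=> p; exact: smooth_differentiable.
Qed.

Lemma J_bounds : exists2 L : R, 0 <= L &
  (forall t, `|J (x t, s)| <= L) /\ (forall t, `|J_u J (x t) s| <= L).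
Proof.
have [r r0 rA] := compact_norm_bound A_compact (fun a => @cvg_id _ (nbhs a)).
have [L [L0 Lb0 Lb _ _]] := smooth_C2_bound_real (Num.max r `|s|) J_smooth.
have xr t : `|(x t, s)| <= Num.max r `|s|.
  by rewrite norm_pair ge_max !le_max rA ?lexx ?orbT.
exists L => //; split=> t; first exact: Lb0.
apply: norm_le_entry => // i j; rewrite mxE derive_state.
apply: le_trans (Lb _ _ (xr t)) _; rewrite norm_pair_l ler_piMr//.
exact: norm_delta_mx.
Qed.

(** The pairing of [v] with the field satisfies [<v, f>' = - J'], so that it
    must be [c - J] for a constant [c]; this prescribes the neutral component,
    [(c - J) *: q^T] carried to time [t].  The other two components come from the
    bounded solution of the adjoint equation forced by [- J_u]: the component
    paired with stable tangent vectors is integrated from [+oo], the one paired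
    with unstable tangent vectors from [0], where it vanishes. *)
Lemma adjoint_exists (c : R) : exists v : R -> 'rV[R]_m,
  [/\ forall t : R, is_derive t 1 v (- (v t *m (M t)^T) - J_u J (x t) s),
      v 0 *m Pu^T = 0,
      exists B, forall t, 0 <= t -> `|v t| <= B &
      forall t, dot (v t) (f (x t, s)) = c - J (x t, s)].
Proof.
have xc : continuous x := orbit_continuous x_orbit.
have [L L0 [JL JuL]] := J_bounds.
have Fa := fundamental_adjoint F.
have Da := dichotomy_adjoint D.
pose h t := - J_u J (x t) s.
have hc : continuous h by move=> t; apply: cvgN; exact: J_u_continuous.
have hL t : `|h t| <= L by rewrite normrN.
pose gr := green (fun t => (Psi t)^T) (fun t => (Phi t)^T) Ps^T Pu^T h.
pose k t : 'M[R]_1 := (c - J (x t, s))%:M.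
pose v t := gr t + k t *m (q^T *m (Psi t)^T).
have vd (t : R) : is_derive t 1 v (- (v t *m (M t)^T) - J_u J (x t) s).
  have kd : is_derive t 1 k (- dot (f (x t, s)) (J_u J (x t) s))%:M.
    apply: is_derive_scalar_mx; rewrite -sub0r.
    apply: is_deriveB; exact: J_derive_along.
  have qd := is_derive_mulmx (is_derive_cst q^T t 1) (fund_derive Fa t).
  rewrite mul0mx add0r in qd.
  have gd := green_derive Ps^T Pu^T Fa t hc.
  have kqd := is_derive_mulmx kd qd.
  have vd : is_derive t 1 v _ := is_deriveD gd kqd.
  apply: (is_derive_eq vd).
  have JE : J_u J (x t) s = J_u J (x t) s *m (Phi t)^T *m (Ps^T + Pu^T) *m (Psi t)^T
      + (dot (f (x t, s)) (J_u J (x t) s))%:M *m (q^T *m (Psi t)^T).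
    rewrite dot_mulmx -mx11_scalar.
    have -> : f (x t, s) *m (J_u J (x t) s)^T = J_u J (x t) s *m (Phi t)^T *m (f (x 0, s))^T.
      by rewrite -mulmxA -trmx_mul (f_along_orbit f_smooth x_orbit t F)
        -[LHS]trmx11 trmx_mul trmxK.
    rewrite -!mulmxA -!mulmxDr mulmxA (mulmxA _^T q^T) -mulmxDl -[Ps^T + _]linearD -trmx_mul -linearD/=.
    by rewrite [Ps + Pu]addrC (split_sum S) trmx1 mul1mx -mulmxA -trmx_mul (fundKV t F) trmx1 mulmx1.
  rewrite [X in _ = _ - X]JE -[v t]/(gr t + k t *m (q^T *m (Psi t)^T)).
  rewrite -[green _ _ _ _ h t]/(gr t) -[cst q^T t]/(q^T) -[h t]/(- J_u J (x t) s).
  move: (gr t) => grt; rewrite [(- dot _ _)%:M]raddfN/= !(mulmxN, mulNmx, mulmxDl) !opprD !mulmxA !addrA.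
  by rewrite [RHS](ACl (1*3*4*2)).
have v0E N : v 0 *m (N : 'M[R]_(m, _)) = gr 0 *m N + k 0 *m (q^T *m N).
  by rewrite /v (fundV0 F) trmx1 mulmx1 mulmxDl mulmxA.
have gr0 N : Ps^T *m (N : 'M[R]_(m, _)) = 0 -> gr 0 *m N = 0.
  move=> PN; rewrite /gr; exact: (green0_mul Fa Da hc hL PN).
have fv : forall t, dot (v t) (f (x t, s)) = c - J (x t, s).
  move=> t; rewrite dot_mulmx.
  have Gd (r : R) : is_derive r 1 (fun r => v r *m (f (x r, s))^T + (J (x r, s))%:M) 0.
    have d1 := is_derive_mulmx (vd r) (is_derive_trmx (f_derive_along f_smooth x_orbit r)).
    apply: (is_derive_eq (is_deriveD d1 (is_derive_scalar_mx (J_derive_along r)))).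
    rewrite trmx_mul mulmxBl mulNmx mulmxA [- _ - _ + _]addrAC addNr add0r.
    by rewrite dot_mulmx -mx11_scalar -[X in _ + X]trmx11 trmx_mul trmxK addNr.
  have := @eq_derive_eq _ _ _ _ (fun=> c%:M) _ 0 t Gd (fun=> is_derive_cst _ _ _).
  rewrite v0E gr0; last by rewrite -trmx_mul (split_fs S) trmx0.
  rewrite -trmx_mul (split_fq S) trmx1 mulmx1 add0r /k -raddfD/= subrK => /(_ erefl).
  move=> /(congr1 (fun B : 'M[R]_1 => B 0 0)); rewrite [LHS]mxE [X in _ + X]mxE [RHS]mxE eqxx !mulr1n => <-.
  by rewrite addrK.
exists v; split=> //.
  rewrite v0E gr0; last by rewrite -trmx_mul (split_us S) trmx0.
  by rewrite -trmx_mul (split_uq S) trmx0 mulmx0 addr0.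
exists (2 * m%:R * K / l * L + (`|c| + L) * K) => t t0.
apply: le_trans (ler_normD _ _) (lerD _ _); first exact: green_bound Fa Da _ _ _ hc hL t0.
apply: le_trans (norm_mulmx _ _) _; rewrite mul1r ler_pM//.
  apply: norm_le_entry; first by rewrite addr_ge0.
  move=> i j; rewrite (ord1 i) (ord1 j) mxE eqxx mulr1n.
  by apply: le_trans (ler_normB _ _) _; rewrite lerD2l.
by rewrite -trmx_mul norm_trmx.
Qed.

(** The difference [d] of two solutions satisfies the homogeneous adjoint
    equation, so its pairing with tangent solutions is constant.  At time [0] it
    annihilates unstable vectors by the initial condition, stable vectors because
    [d] is bounded and they decay, and the field because the time average of the
    constant [<d, f>] is [0]. *)
Lemma adjoint_unique (v w u : R -> 'rV[R]_m) (c : R) (Vp Vm : 'rV[R]_m -> 'M[R]_m) :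
  Pu = unstable_proj f Vp Vm (x 0) s ->
  (forall t, 0 <= t -> u t = x t) ->
  (forall t : R, is_derive t 1 v (- (v t *m (M t)^T) - J_u J (x t) s)) ->
  (forall t, dot (v t) (f (x t, s)) = c - J (x t, s)) ->
  adjoint_shadowing f J s Vp Vm u v -> adjoint_shadowing f J s Vp Vm u w ->
  forall t, 0 <= t -> w t = v t.
Proof.
move=> PuE ux vd vf [_ v0 [Bv vB] vn] [we w0 [Bw wB] wn].
have u0 : u 0 = x 0 by apply: ux.
rewrite /adjoint_unstable_proj u0 -PuE in v0 w0.
have [dw dwP] : exists dw : R -> 'rV[R]_m, forall t, 0 <= t ->
    is_derive_ge0 w t (dw t) /\ dw t + w t *m (M t)^T = - J_u J (x t) s.
  have ex (t : R) : exists z : 'rV[R]_m, 0 <= t ->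
      is_derive_ge0 w t z /\ z + w t *m (M t)^T = - J_u J (x t) s.
    have [t0|t0] := leP 0 t; last by exists 0.
    by have [z zd zE] := we _ t0; exists z => _; rewrite /M -ux.
  by have [dw dwP] := choice ex; exists dw.
have [wc wd] := ge0_extension (fun t t0 => (dwP t t0).1).
set W := fun t : R => w (Num.max t 0) in wc wd.
have WE t : 0 <= t -> W t = w t by move=> t0; rewrite /W (max_idPl t0).
have vc : continuous v by move=> t; exact: is_derive_continuous (vd t).
pose d t := W t - v t.
have dc : continuous d by move=> t; apply: continuousB; [exact: wc|exact: vc].
have dd (t : R) : 0 < t -> is_derive t 1 d (- (d t *m (M t)^T)).
  move=> t0; have dE : is_derive t 1 d _ := is_deriveB (wd _ t0) (vd t).
  apply: (is_derive_eq dE); have [_ e] := dwP t (ltW t0).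
  have -> : dw t = - J_u J (x t) s - w t *m (M t)^T by rewrite -e addrK.
  rewrite /d (WE _ (ltW t0)) mulmxBl !opprD !opprK.
  by rewrite addrA [LHS](ACl (2*3*(1*4)))/= addNr addr0.
(* Pairing with all solutions of the tangent equation at once. *)
have dPhi t : 0 <= t -> d t *m (Phi t)^T = d 0.
  move=> t0; rewrite -[RHS]mulmx1 -trmx1 -(fund0 F).
  apply: (@derive0_cst _ _ _ (fun t => d t *m (Phi t)^T)) => //.
    apply: continuous_mulmx => //; apply: continuous_trmx => r.
    exact: is_derive_continuous (fund_derive F r).
  move=> r /andP[r0 _].
  apply: (is_derive_eq (is_derive_mulmx (dd _ r0) (is_derive_trmx (fund_derive F r)))).
  by rewrite trmx_mul mulNmx mulmxA addNr.
have du : d 0 *m Pu^T = 0 by rewrite /d WE// mulmxBl v0 w0 subrr.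
have dB t : 0 <= t -> `|d t| <= Bw + Bv.
  move=> t0; rewrite /d WE//; apply: le_trans (ler_normB _ _) (lerD _ _).
    exact: le_trans (norm_le_enorm _) (wB _ t0).
  exact: le_trans (norm_le_enorm _) (vB _ t0).
have ds : d 0 *m Ps^T = 0.
  apply/eqP; rewrite -normr_le0; apply/ler_addgt0Pr => e e0; rewrite add0r.
  have [T T0 Te] := @expR_decay _ (m%:R * (Bw + Bv) * K) l e (dich_gt0 D) e0.
  apply: le_trans Te; rewrite -(dPhi _ T0) -mulmxA -trmx_mul.
  apply: le_trans (norm_mulmx _ _) _; rewrite norm_trmx -(mulrA (_ * _)).
  have B0 : 0 <= Bw + Bv by exact: le_trans (dB _ T0).
  rewrite ler_pM ?mulr_ge0// ?ler_wpM2l// ?dB//.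
  by have := dich_s D T0; rewrite (fundV0 F) mul1mx subr0.
have xc : continuous x := orbit_continuous x_orbit.
have Jc : continuous (fun t => J (x t, s)).
  by apply: continuous_along => //; exact: smooth_continuous.
have dn : d 0 *m (f (x 0, s))^T = 0.
  pose z := (d 0 *m (f (x 0, s))^T) 0 0.
  have wf t : 0 <= t -> dot (w t) (f (x t, s)) = c - J (x t, s) + z.
    move=> t0; rewrite -vf !dot_mulmx.
    have -> : z = (d t *m (f (x t, s))^T) 0 0.
      by rewrite /z -(dPhi _ t0) -mulmxA -trmx_mul (f_along_orbit f_smooth x_orbit t F).
    by rewrite /d WE// mulmxBl [X in _ + X]mxE [X in _ + (_ + X)]mxE subrKC.
  have gc : continuous (fun t => c - J (x t, s)).
    by move=> t; apply: continuousB; [exact: cst_continuous|exact: Jc].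
  have [G [G0 Gd]] := antiderivative_exists gc.
  have Gc : continuous G by move=> t; exact: is_derive_continuous (Gd t).
  have avv : (fun T => T^-1 * G T) @ +oo --> (0 : R).
    apply: cvg_trans vn; apply: near_eq_cvg; near=> T.
    have T0 : 0 < T by [].
    have gE t : 0 <= t -> dot (v t) (f (u t, s)) = c - J (x t, s) by move=> t0; rewrite ux.
    by rewrite (time_average_FTC T0 gc Gc (fun t _ => Gd t) gE) G0 subr0.
  have avw : (fun T => T^-1 * G T + z) @ +oo --> (0 : R).
    apply: cvg_trans wn; apply: near_eq_cvg; near=> T.
    have T0 : 0 < T by [].
    have Gzd (t : R) : is_derive t 1 (G + (fun t => t * z)) (c - J (x t, s) + z).
      apply: is_deriveD; first exact: Gd.
      have h : is_derive t 1 (fun r : R => r * z) _ :=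
        @is_deriveM _ _ id (cst z) t 1 _ _ (is_derive_id t 1) (is_derive_cst z t 1).
      by apply: (is_derive_eq h); rewrite scaler0 add0r [_ *: 1]mulr1.
    have Gzc : continuous (G + (fun t => t * z)).
      by move=> t; exact: is_derive_continuous (Gzd t).
    have gzc : continuous (fun t => c - J (x t, s) + z).
      by move=> t; apply: cvgD; [exact: gc|exact: cvg_cst].
    have gE t : 0 <= t -> dot (w t) (f (u t, s)) = c - J (x t, s) + z.
      by move=> t0; rewrite ux// wf.
    rewrite (time_average_FTC T0 gzc Gzc (fun t _ => Gzd t) gE).
    rewrite -[(_ + _ : R -> R) T]/(G T + T * z) -[(_ + _ : R -> R) 0]/(G 0 + 0 * z).
    by rewrite G0 mul0r addr0 subr0 mulrDr mulrA mulVf ?mul1r// gt_eqF.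
  have avw' : (fun T => T^-1 * G T + z) @ +oo --> 0 + z.
    by apply: cvgD avv (cvg_cst _).
  have z0 : 0 + z = 0 by apply: cvg_unique avw' avw => //; exact: norm_hausdorff.
  apply/matrixP => i j; rewrite (ord1 i) (ord1 j) -[LHS]/z mxE.
  by rewrite -z0 add0r.
have d0 : d 0 = 0.
  rewrite -[LHS]mulmx1 -trmx1 -(split_sum S) !linearD/= trmx_mul.
  by rewrite du ds mulmxA dn mul0mx !addr0.
move=> t t0; apply/eqP; rewrite -subr_eq0 -(WE _ t0) -[_ - _]/(d t).
rewrite -[d t]mulmx1 -trmx1 -(fundKV t F) trmx_mul mulmxA.
by rewrite (dPhi _ t0) d0 mul0mx.
Unshelve. all: by end_near. Qed.

End Adjoint.

(** * Shadowing of an orbit by orbits of the perturbed field *)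

Section Shadowing.
Context {R : realType} {m : nat}.
Variables (f : 'rV[R]_m * R -> 'rV[R]_m) (s : R) (A : set 'rV[R]_m).
Hypothesis f_smooth : smooth f.
Hypothesis A_compact : compact A.
Variable x : R -> 'rV[R]_m.
Hypothesis x_orbit : full_orbit f s x.
Hypothesis x_A : forall t, A (x t).
Let M t := f_u f (x t) s.
Variables (Phi Psi : R -> 'M[R]_m) (Pu Ps : 'M[R]_m) (q : 'cV[R]_m) (K l : R).
Hypothesis F : fundamental M Phi Psi.
Hypothesis S : splitting Pu Ps q (f (x 0, s)).
Hypothesis D : dichotomy Phi Psi Pu Ps K l.
Hypothesis qK : forall t, `|Psi t *m q| <= K.

(** A neutral forcing would make the displacement drift along the orbit without
    bound.  Changing the speed by this amount cancels it. *)
Definition speedup (h : R -> 'rV[R]_m) (t : R) : R := - (h t *m Psi t *m q) 0 0.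

Lemma speedup_bound h B t : `|h t| <= B -> `|speedup h t| <= m%:R * K * B.
Proof.
move=> hB; rewrite /speedup normrN -mulmxA; apply: le_trans (entry_le_norm _ _ _) _.
apply: le_trans (norm_mulmx _ _) _; rewrite -!mulrA ler_wpM2l// mulrC.
by rewrite ler_pM.
Qed.

Lemma speedupB h1 h2 t : speedup (h1 - h2) t = speedup h1 t - speedup h2 t.
Proof.
rewrite /speedup -[(h1 - h2) t]/(h1 t - h2 t) !mulmxBl !mxE opprB opprK addrC.
by [].
Qed.

Lemma speedup_continuous h : continuous h -> continuous (speedup h).
Proof.
move=> hc t; apply: cvgN; move: t; apply: continuous_entry.
apply: (@continuous_mulmx _ _ _ _ _ _ (fun=> q)); last exact: cst_continuous.
apply: continuous_mulmx => // t.
exact: is_derive_continuous (fund_inv_derive F t).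
Qed.

Lemma defect_continuous d (w : R -> 'rV[R]_m) (e : R -> R) :
  continuous w -> continuous e ->
  continuous (fun t => defect f (x t, s) d (w t) (e t)).
Proof.
move=> wc ec; have xc : continuous x := orbit_continuous x_orbit.
have fc : continuous f by exact: smooth_continuous.
have fxc : continuous (fun t => f (x t, s)) by exact: continuous_along.
rewrite (_ : (fun t => _) = (fun t => (1 + e t) *: f (x t + w t, s + d) - f (x t, s)
    - w t *m M t - e t *: f (x t, s))); last first.
  by apply/funext => t; rewrite /defect -mulmx_f_u.
move=> t; apply: cvgB; last by apply: cvgZ; [exact: ec|exact: fxc].
apply: cvgB; last by apply: continuous_mulmx => //; exact: f_u_continuous.
apply: cvgB; last exact: fxc.
apply: cvgZ; first by apply: cvgD; [exact: cvg_cst|exact: ec].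
apply: (@continuous_along _ _ _ _ f (fun t => x t + w t) (s + d)) => // r.
by apply: cvgD; [exact: xc|exact: wc].
Qed.

Lemma green_continuous h : continuous h -> continuous (green Phi Psi Pu Ps h).
Proof. by move=> hc t; exact: is_derive_continuous (green_derive Pu Ps F t hc). Qed.

Lemma max0_continuous : continuous (fun t : R => Num.max t 0).
Proof.
move=> t; apply: (@continuous_max _ _ id (cst 0)); first exact: cvg_id.
exact: cst_continuous.
Qed.

(** The unknown of the fixed point equation is the forcing [h].  It determines
    the displacement [w = green h] and the change of speed [e = speedup h], which
    solve the linearised equation forced by [h] and are bounded by [h]; the
    displaced curve is an orbit of the perturbed field, run at speed [1 + e],
    when [h] is the defect of [(w, e)].  Since the defect of [(0, 0)] is of order
    [d], and the defect is Lipschitz with a constant of order [d] on a ball of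
    radius of order [d], this equation is solved in that ball.  Only times
    [t >= 0] matter, so the defect is frozen for negative times. *)
Lemma shadowing : exists d0 C : R, [/\ 0 < d0, 0 <= C &
  forall d, `|d| <= d0 -> exists (w h : R -> 'rV[R]_m) (e : R -> R),
  [/\ continuous h /\ continuous e,
      forall t : R, is_derive t 1 w (w t *m M t + e t *: f (x t, s) + h t),
      forall t, 0 <= t -> h t = defect f (x t, s) d (w t) (e t) &
      forall t, 0 <= t -> `|w t| <= C * `|d| /\ `|e t| <= C * `|d| ]].
Proof.
have [rA rA0 AP] := compact_norm_bound A_compact (fun a => @cvg_id _ (nbhs a)).
pose r := Num.max rA `|s| + 1.
have [L fL] := smooth_C2_bound_mx r f_smooth.
have L0 : 0 <= L by have [] := fL.
have l0 := dich_gt0 D; have K0 := dich_ge0 D.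
pose K1 := 2 * m%:R * K / l.
have K10 : 0 <= K1 by rewrite /K1 divr_ge0 ?mulr_ge0// ltW.
pose kappa := K1 + m%:R * K.
have mK0 : 0 <= m%:R * K by rewrite mulr_ge0.
have kappa0 : 0 <= kappa by rewrite addr_ge0.
have Lk0 : 0 <= L * kappa by rewrite mulr_ge0.
(* C * d bounds d, w and e when h is in the ball of radius 2 * L * d; d0 keeps
   this bound below 1, and 2 * L * kappa times it below 1 / 2. *)
pose C := 1 + 2 * (L * kappa).
have C1 : 1 <= C by rewrite /C; lra.
have C0 : 0 < C by lra.
pose d0 := (C * (1 + 4 * (L * kappa)))^-1.
have d00 : 0 < d0 by rewrite invr_gt0 mulr_gt0//; lra.
exists d0, C; split=> // [|d dd0]; first by lra.
pose c := C * `|d|.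
have c0 : 0 <= c by rewrite mulr_ge0// ltW.
have dc : `|d| <= c by rewrite /c ler_peMl.
have ck : c * (1 + 4 * (L * kappa)) <= 1.
  have k1 : 0 < 1 + 4 * (L * kappa) by lra.
  rewrite -ler_pdivlMr// div1r /c.
  have := ler_wpM2l (ltW C0) dd0.
  by rewrite /d0 invfM mulVKf// gt_eqF.
have cLk : 0 <= c * (L * kappa) by rewrite mulr_ge0.
have c1 : c <= 1 by lra.
have xr t : `|(x t, s)| + c <= r.
  rewrite /r lerD// norm_pair ge_max !le_max lexx orbT andbT.
  by rewrite (AP _ (x_A t)).
have fd p : differentiable f p by exact: smooth_differentiable.
pose rho := 2 * (L * `|d|).
have Ld0 : 0 <= L * `|d| by rewrite mulr_ge0.
have rho0 : 0 <= rho by rewrite mulr_ge0.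
have rhoc : kappa * rho <= c.
  by rewrite /c /C /rho; have := normr_ge0 d; lra.
pose N h t := defect f (x t, s) d (green Phi Psi Pu Ps h t) (speedup h t).
pose T h (t : R) := N h (Num.max t 0).
pose Q : set 'rV[R]_m := [set X | `|X| <= rho].
have Qcl : closed Q.
  apply: (@closed_comp _ _ (fun X : 'rV[R]_m => `|X|) [set z | z <= rho]).
    by move=> X _; exact: norm_continuous.
  exact: closed_le.
have m0 (t : R) : 0 <= Num.max t 0 by rewrite le_max lexx orbT.
have wle h t : continuous h -> (forall t, Q (h t)) -> 0 <= t ->
    `|green Phi Psi Pu Ps h t| <= c.
  move=> hc hQ t0; apply: le_trans (green_bound F D hc hQ t0) _.
  by apply: le_trans rhoc; rewrite ler_wpM2r// lerDl.
have ele h t : (forall t, Q (h t)) -> `|speedup h t| <= c.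
  move=> hQ; apply: le_trans (speedup_bound (hQ t)) _.
  by apply: le_trans rhoc; rewrite ler_wpM2r// lerDr.
have contr (h1 h2 : R -> 'rV[R]_m) (dl : R) :
    continuous h1 /\ (forall t, Q (h1 t)) -> continuous h2 /\ (forall t, Q (h2 t)) ->
    0 <= dl -> (forall t, `|h1 t - h2 t| <= dl * 1) ->
    forall t, `|T h1 t - T h2 t| <= dl / 2 * 1.
  move=> [h1c h1Q] [h2c h2Q] dl0; rewrite !mulr1 => h12 t.
  have hc : continuous (h1 - h2).
    by move=> z; apply: continuousB; [exact: h1c|exact: h2c].
  have := defect_lipschitz fL (fd _) (xr (Num.max t 0)) dc
    (wle _ _ h1c h1Q (m0 t)) (wle _ _ h2c h2Q (m0 t))
    (ele _ (Num.max t 0) h1Q) (ele _ (Num.max t 0) h2Q).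
  rewrite -(greenB F D _ h1c h1Q h2c h2Q) -speedupB => h.
  apply: le_trans h _.
  have g1 := green_bound F D hc h12 (m0 t).
  have g2 := @speedup_bound (h1 - h2) dl (Num.max t 0) (h12 _).
  have Lc0 : 0 <= 2 * L * c by rewrite mulr_ge0// mulr_ge0.
  apply: le_trans (ler_wpM2l Lc0 (lerD g1 g2)) _.
  rewrite -/K1 -mulrDl -/kappa.
  have := ler_wpM2r dl0 ck.
  have : 0 <= c * dl by rewrite mulr_ge0.
  by lra.
have good0 : continuous (fun _ : R => 0 : 'rV[R]_m) /\ forall t : R, Q 0.
  by split=> [|t]; [exact: cst_continuous|rewrite /Q/= normr0].
have T0 t : `|T (fun=> 0) t| <= L * `|d|.
  rewrite /T /N.
  have -> : green Phi Psi Pu Ps (fun=> 0) (Num.max t 0) = 0.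
    apply/eqP; rewrite -normr_le0.
    have := @green_bound _ _ _ _ _ _ _ _ _ F D (fun=> 0) 0 (Num.max t 0) good0.1 _ (m0 t).
    by rewrite mulr0; apply=> ?; rewrite normr0.
  have -> : speedup (fun=> 0) (Num.max t 0) = 0.
    by rewrite /speedup !mul0mx mxE oppr0.
  apply: defect0_le fL _; apply: le_trans (xr (Num.max t 0)); rewrite lerD2l//.
have [||||||||h [hc hQ] Th] := @weighted_fixed_point R 1 m Q (fun=> 1) T (fun=> 0) (L * `|d|).
- exact: Qcl.
- exact: cst_continuous.
- by [].
- by [].
- exact: good0.
- move=> h gh; split.
    move=> t; apply: (@continuous_comp _ _ _ (fun t : R => Num.max t 0) (N h)).
      exact: max0_continuous.
    apply: defect_continuous; first exact: green_continuous gh.1.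
    exact: speedup_continuous gh.1.
  move=> t; rewrite /Q/= -(subrK (T (fun=> 0) t) (T h t)).
  apply: le_trans (ler_normD _ _) _.
  have h0 : forall t, `|h t - 0| <= rho * 1 by move=> z; rewrite subr0 mulr1; exact: gh.2.
  have := contr h (fun=> 0) rho gh good0 rho0 h0 t; have := T0 t.
  by rewrite /rho; lra.
- by move=> h1 h2 dl g1 g2 dl0 h12 t; exact: contr.
- by move=> t; rewrite subr0 mulr1; exact: T0.
exists (green Phi Psi Pu Ps h), h, (speedup h); split.
- by split=> //; exact: speedup_continuous.
- move=> t; apply: (is_derive_eq (green_derive Pu Ps F t hc)).
  rewrite -addrA; congr (_ + _).
  have -> : speedup h t *: f (x t, s) = - (h t *m Psi t *m (q *m f (x 0, s)) *m Phi t).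
    rewrite -(f_along_orbit f_smooth x_orbit t F) /speedup scaleNr; congr (- _).
    by rewrite -mul_scalar_mx -mx11_scalar !mulmxA.
  have hE : h t = h t *m Psi t *m (Pu + Ps) *m Phi t
      + h t *m Psi t *m (q *m f (x 0, s)) *m Phi t.
    rewrite -mulmxDl -mulmxDr (split_sum S) mulmx1 -mulmxA (fundKV t F).
    by rewrite mulmx1.
  by rewrite [X in _ = _ + X]hE [RHS]addrC addrK.
- by move=> t t0; rewrite -Th /T (max_idPl t0).
- by move=> t t0; split; [exact: wle|exact: ele].
Qed.

End Shadowing.

(** * Time averages and a common limit *)

Section Averages.
Context {R : realType}.

Lemma has_time_averageP (g g1 G : R -> R) (l : R) :
  continuous g -> (forall t : R, is_derive t 1 G (g t)) -> G 0 = 0 ->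
  (forall t, 0 <= t -> g1 t = g t) ->
  has_time_average g1 l <-> T^-1 * G T @[T --> +oo] --> l.
Proof.
move=> gc Gd G0 g1g.
have Gc : continuous G by move=> t; exact: is_derive_continuous (Gd t).
have E : \forall T \near +oo, time_average g1 T = T^-1 * G T.
  near=> T; have T0 : 0 < T by [].
  by rewrite (time_average_FTC T0 gc Gc (fun t _ => Gd t) g1g) G0 subr0.
split; apply: cvg_trans; apply: near_eq_cvg => //.
by apply: filterS E => T ->.
Unshelve. all: by end_near. Qed.

(** For large times all values of [a] are within [C * `|d|] of the same number
    [D d]; as [d] is arbitrarily small, [a] is Cauchy, and its limit inherits the
    distance [C * `|d|] to [D d]. *)
Lemma common_limit (D a : R -> R) (d1 C : R) : 0 < d1 -> 0 <= C ->
  (forall d, d != 0 -> `|d| <= d1 -> \forall T \near +oo, `|D d - a T| <= C * `|d|) ->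
  exists L : R, a T @[T --> +oo] --> L /\ D d @[d --> (0 : R)^'] --> L.
Proof.
move=> d10 C0 Da.
have cv : cvg (a @ +oo).
  apply: cauchy_cvg; apply: cauchy_exP => e e0.
  pose d := Num.min d1 (e / (2 * (C + 1))).
  have C1 : 0 < C + 1 by rewrite ltr_wpDl.
  have d0 : 0 < d by rewrite lt_min d10 divr_gt0// mulr_gt0.
  exists (D d); have dd1 : `|d| <= d1 by rewrite gtr0_norm// ge_min lexx.
  apply: filterS (Da d _ dd1); last by rewrite gt_eqF.
  move=> T; rewrite -ball_normE/= => /le_lt_trans; apply.
  rewrite gtr0_norm//.
  have : d * (2 * (C + 1)) <= e.
    by rewrite -ler_pdivlMr ?mulr_gt0// ge_min lexx orbT.
  have : 0 <= C * d by rewrite mulr_ge0// ltW.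
  by lra.
exists (lim (a @ +oo)); split; first exact: cv.
have DL d : d != 0 -> `|d| <= d1 -> `|D d - lim (a @ +oo)| <= C * `|d|.
  move=> d0 dd1; rewrite distrC; apply: cvg_dist_le cv _.
  by apply: filterS (Da d d0 dd1) => T; rewrite distrC.
apply/cvgrPdist_le => e e0; near=> d.
have d0 : d != 0 by near: d; exact: nbhs_dnbhs_neq.
have dd1 : `|d| <= d1.
  by apply: ltW; near: d; apply: (@dnbhs0_lt R R).
have de : `|d| <= e / (C + 1).
  by apply: ltW; near: d; apply: (@dnbhs0_lt R R); rewrite divr_gt0// ltr_wpDl.
rewrite distrC; apply: le_trans (DL d d0 dd1) _.
move: de; rewrite ler_pdivlMr ?ltr_wpDl// mulrDr mulr1 mulrC; apply: le_trans.
by rewrite lerDl.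
Unshelve. all: by end_near. Qed.

End Averages.

(** * Averages along orbits and along shadowing curves *)

Section Sensitivity.
Context {R : realType} {m : nat}.
Variables (f : 'rV[R]_m * R -> 'rV[R]_m) (J : 'rV[R]_m * R -> R)
  (U : set 'rV[R]_m) (Javg : R -> R) (s : R) (A : set 'rV[R]_m).
Hypothesis f_smooth : smooth f.
Hypothesis J_smooth : smooth J.
Hypothesis U_open : open U.
Hypothesis J_avg : is_J_avg f J U Javg.
Hypothesis A_compact : compact A.
Variable x : R -> 'rV[R]_m.
Hypothesis x_orbit : full_orbit f s x.
Hypothesis x_A : forall t, A (x t).
Hypothesis x_U : U (x 0).
Let M t := f_u f (x t) s.

Lemma trajectory_eq_orbit (u : R -> 'rV[R]_m) : trajectory f s u -> u 0 = x 0 ->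
  forall t, 0 <= t -> u t = x t.
Proof.
move=> tu u0 t t0.
have [uc ud] := ge0_extension tu.
have := @rescaled_ode_unique _ _ f f_smooth s t (cst 1) (fun r => u (Num.max r 0)) x t0.
rewrite maxxx (max_idPl t0); apply=> //.
- exact: cst_continuous.
- exact: orbit_continuous x_orbit.
- by move=> r /andP[r0 _]; rewrite scale1r (max_idPl (ltW r0)); exact: ud.
- by move=> r _; rewrite scale1r.
Qed.

Lemma orbit_average (I0 : R -> R) : I0 0 = 0 ->
  (forall t : R, is_derive t 1 I0 (J (x t, s))) ->
  T^-1 * I0 T @[T --> +oo] --> Javg s.
Proof.
move=> I00 I0d; have [X [tX X0 avX]] := J_avg s x_U.
have gc : continuous (fun t => J (x t, s)).
  apply: continuous_along; first exact: smooth_continuous.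
  exact: orbit_continuous x_orbit.
have gE t : 0 <= t -> J (X t, s) = J (x t, s).
  by move=> t0; rewrite (trajectory_eq_orbit tX X0).
exact: (has_time_averageP _ gc I0d I00 gE).1 avX.
Qed.

Lemma clock_drift (e tau : R -> R) (c T : R) : 0 <= T -> tau 0 = 0 ->
  (forall t : R, is_derive t 1 tau (1 + e t)) ->
  (forall t, 0 <= t -> `|e t| <= c) -> `|tau T - T| <= c * T.
Proof.
move=> T0 tau0 taud ec; have Fd (t : R) : is_derive t 1 (tau - id) (e t).
  apply: (is_derive_eq (is_deriveB (taud t) (is_derive_id t 1))).
  by rewrite addrAC subrr add0r.
have ec' t : 0 < t < T -> `|e t| <= c by move=> /andP[t0 _]; apply: ec; exact: ltW.
have := mean_value_cst T0 (fun t => is_derive_continuous (Fd t)) (fun t _ => Fd t) ec'.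
by rewrite -[(tau - id) T]/(tau T - T) -[(tau - id) 0]/(tau 0 - 0) tau0 !subr0.
Qed.

(** The trajectory from [y 0] whose average is known, read along the clock [tau],
    solves the same equation as [y] and therefore is [y]; the time integral along
    [y] becomes the integral of that trajectory up to time [tau T], which grows
    linearly. *)
Lemma rescaled_average (d : R) (y : R -> 'rV[R]_m) (e tau : R -> R) (I : R -> R) :
  U (y 0) -> continuous y -> continuous e ->
  (forall t : R, 0 < t -> is_derive t 1 y ((1 + e t) *: f (y t, s + d))) ->
  (forall t, 0 <= t -> `|e t| <= 1 / 2) ->
  tau 0 = 0 -> (forall t : R, is_derive t 1 tau (1 + e t)) ->
  I 0 = 0 -> (forall t : R, 0 < t -> is_derive t 1 I ((1 + e t) * J (y t, s + d))) ->
  continuous I ->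
  T^-1 * (I T - Javg (s + d) * tau T) @[T --> +oo] --> (0 : R).
Proof.
move=> Uy yc ec yd ele tau0 taud I0 Id Ic.
have [Z [tZ Z0 avZ]] := J_avg (s + d) Uy.
have [Zc Zd] := ge0_extension tZ.
set W := fun t : R => Z (Num.max t 0) in Zc Zd.
have WE t : 0 <= t -> W t = Z t by move=> t0; rewrite /W (max_idPl t0).
have tauc : continuous tau by move=> t; exact: is_derive_continuous (taud t).
have tau_le T : 0 <= T -> T / 2 <= tau T <= 2 * T.
  move=> T0; have := clock_drift T0 tau0 taud (fun t t0 => ele t t0).
  by rewrite ler_norml => /andP[? ?]; apply/andP; split; lra.
have tau_gt0 T : 0 < T -> 0 < tau T.
  by move=> T0; have /andP[] := tau_le _ (ltW T0); lra.
have Wtau T : 0 <= T -> W (tau T) = y T.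
  move=> T0.
  apply: (@rescaled_ode_unique _ _ f f_smooth (s + d) T (fun t => 1 + e t) (W \o tau) y) => //.
  - by move=> t; apply: cvgD; [exact: cvg_cst|exact: ec].
  - by move=> t; apply: continuous_comp; [exact: tauc|exact: Zc].
  - move=> t /andP[t0 _].
    have Wd : is_derive (tau t) 1 W (f (W (tau t), s + d)).
      by rewrite WE ?ltW ?tau_gt0//; exact: Zd (tau_gt0 _ t0).
    exact: is_derive_reparam Wd (taud t).
  - by move=> t /andP[t0 _]; exact: yd.
  - by rewrite /= tau0 WE.
have gc : continuous (fun t => J (W t, s + d)).
  by apply: continuous_along => //; exact: smooth_continuous.
have [G [G0 Gd]] := antiderivative_exists gc.
have Gav : T^-1 * G T @[T --> +oo] --> Javg (s + d).
  have gE t : 0 <= t -> J (Z t, s + d) = J (W t, s + d) by move=> t0; rewrite WE.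
  exact: (has_time_averageP _ gc Gd G0 gE).1 avZ.
have IG T : 0 <= T -> I T = G (tau T).
  move=> T0; have Gtd (t : R) := is_derive1_comp (Gd (tau t)) (taud t).
  pose F := I - (G \o tau).
  have Fc : continuous F.
    by move=> t; apply: continuousB; [exact: Ic|exact: is_derive_continuous (Gtd t)].
  have Fd (t : R) : 0 < t < T -> is_derive t 1 F 0.
    move=> /andP[t0 _]; apply: (is_derive_eq (is_deriveB (Id _ t0) (Gtd t))).
    by rewrite (Wtau _ (ltW t0)) mulrC subrr.
  have F0 (t : R) : 0 < t < T -> `|0 : R| <= 0 by rewrite normr0.
  have := mean_value_cst T0 Fc Fd F0.
  rewrite mul0r normr_le0 -[F T]/(I T - G (tau T)) -[F 0]/(I 0 - G (tau 0)).
  by rewrite tau0 I0 G0 !subr0 subr_eq0 => /eqP.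
apply/cvgrPdist_le => eps eps0.
have : \forall T \near +oo, `|Javg (s + d) - T^-1 * G T| <= eps / 2.
  by move/cvgrPdist_le: Gav; apply; rewrite divr_gt0.
move=> [T1 [T1r T1P]]; near=> T.
have T0 : 0 < T by [].
have tT1 : T1 < tau T.
  have /andP[+ _] := tau_le _ (ltW T0).
  by apply: lt_le_trans; rewrite ltr_pdivlMr//; near: T; apply: nbhs_pinfty_gt; exact: num_real.
have := T1P _ tT1; have tp := tau_gt0 _ T0 => h.
rewrite sub0r normrN (IG _ (ltW T0)) normrM normfV (gtr0_norm T0) ler_pdivrMl//.
have -> : G (tau T) - Javg (s + d) * tau T = - ((Javg (s + d) - (tau T)^-1 * G (tau T)) * tau T).
  by field; rewrite gt_eqF.
rewrite normrN normrM (gtr0_norm tp).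
have := ler_wpM2r (ltW tp) h.
have /andP[_ t2] := tau_le _ (ltW T0).
have : eps * tau T <= eps * (2 * T) by rewrite ler_wpM2l// ltW.
by lra.
Unshelve. all: by end_near. Qed.

End Sensitivity.

(** * The sensitivity estimate *)

Section Dot.
Context {R : realType} {m : nat}.
Implicit Types v w : 'rV[R]_m.

Lemma dotC v w : dot v w = dot w v.
Proof. by apply: eq_bigr => i _; rewrite mulrC. Qed.

Lemma dotBr v w1 w2 : dot v (w1 - w2) = dot v w1 - dot v w2.
Proof. by rewrite /dot -sumrB; apply: eq_bigr => i _; rewrite !mxE mulrBr. Qed.

Lemma dotDr v w1 w2 : dot v (w1 + w2) = dot v w1 + dot v w2.
Proof. by rewrite /dot -big_split; apply: eq_bigr => i _; rewrite !mxE mulrDr. Qed.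

Lemma dotZr c v w : dot v (c *: w) = c * dot v w.
Proof. by rewrite /dot mulr_sumr; apply: eq_bigr => i _; rewrite !mxE mulrCA. Qed.

Lemma dotNr v w : dot v (- w) = - dot v w.
Proof. by rewrite -scaleN1r dotZr mulN1r. Qed.

Lemma dot_adjoint v w (B : 'M[R]_m) : dot w (v *m B^T) = dot v (w *m B).
Proof. by rewrite [RHS]dotC !dot_mulmx trmx_mul trmxK mulmxA. Qed.

Lemma is_derive_dot (v w : R -> 'rV[R]_m) (t : R) dv dw :
  is_derive t 1 v dv -> is_derive t 1 w dw ->
  is_derive t 1 (fun r => dot (v r) (w r)) (dot dv (w t) + dot (v t) dw).
Proof.
move=> vd wd; rewrite (_ : (fun r => _) = (fun r => (v r *m (w r)^T) 0 0)).
  apply: (is_derive_eq (is_derive_entry 0 0 (is_derive_mulmx vd (is_derive_trmx wd)))).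
  by rewrite mxE !dot_mulmx.
by apply/funext => r; rewrite dot_mulmx.
Qed.

Lemma continuous_dot (v w : R -> 'rV[R]_m) : continuous v -> continuous w ->
  continuous (fun r => dot (v r) (w r)).
Proof.
move=> vc wc; rewrite (_ : (fun r => _) = (fun r => (v r *m (w r)^T) 0 0)).
  apply: continuous_entry; apply: continuous_mulmx => //; exact: continuous_trmx.
by apply/funext => r; rewrite dot_mulmx.
Qed.

End Dot.

Section SensitivityEstimate.
Context {R : realType} {m : nat}.
Variables (f : 'rV[R]_m * R -> 'rV[R]_m) (J : 'rV[R]_m * R -> R)
  (U : set 'rV[R]_m) (Javg : R -> R) (s : R) (A : set 'rV[R]_m).
Hypothesis f_smooth : smooth f.
Hypothesis J_smooth : smooth J.
Hypothesis U_open : open U.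
Hypothesis J_avg : is_J_avg f J U Javg.
Hypothesis A_compact : compact A.
Variable x : R -> 'rV[R]_m.
Hypothesis x_orbit : full_orbit f s x.
Hypothesis x_A : forall t, A (x t).
Hypothesis x_U : U (x 0).
Let M t := f_u f (x t) s.
Variables (Phi Psi : R -> 'M[R]_m) (Pu Ps : 'M[R]_m) (q : 'cV[R]_m) (K l : R).
Hypothesis F : fundamental M Phi Psi.
Hypothesis S : splitting Pu Ps q (f (x 0, s)).
Hypothesis D : dichotomy Phi Psi Pu Ps K l.
Hypothesis qK : forall t, `|Psi t *m q| <= K.
Variables (v : R -> 'rV[R]_m) (B : R).
Hypothesis vd : forall t : R, is_derive t 1 v (- (v t *m (M t)^T) - J_u J (x t) s).
Hypothesis vB : forall t, 0 <= t -> `|v t| <= B.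
Hypothesis vf : forall t, dot (v t) (f (x t, s)) = Javg s - J (x t, s).

Definition sensitivity_density (t : R) : R :=
  dot (v t) (f_s f (x t) s) + J_s J (x t) s.

Lemma sensitivity_density_continuous : continuous sensitivity_density.
Proof.
have xc : continuous x := orbit_continuous x_orbit.
rewrite (_ : sensitivity_density = fun t =>
    dot (v t) ('D_(0, 1) f (x t, s)) + 'D_(0, 1) J (x t, s)); last first.
  by apply/funext => t; rewrite /sensitivity_density f_sE J_sE.
move=> t; apply: cvgD; last first.
  apply: (@continuous_along _ _ _ _ (fun p => 'D_(0, 1) J p)) => //.
  exact: smooth_derive_continuous.
apply: continuous_dot; first by move=> r; exact: is_derive_continuous (vd r).
apply: (@continuous_along _ _ _ _ (fun p => 'D_(0, 1) f p)) => //.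
exact: smooth_derive_continuous.
Qed.

(** The two terms containing the Jacobian cancel by adjointness, and the value of
    [<v, f>] turns the change of speed into [e * (Javg s - J)]: these are exactly
    the terms, up to sign, by which the displacement and the change of speed
    alter the integral of [J]. *)
Lemma pairing_derive (w : R -> 'rV[R]_m) (t e : R) (h : 'rV[R]_m) :
  is_derive t 1 w (w t *m M t + e *: f (x t, s) + h) ->
  is_derive t 1 (fun r => dot (v r) (w r))
    (- 'D_(w t, 0) J (x t, s) + e * (Javg s - J (x t, s)) + dot (v t) h).
Proof.
move=> wd; apply: (is_derive_eq (is_derive_dot (vd t) wd)).
rewrite !dotDr dotZr vf -dot_J_u// dotC dotBr.
rewrite dotNr dot_adjoint.
by lra.
Qed.

(** Let [y = x + w] be the shadowing curve for the parameter [s + d], run at speed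
    [1 + e].  The integral of [J (y, s + d) * (1 + e) - J (x, s)] contains the
    first-order terms [<w, J_u> + e * J], and adding the bounded quantity
    [<v, w>] replaces them by [<v, h> + e * Javg s], where [h] is [d *: f_s] up to
    [O(d^2)].  Hence [H] below has derivative [O(d^2)].  Since the integrals of
    [J] along [x] and along [y] are asymptotic to [Javg s * T] and
    [Javg (s + d) * tau T], this leaves
    [(Javg (s + d) - Javg s) * tau T = d * a T + O(d^2) * T], and [tau T] may be
    replaced by [T] because [tau T - T = O(d) * T]. *)
Lemma sensitivity_estimate (a : R -> R) : a 0 = 0 ->
  (forall t : R, is_derive t 1 a (sensitivity_density t)) ->
  exists d1 C : R, [/\ 0 < d1, 0 <= C & forall d, d != 0 -> `|d| <= d1 ->
    \forall T \near +oo,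
      `|(Javg (s + d) - Javg s) / d - T^-1 * a T| <= C * `|d| ].
Proof.
move=> a0 ad.
have xc : continuous x := orbit_continuous x_orbit.
have vc : continuous v by move=> r; exact: is_derive_continuous (vd r).
have ac : continuous a by move=> r; exact: is_derive_continuous (ad r).
have [d0 [C1 [d00 C10 shadow]]] := shadowing f_smooth A_compact x_orbit x_A F S D qK.
have /nbhs_ballP[eps /= eps0 epsU] : nbhs (x 0) U by apply: open_nbhs_nbhs.
have [rA rA0 AP] := compact_norm_bound A_compact (fun a => @cvg_id _ (nbhs a)).
pose r := Num.max rA `|s| + 1.
have [Lf fL] := smooth_C2_bound_mx r f_smooth.
have [LJ JL] := smooth_C2_bound_real r J_smooth.
have Lf0 : 0 <= Lf by have [] := fL.
have LJ0 : 0 <= LJ by have [] := JL.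
have B0 : 0 <= B by exact: le_trans (vB (lexx 0)).
pose C2 := C1 + 1.
have C20 : 0 < C2 by rewrite ltr_wpDl.
have xr t : `|(x t, s)| + 1 <= r.
  rewrite /r lerD2r norm_pair ge_max !le_max lexx orbT andbT.
  by rewrite (AP _ (x_A t)).
pose kap L := 4 * L * C2 * C2 + L.
have kap0 L : 0 <= L -> 0 <= kap L.
  by move=> L0; rewrite addr_ge0// !mulr_ge0// ltW.
pose k1 := kap LJ + m%:R * B * kap Lf.
have k10 : 0 <= k1 by rewrite addr_ge0// ?kap0// mulr_ge0 ?kap0// mulr_ge0.
pose G := m%:R * B * Lf + LJ.
have G0 : 0 <= G by rewrite addr_ge0// mulr_ge0// mulr_ge0.
have gG t : 0 <= t -> `|sensitivity_density t| <= G.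
  move=> t0; have xr1 : `|(x t, s)| <= r by apply: le_trans (xr t); rewrite lerDl.
  have [_ _ fL1 _ _] := fL; have [_ _ JL1 _ _] := JL.
  have := fL1 _ (0, 1) xr1; have := JL1 _ (0, 1) xr1.
  rewrite norm_pair_r normr1 !mulr1 => h1 h2.
  rewrite /sensitivity_density f_sE J_sE; apply: le_trans (ler_normD _ _) (lerD _ h1).
  apply: le_trans (norm_dot _ _) _; rewrite ler_pM ?mulr_ge0//.
  by rewrite ler_wpM2l// vB.
pose k3 := k1 + 3.
pose C3 := 2 * (G + k3) * C2 + k3.
have k30 : 0 <= k3 by rewrite addr_ge0.
have C30 : 0 <= C3.
  by rewrite addr_ge0// mulr_ge0 ?(ltW C20)// mulr_ge0// addr_ge0.
pose d1 := Num.min d0 (Num.min (2 * C2)^-1 (eps / (2 * C2))).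
have d10 : 0 < d1.
  by rewrite !lt_min d00 invr_gt0 divr_gt0// mulr_gt0.
exists d1, C3; split=> // d dN0.
rewrite !le_min => /and3P[dd0 dC2 deps].
have [w [h [e [[hc ec] wd hE we]]]] := shadow d dd0.
have wc : continuous w by move=> t; exact: is_derive_continuous (wd t).
have d_gt0 : 0 < `|d| by rewrite normr_gt0.
pose c := C2 * `|d|.
have c0 : 0 <= c by rewrite mulr_ge0// ltW.
have c12 : c <= 1 / 2.
  have C2N0 : C2 != 0 by rewrite gt_eqF.
  have -> : 1 / 2 = C2 * (2 * C2)^-1 by field.
  by rewrite ler_wpM2l// ltW.
have ceps : c < eps.
  have C2N0 : C2 != 0 by rewrite gt_eqF.
  apply: (@le_lt_trans _ _ (eps / 2)); last by lra.
  have -> : eps / 2 = C2 * (eps / (2 * C2)) by field.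
  by rewrite ler_wpM2l// ltW.
have dc : `|d| <= c by rewrite /c ler_peMl// /C2 lerDr.
have C1c : C1 * `|d| <= c by rewrite /c ler_wpM2r// /C2 lerDl.
have wc' t : 0 <= t -> `|w t| <= c by move=> /we[/le_trans wt _]; exact: wt.
have ec' t : 0 <= t -> `|e t| <= c by move=> /we[_ /le_trans et]; exact: et.
pose y t := x t + w t.
have yc : continuous y by move=> t; apply: cvgD; [exact: xc|exact: wc].
have Uy : U (y 0).
  apply: epsU; rewrite -ball_normE/= /y opprD addrA subrr sub0r normrN.
  exact: le_lt_trans (wc' _ (lexx 0)) ceps.
have fd p : differentiable f p by exact: smooth_differentiable.
have Jd p : differentiable J p by exact: smooth_differentiable.
have yd (t : R) : 0 < t -> is_derive t 1 y ((1 + e t) *: f (y t, s + d)).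
  move=> t0; have yd : is_derive t 1 y _ := is_deriveD (x_orbit t) (wd t).
  apply: (is_derive_eq yd); rewrite (hE _ (ltW t0)) /defect -mulmx_f_u//.
  rewrite -[(x t, s) + (w t, d)]/(y t, s + d) -/(M t) !addrA.
  by rewrite [LHS](ACl (4*(1*5)*(2*6)*(3*7)))/= !subrr !addr0.
have [tau [tau0 taud]] : exists tau : R -> R, tau 0 = 0 /\ forall t : R, is_derive t 1 tau (1 + e t).
  apply: (@antiderivative_exists _ (fun t => 1 + e t)) => t.
  by apply: cvgD; [exact: cvg_cst|exact: ec].
have Iyc : continuous (fun t => (1 + e t) * J (y t, s + d)).
  move=> t; apply: cvgM; first by apply: cvgD; [exact: cvg_cst|exact: ec].
  by apply: continuous_along => //; exact: smooth_continuous.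
have [I [I0 Id]] := antiderivative_exists Iyc.
have Ic : continuous I by move=> t; exact: is_derive_continuous (Id t).
have Jxc : continuous (fun t => J (x t, s)).
  by apply: continuous_along => //; exact: smooth_continuous.
have [Ix [Ix0 Ixd]] := antiderivative_exists Jxc.
have ele t : 0 <= t -> `|e t| <= 1 / 2 by move=> t0; exact: le_trans (ec' _ t0) c12.
have av1 := rescaled_average f_smooth J_smooth J_avg Uy yc ec yd ele tau0 taud I0 (fun t _ => Id t) Ic.
have av0 := orbit_average f_smooth J_smooth J_avg x_orbit x_U Ix0 Ixd.
set j := Javg s; set j' := Javg (s + d) in av1 *.
(* To second order the defects of f and J along the shadowing curve only see the
   change of parameter, as w and e are themselves of order d. *)
have remainder (W : normedModType R) (g : 'rV[R]_m * R -> W) L t :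
    C2_bound g r L -> (forall p, differentiable g p) -> 0 <= t ->
    `|defect g (x t, s) d (w t) (e t) - d *: 'D_(0, 1) g (x t, s)| <= kap L * `|d| ^+ 2.
  move=> gL gd t0.
  have L0 : 0 <= L by have [] := gL.
  have xrc : `|(x t, s)| + c <= r by apply: le_trans (xr t); rewrite lerD2l; lra.
  have z0 : `|0 : 'rV[R]_m| <= c by rewrite normr0.
  have z0' : `|0 : R| <= c by rewrite normr0.
  have h1 := defect_lipschitz gL (gd _) xrc dc (wc' _ t0) z0 (ec' _ t0) z0'.
  have h2 : `|defect g (x t, s) d 0 0 - d *: 'D_(0, 1) g (x t, s)| <= L * `|d| ^+ 2.
    by apply: (defect0_taylor gL) => //; apply: le_trans xrc; rewrite lerD2l.
  rewrite -(subrKA (defect g (x t, s) d 0 0)); apply: le_trans (ler_normD _ _) _.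
  rewrite !subr0 in h1.
  have h3 : 2 * L * c * (`|w t| + `|e t|) <= 2 * L * c * (c + c).
    rewrite ler_wpM2l ?lerD ?wc' ?ec'//.
    by rewrite mulr_ge0// mulr_ge0.
  have -> : kap L * `|d| ^+ 2 = 2 * L * c * (c + c) + L * `|d| ^+ 2.
    by rewrite /kap /c; ring.
  by apply: lerD h2; exact: le_trans h1 h3.
pose vw t := dot (v t) (w t).
have vwB t : 0 <= t -> `|vw t| <= m%:R * B * c.
  move=> t0; apply: le_trans (norm_dot _ _) _.
  by rewrite ler_pM ?mulr_ge0// ?wc'// ler_wpM2l// vB.
pose H t := I t - Ix t - j * (tau t - t) + vw t - d * a t.
have HT T : 0 <= T -> `|H T - H 0| <= k1 * `|d| ^+ 2 * T.
  move=> T0.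
  have Hd (t : R) : is_derive t 1 H
      ((1 + e t) * J (y t, s + d) - J (x t, s) - j * (1 + e t - 1) +
       (- 'D_(w t, 0) J (x t, s) + e t * (j - J (x t, s)) + dot (v t) (h t)) -
       d * sensitivity_density t).
    have D2 := is_deriveZ j (is_deriveB (taud t) (is_derive_id t 1)).
    exact: (is_deriveB (is_deriveD (is_deriveB (is_deriveB (Id t) (Ixd t)) D2)
      (pairing_derive (wd t))) (is_deriveZ d (ad t))).
  apply: mean_value_cst T0 (fun t => is_derive_continuous (Hd t)) (fun t _ => Hd t) _.
  move=> t /andP[/ltW t0 _].
  have -> : (1 + e t) * J (y t, s + d) - J (x t, s) - j * (1 + e t - 1) +
       (- 'D_(w t, 0) J (x t, s) + e t * (j - J (x t, s)) + dot (v t) (h t)) -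
       d * sensitivity_density t =
       (defect J (x t, s) d (w t) (e t) - d *: 'D_(0, 1) J (x t, s))
       + dot (v t) (h t - d *: 'D_(0, 1) f (x t, s)).
    rewrite dotBr dotZr /defect -[(x t, s) + (w t, d)]/(y t, s + d).
    by rewrite /sensitivity_density f_sE J_sE /GRing.scale/=; ring.
  rewrite /k1 mulrDl; apply: le_trans (ler_normD _ _) (lerD _ _).
    exact: remainder.
  apply: le_trans (norm_dot _ _) _; rewrite -(mulrA (m%:R * B)).
  rewrite ler_pM ?mulr_ge0// ?ler_wpM2l ?vB//.
  by rewrite hE//; exact: remainder.
have drift T : 0 <= T -> `|tau T - T| <= c * T.
  by move=> T0; exact: clock_drift T0 tau0 taud ec'.
have aG T : 0 <= T -> `|a T| <= G * T.
  move=> T0; rewrite -[a T]subr0 -a0; apply: mean_value_cst T0 ac (fun t _ => ad t) _.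
  by move=> t /andP[t0 _]; apply: gG; exact: ltW.
have d2 : 0 < `|d| ^+ 2 by rewrite exprn_gt0.
have n1 : \forall T \near +oo, `|0 - T^-1 * (I T - j' * tau T)| <= `|d| ^+ 2.
  by move/cvgrPdist_le: av1; apply.
have n2 : \forall T \near +oo, `|j - T^-1 * Ix T| <= `|d| ^+ 2.
  by move/cvgrPdist_le: av0; apply.
near=> T.
have T0 : 0 < T by [].
have h1 : `|0 - T^-1 * (I T - j' * tau T)| <= `|d| ^+ 2 by near: T.
have h2 : `|j - T^-1 * Ix T| <= `|d| ^+ 2 by near: T.
have h3 : 2 * (m%:R * B * c) <= `|d| ^+ 2 * T.
  rewrite [leRHS]mulrC -ler_pdivrMr//; apply: ltW; near: T; apply: nbhs_pinfty_gt.
have {}h1 : `|I T - j' * tau T| <= `|d| ^+ 2 * T.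
  move: h1; rewrite sub0r normrN normrM normfV (gtr0_norm T0) ler_pdivrMl//.
  by rewrite (mulrC T).
have {}h2 : `|Ix T - j * T| <= `|d| ^+ 2 * T.
  have -> : Ix T - j * T = - ((j - T^-1 * Ix T) * T) by field; rewrite gt_eqF.
  by rewrite normrN normrM (gtr0_norm T0) ler_wpM2r// ltW.
have h4 := HT _ (ltW T0); have h5 := drift _ (ltW T0); have h6 := aG _ (ltW T0).
have h7 := vwB _ (ltW T0); have h8 := vwB _ (lexx 0).
(* The four errors: H, the two averages, and the boundary terms of <v, w>, each
   at most a multiple of d^2 * T once T is large. *)
have H0 : H 0 = vw 0 by rewrite /H I0 Ix0 tau0 a0; ring.
pose Dj := j' - j.
have main : `|Dj * tau T - d * a T| <= k3 * (`|d| ^+ 2 * T).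
  have -> : Dj * tau T - d * a T = (H T - H 0) - (I T - j' * tau T)
      + (Ix T - j * T) - vw T + vw 0 by rewrite H0 /H /Dj; ring.
  apply: le_trans (ler_normD _ _) _; apply: le_trans (lerD (ler_normB _ _) (lexx _)) _.
  apply: le_trans (lerD (lerD (ler_normD _ _) (lexx _)) (lexx _)) _.
  apply: le_trans (lerD (lerD (lerD (ler_normB _ _) (lexx _)) (lexx _)) (lexx _)) _.
  by rewrite /k3; lra.
have d1' : `|d| <= 1 by lra.
have Djd : `|Dj| <= 2 * (G + k3) * `|d|.
  have tau2 : T / 2 <= `|tau T|.
    move: h5; rewrite ler_norml => /andP[h5 _].
    have : c * T <= 1 / 2 * T by rewrite ler_wpM2r// ltW.
    by move=> ?; apply: le_trans (ler_norm _); lra.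
  have q1 : `|Dj| * (T / 2) <= `|Dj * tau T|.
    by rewrite normrM ler_wpM2l.
  have q2 : `|Dj * tau T| <= `|d| * (G * T) + k3 * (`|d| ^+ 2 * T).
    rewrite -[Dj * tau T](subrK (d * a T)); apply: le_trans (ler_normD _ _) _.
    by rewrite addrC lerD// normrM ler_wpM2l.
  have q3 : `|d| ^+ 2 * T <= `|d| * T.
    by rewrite ler_wpM2r ?(ltW T0)// expr2 ler_piMl.
  have q4 := ler_wpM2l k30 q3.
  rewrite -(ler_pM2r T0).
  by lra.
have fin : `|Dj * T - d * a T| <= C3 * (`|d| ^+ 2 * T).
  have -> : Dj * T - d * a T = (Dj * tau T - d * a T) - Dj * (tau T - T) by ring.
  apply: le_trans (ler_normB _ _) _; rewrite normrM.
  have q1 : `|Dj| * `|tau T - T| <= 2 * (G + k3) * `|d| * (c * T).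
    by rewrite ler_pM.
  have -> : C3 * (`|d| ^+ 2 * T) = k3 * (`|d| ^+ 2 * T) + 2 * (G + k3) * `|d| * (c * T).
    by rewrite /C3 /c; ring.
  exact: lerD.
have -> : Dj / d - T^-1 * a T = (Dj * T - d * a T) / (d * T).
  by field; rewrite dN0 gt_eqF.
rewrite normrM normfV normrM (gtr0_norm T0) ler_pdivrMr ?mulr_gt0//.
by apply: le_trans fin _; rewrite le_eqVlt; apply/orP; left; apply/eqP; ring.
Unshelve. all: by end_near. Qed.

End SensitivityEstimate.

(** * Existence, uniqueness and the sensitivity formula *)

Theorem theorem2p2 (R : realType) (m : nat)
    (f : 'rV[R]_m * R -> 'rV[R]_m) (J : 'rV[R]_m * R -> R)
    (U : set 'rV[R]_m) (Javg : R -> R)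
    (s : R) (A : set 'rV[R]_m) (Vp Vm : 'rV[R]_m -> 'M[R]_m) :
  smooth f -> smooth J ->
  open U ->
  is_J_avg f J U Javg ->
  global_attractor f s U A ->
  uniform_hyperbolic f s A Vp Vm ->
  forall u : R -> 'rV[R]_m,
    trajectory f s u -> (forall t, 0 <= t -> A (u t)) ->
    exists v : R -> 'rV[R]_m,
      [/\ adjoint_shadowing f J s Vp Vm u v,
          forall w : R -> 'rV[R]_m, adjoint_shadowing f J s Vp Vm u w ->
            forall t, 0 <= t -> w t = v t,
          derivable Javg s 1 &
          has_time_average
            (fun t => dot (v t) (f_s f (u t) s) + J_s J (u t) s)
            (derive1 Javg s)].
Proof.
move=> f_smooth J_smooth U_open J_avg [A_compact AU inv _] hyp u tu uA.
have [x [x_orbit x0 x_A]] := inv _ (uA 0 (lexx 0)).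
have x_U : U (x 0) by exact: AU.
have ux := trajectory_eq_orbit f_smooth x_orbit tu (esym x0).
have xc : continuous x := orbit_continuous x_orbit.
have [Phi [Psi [Ps [q [K [l [F S D qK]]]]]]] :=
  orbit_dichotomy f_smooth A_compact hyp x_orbit x_A.
have [v [vd v0 [B vB] vf]] :=
  adjoint_exists f_smooth J_smooth A_compact x_orbit x_A F S D qK (Javg s).
have adj : adjoint_shadowing f J s Vp Vm u v.
  split.
  - move=> t t0; exists (- (v t *m (f_u f (x t) s)^T) - J_u J (x t) s).
      exact: is_derive_ge0_of.
    by rewrite ux// addrAC addNr sub0r.
  - by rewrite /adjoint_unstable_proj -x0.
  - exists (m%:R * B) => t t0; apply: le_trans (enorm_le_norm _) _.
    by rewrite ler_wpM2l// vB.
  - have Jxc : continuous (fun t => J (x t, s)).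
      by apply: continuous_along => //; exact: smooth_continuous.
    have [Ix [Ix0 Ixd]] := antiderivative_exists Jxc.
    have av := orbit_average f_smooth J_smooth J_avg x_orbit x_U Ix0 Ixd.
    have gc : continuous (fun t => Javg s - J (x t, s)).
      by move=> t; apply: cvgB; [exact: cvg_cst|exact: Jxc].
    have Gd (t : R) : is_derive t 1 (fun r => Javg s * r - Ix r) (Javg s - J (x t, s)).
      have cd : is_derive t 1 (fun r : R => Javg s * r) (Javg s).
        by have := @is_deriveZ _ _ _ id (Javg s) t 1 1 (is_derive_id t 1); rewrite [_ *: 1]mulr1.
      exact: is_deriveB cd (Ixd t).
    have G0 : Javg s * 0 - Ix 0 = 0 by rewrite Ix0 mulr0 subr0.
    have gE t : 0 <= t -> dot (v t) (f (u t, s)) = Javg s - J (x t, s).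
      by move=> t0; rewrite ux.
    apply: (has_time_averageP _ gc Gd G0 gE).2.
    have cv : Javg s - T^-1 * Ix T @[T --> +oo] --> Javg s - Javg s.
      by apply: cvgB; [exact: cvg_cst|exact: av].
    rewrite subrr in cv; apply: cvg_trans cv; apply: near_eq_cvg; near=> T.
    have T0 : 0 < T by [].
    by field; rewrite gt_eqF.
have gc := sensitivity_density_continuous f_smooth J_smooth x_orbit vd.
have [a [a0 ad]] := antiderivative_exists gc.
have [d1 [C [d10 C0 est]]] := sensitivity_estimate f_smooth J_smooth U_open J_avg
  A_compact x_orbit x_A x_U F S D qK vd vB vf a0 ad.
have [L [aL DL]] := common_limit d10 C0 est.
exists v; split=> //.
- move=> w adjw.
  exact: (adjoint_unique f_smooth J_smooth x_orbit F S D erefl ux vd vf adj adjw).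
- apply/cvg_ex; exists L; rewrite (_ : (fun h => _) = (fun d => (Javg (s + d) - Javg s) / d))//.
  apply/funext => h.
  have -> : (Javg \o shift s) (h *: 1) = Javg (s + h) by rewrite /= [h *: 1]mulr1 addrC.
  by rewrite [RHS]mulrC.
- have -> : derive1 Javg s = L.
    rewrite /derive1 (_ : (fun h => _) = (fun d => (Javg (s + d) - Javg s) / d)).
      exact: cvg_lim DL.
    by apply/funext => h; rewrite (addrC h s) [RHS]mulrC.
  apply: (has_time_averageP _ gc ad a0 _).2 => //.
  by move=> t t0; rewrite /sensitivity_density ux.
Unshelve. all: by end_near. Qed.
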